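(* For $i=1,2$ let $\Gamma_i$ be a countable discrete group with identity $e_i$ and let $\Gamma_i\curvearrowright G_i$ be a topologically free action on a groupoid. Consider the following statements: (1) $\Gamma_1\curvearrowright G_1\sim_{\rm coe}\Gamma_2\curvearrowright G_2$ (continuous orbit equivalence); (2) there exists an isomorphism of topological groupoids $\psi:\Gamma_1\ltimes G_1\to\Gamma_2\ltimes G_2$ such that $\psi(\Gamma_1\times G_1^{(0)})=\Gamma_2\times G_2^{(0)}$ and $\psi(\{e_1\}\times G_1)=\{e_2\}\times G_2$; (3) there exists a $*$-isomorphism $\theta:C^*_r(\Gamma_1\ltimes G_1)\to C^*_r(\Gamma_2\ltimes G_2)$ such that $\theta(C_0(G_1^{(0)}))=C_0(G_2^{(0)})$, $\theta(\Gamma_1\ltimes_rC_0(G_1^{(0)}))=\Gamma_2\ltimes_rC_0(G_2^{(0)})$, and $\theta(C^*_r(G_1))=C^*_r(G_2)$. Then $(1)\Leftrightarrow(2)\Rightarrow(3)$. If the two actions are topologically principally free, then (1), (2), (3) are equivalent.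
   Context: Conventions: all groupoids are locally compact, Hausdorff, second countable and étale; groups are countable discrete; an isomorphism of topological groupoids is an algebraic isomorphism that is a homeomorphism. $r,s$ denote range and source. An action $\Gamma\curvearrowright G$ on a topological groupoid is a homomorphism from $\Gamma$ to the group of topological groupoid automorphisms of $G$. It is topologically free if for each $\gamma\neq e$ the set $\{u\in G^{(0)}:\gamma u\neq u\}$ is dense in $G^{(0)}$. It is topologically principally free if there is a dense subset $U\subseteq G^{(0)}$ such that for every $u\in U$, every $g\in G$ with $s(g)=u$ and every $\gamma\in\Gamma$, $\gamma r(g)=s(g)$ forces $\gamma=e$ and $g\in G^{(0)}$. $\Gamma\ltimes G$ is $\Gamma\times G$ with $(\gamma,g)(\gamma',g')=(\gamma\gamma',(\gamma'^{-1}g)g')$ and $(\gamma,g)^{-1}=(\gamma^{-1},\gamma g^{-1})$. $\Gamma_1\curvearrowright G_1\sim_{\rm coe}\Gamma_2\curvearrowright G_2$ means: there are a topological groupoid isomorphism $\phi:G_1\to G_2$ and continuous maps $a:\Gamma_1\times G_1^{(0)}\to\Gamma_2$, $b:\Gamma_2\times G_2^{(0)}\to\Gamma_1$ such that for all $\gamma_i\in\Gamma_i$, $g_i\in G_i$: $\phi(\gamma_1g_1)=a(\gamma_1,r(g_1))\phi(g_1)=a(\gamma_1,s(g_1))\phi(g_1)$ and $\phi^{-1}(\gamma_2g_2)=b(\gamma_2,r(g_2))\phi^{-1}(g_2)=b(\gamma_2,s(g_2))\phi^{-1}(g_2)$. The open subgroupoids $\{e\}\times G\cong G$, $\Gamma\ltimes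 G^{(0)}$ and $G^{(0)}$ of $\Gamma\ltimes G$ give canonical embeddings of $C^*_r(G)$, $\Gamma\ltimes_rC_0(G^{(0)})\cong C^*_r(\Gamma\ltimes G^{(0)})$ and $C_0(G^{(0)})$ into $C^*_r(\Gamma\ltimes G)$; the subalgebras in (3) are these images. *)

(* Defs.v *)
From HB Require Import structures.
From mathcomp Require Import all_boot all_order all_algebra.
From mathcomp Require Import complex.
From mathcomp Require Import all_classical all_reals all_analysis.
From mathcomp Require summability.

Set Implicit Arguments.
Unset Strict Implicit.
Unset Printing Implicit Defensive.

Import Order.TTheory GRing.Theory Num.Theory.
Import numFieldNormedType.Exports.

Local Open Scope classical_set_scope.
Local Open Scope ring_scope.

(* Units are elements of the groupoid, and [src], [rng] take values in them.
   [gmul] is total for convenience; it is meaningful, and constrained, only on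
   composable pairs, i.e. when [src g = rng h]. *)
Record topGroupoid := TopGroupoid {
  gcarrier :> topologicalType ;
  src : gcarrier -> gcarrier ;
  rng : gcarrier -> gcarrier ;
  gmul : gcarrier -> gcarrier -> gcarrier ;
  ginv : gcarrier -> gcarrier ;
  src_src : forall g, src (src g) = src g ;
  rng_src : forall g, rng (src g) = src g ;
  src_rng : forall g, src (rng g) = rng g ;
  rng_rng : forall g, rng (rng g) = rng g ;
  src_gmul : forall g h, src g = rng h -> src (gmul g h) = src h ;
  rng_gmul : forall g h, src g = rng h -> rng (gmul g h) = rng g ;
  gmulA : forall g h k, src g = rng h -> src h = rng k ->
    gmul g (gmul h k) = gmul (gmul g h) k ;
  gmul_src : forall g, gmul g (src g) = g ;
  gmul_rng : forall g, gmul (rng g) g = g ;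
  src_ginv : forall g, src (ginv g) = rng g ;
  rng_ginv : forall g, rng (ginv g) = src g ;
  gmulVg : forall g, gmul (ginv g) g = src g ;
  gmulgV : forall g, gmul g (ginv g) = rng g ;
  src_continuous : continuous src ;
  rng_continuous : continuous rng ;
  ginv_continuous : continuous ginv ;
  gmul_continuous :
    {within [set p : gcarrier * gcarrier | src p.1 = rng p.2],
      continuous (fun p => gmul p.1 p.2)} }.

Arguments src {t} _.
Arguments rng {t} _.
Arguments gmul {t} _ _.
Arguments ginv {t} _.

Definition composable (G : topGroupoid) (g h : G) := src g = rng h.

Definition units (G : topGroupoid) : set G := [set u | src u = u].

Arguments units : clear implicits.

Lemma units_src (G : topGroupoid) (g : G) : src g \in units G.
Proof. by apply/mem_set; exact: src_src. Qed.

Lemma units_rng (G : topGroupoid) (g : G) : rng g \in units G.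
Proof. by apply/mem_set; exact: src_rng. Qed.

Definition usrc (G : topGroupoid) (g : G) : set_type (units G) :=
  exist _ (src g) (units_src g).

Definition urng (G : topGroupoid) (g : G) : set_type (units G) :=
  exist _ (rng g) (units_rng g).

Definition local_homeomorphism (X Y : topologicalType) (f : X -> Y) :=
  forall x, exists2 U : set X, open_nbhs x U &
    [/\ open (f @` U),
        {within U, continuous f} &
        exists2 k : Y -> X, (forall y, U y -> k (f y) = y) &
          {within f @` U, continuous k}].

Record lcsc_hausdorff_etale (G : topGroupoid) : Prop := {
  etale_locally_compact : locally_compact [set: G] ;
  etale_hausdorff : hausdorff_space G ;
  etale_second_countable : @second_countable G ;
  etale_src : local_homeomorphism (@usrc G) ;
  etale_rng : local_homeomorphism (@urng G) }.

Definition groupoid_morphism (G H : topGroupoid) (phi : G -> H) :=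
  forall g h : G, composable g h ->
    composable (phi g) (phi h) /\ phi (gmul g h) = gmul (phi g) (phi h).

Definition groupoid_iso_with (G H : topGroupoid)
    (phi : G -> H) (psi : H -> G) :=
  [/\ cancel phi psi, cancel psi phi,
      groupoid_morphism phi, groupoid_morphism psi &
      continuous phi /\ continuous psi].

Definition groupoid_iso (G H : topGroupoid) (phi : G -> H) :=
  exists psi : H -> G, groupoid_iso_with phi psi.

Section SpaceGroupoid.
Variable X : topologicalType.

Definition space_mul (x y : X) := x.

Lemma space_mulA (x y z : X) : x = y -> y = z ->
  space_mul x (space_mul y z) = space_mul (space_mul x y) z.
Proof. by []. Qed.

Lemma space_mul_continuous : {within [set p : X * X | p.1 = p.2],
  continuous (fun p => space_mul p.1 p.2)}.
Proof. by apply: continuous_subspaceT => p; exact: cvg_fst. Qed.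

Lemma space_id_continuous : continuous (@idfun X).
Proof. by move=> x; exact: cvg_id. Qed.

Definition space_groupoid : topGroupoid :=
  @TopGroupoid X idfun idfun space_mul idfun
    (fun _ => erefl) (fun _ => erefl) (fun _ => erefl) (fun _ => erefl)
    (fun _ _ => id) (fun _ _ _ => erefl) space_mulA
    (fun _ => erefl) (fun _ => erefl) (fun _ => erefl) (fun _ => erefl)
    (fun _ => erefl) (fun _ => erefl)
    space_id_continuous space_id_continuous space_id_continuous
    space_mul_continuous.

End SpaceGroupoid.

Record gpd_action (Gamma : groupType) (G : topGroupoid) := GpdAction {
  act :> Gamma -> G -> G ;
  act1 : forall g, act 1%g g = g ;
  actM : forall gamma delta g,
    act (gamma * delta)%g g = act gamma (act delta g) ;
  act_iso : forall gamma, groupoid_iso (act gamma) }.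

Section ActionTheory.
Variables (Gamma : groupType) (G : topGroupoid) (alpha : gpd_action Gamma G).

Lemma act_composable gamma (g h : G) :
  composable g h -> composable (alpha gamma g) (alpha gamma h).
Proof. by case: (act_iso alpha gamma) => ? [_ _ m _ _] /m[]. Qed.

Lemma act_gmul gamma (g h : G) : composable g h ->
  alpha gamma (gmul g h) = gmul (alpha gamma g) (alpha gamma h).
Proof. by case: (act_iso alpha gamma) => ? [_ _ m _ _] /m[]. Qed.

Lemma act_continuous gamma : continuous (alpha gamma).
Proof. by case: (act_iso alpha gamma) => ? [_ _ _ _ []]. Qed.

Lemma act_src gamma (g : G) : src (alpha gamma g) = alpha gamma (src g).
Proof.
have c1 : composable g (src g) by rewrite /composable rng_src.
have c2 : composable (src g) (src g) by rewrite /composable rng_src src_src.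
have e1 := act_composable gamma c1; have e2 := act_composable gamma c2.
have i : gmul (alpha gamma (src g)) (alpha gamma (src g)) = alpha gamma (src g).
  by rewrite -act_gmul// -[X in gmul _ X]src_src gmul_src.
have /(congr1 (gmul (ginv (alpha gamma (src g))))) := i.
rewrite gmulA ?src_ginv// gmulVg e2 gmul_rng => ->.
by rewrite -e2 e1 e2.
Qed.

Lemma act_rng gamma (g : G) : rng (alpha gamma g) = alpha gamma (rng g).
Proof.
have : composable (rng g) g by rewrite /composable src_rng.
by move=> /(act_composable gamma) <-; rewrite act_src src_rng.
Qed.

Lemma act_ginv gamma (g : G) : ginv (alpha gamma g) = alpha gamma (ginv g).
Proof.
rewrite -[LHS]gmul_src src_ginv act_rng -gmulgV act_gmul; last first.
  by rewrite /composable rng_ginv.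
rewrite gmulA ?src_ginv// ?gmulVg; last by rewrite act_src act_rng rng_ginv.
by rewrite act_src -rng_ginv -act_rng gmul_rng.
Qed.

Lemma actK gamma (g : G) : alpha (gamma^-1)%g (alpha gamma g) = g.
Proof. by rewrite -actM mulVg act1. Qed.

Lemma actKV gamma (g : G) : alpha gamma (alpha (gamma^-1)%g g) = g.
Proof. by rewrite -actM mulgV act1. Qed.

End ActionTheory.

Definition topologically_free (Gamma : groupType) (G : topGroupoid)
    (alpha : gpd_action Gamma G) :=
  forall gamma : Gamma, gamma <> 1%g ->
    units G `<=` closure [set u | units G u /\ alpha gamma u <> u].

Definition topologically_principally_free (Gamma : groupType) (G : topGroupoid)
    (alpha : gpd_action Gamma G) :=
  exists U : set G, [/\ U `<=` units G, units G `<=` closure U &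
    forall (u : G) (g : G) (gamma : Gamma), U u -> src g = u ->
      alpha gamma (rng g) = src g -> gamma = 1%g /\ units G g].

Section SemiDirect.
Variables (Gamma : groupType) (G : topGroupoid) (alpha : gpd_action Gamma G).

Local Notation D := (discrete_topology Gamma).
Local Notation T := (D * G)%type.

(* Composability in the semidirect product reads [src g = gamma' (rng g')];
   [sd_src x] and [sd_rng x] are [x^-1 x] and [x x^-1]. *)
Definition sd_src (x : T) : T := (1%g : Gamma, src x.2).
Definition sd_rng (x : T) : T := (1%g : Gamma, alpha x.1 (rng x.2)).
Definition sd_mul (x y : T) : T :=
  ((x.1 * y.1)%g : Gamma, gmul (alpha (y.1^-1)%g x.2) y.2).
Definition sd_inv (x : T) : T := ((x.1^-1)%g : Gamma, alpha x.1 (ginv x.2)).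

Lemma sd_compE (x y : T) :
  sd_src x = sd_rng y -> src x.2 = alpha y.1 (rng y.2).
Proof. by case. Qed.

Lemma sd_compV (x y : T) : sd_src x = sd_rng y ->
  src (alpha (y.1^-1)%g x.2) = rng y.2.
Proof. by move=> /sd_compE e; rewrite act_src e actK. Qed.

Lemma sd_src_src x : sd_src (sd_src x) = sd_src x.
Proof. by rewrite /sd_src /= src_src. Qed.

Lemma sd_rng_src x : sd_rng (sd_src x) = sd_src x.
Proof. by rewrite /sd_src /sd_rng /= act1 rng_src. Qed.

Lemma sd_src_rng x : sd_src (sd_rng x) = sd_rng x.
Proof. by rewrite /sd_src /sd_rng /= act_src src_rng. Qed.

Lemma sd_rng_rng x : sd_rng (sd_rng x) = sd_rng x.
Proof. by rewrite /sd_rng /= act1 act_rng rng_rng. Qed.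

Lemma sd_src_mul x y : sd_src x = sd_rng y -> sd_src (sd_mul x y) = sd_src y.
Proof. by move=> /sd_compV e; rewrite /sd_src /sd_mul /= src_gmul. Qed.

Lemma sd_rng_mul x y : sd_src x = sd_rng y -> sd_rng (sd_mul x y) = sd_rng x.
Proof.
move=> /sd_compV e.
by rewrite /sd_rng /sd_mul /= rng_gmul// actM act_rng actKV.
Qed.

Lemma sd_mulA x y z : sd_src x = sd_rng y -> sd_src y = sd_rng z ->
  sd_mul x (sd_mul y z) = sd_mul (sd_mul x y) z.
Proof.
move=> /sd_compV exy /sd_compV eyz; rewrite /sd_mul /= mulgA; congr (_, _).
rewrite invgM actM act_gmul// gmulA//.
by rewrite act_src exy act_rng.
Qed.

Lemma sd_mul_src x : sd_mul x (sd_src x) = x.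
Proof. by case: x => a g; rewrite /sd_mul /= mulg1 invg1 act1 gmul_src. Qed.

Lemma sd_mul_rng x : sd_mul (sd_rng x) x = x.
Proof. by case: x => a g; rewrite /sd_mul /= mul1g actK gmul_rng. Qed.

Lemma sd_src_inv x : sd_src (sd_inv x) = sd_rng x.
Proof. by rewrite /sd_src /sd_rng /= act_src src_ginv. Qed.

Lemma sd_rng_inv x : sd_rng (sd_inv x) = sd_src x.
Proof. by rewrite /sd_src /sd_rng /= act_rng rng_ginv actK. Qed.

Lemma sd_mulVg x : sd_mul (sd_inv x) x = sd_src x.
Proof. by rewrite /sd_mul /sd_src /= mulVg actK gmulVg. Qed.

Lemma sd_mulgV x : sd_mul x (sd_inv x) = sd_rng x.
Proof.
rewrite /sd_mul /sd_rng /= mulgV invgK -act_gmul ?gmulgV//.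
by rewrite /composable rng_ginv.
Qed.

Lemma sd_slice_continuous (Y : topologicalType) (f : T -> Y) :
  (forall gamma : Gamma, continuous (fun g => f (gamma, g))) -> continuous f.
Proof.
move=> cf [gamma g] A /(cf gamma g) nA.
exists ([set (gamma : D)], [set h | A (f (gamma, h))]) => /=.
  by split => //; exact: discrete_set1.
by move=> [d h] /= [-> ?].
Qed.

Lemma sd_pair_continuous (X : topologicalType) (gamma : Gamma) (f : X -> G) :
  continuous f -> continuous (fun x => (gamma, f x) : T).
Proof. move=> cf x.
apply: (@cvg_pair _ _ _ (nbhs x) (nbhs (gamma : D)) (nbhs (f x))).
  exact: cvg_cst.
exact: cf. Qed.

Lemma sd_src_continuous : continuous sd_src.
Proof.
apply: sd_slice_continuous => gamma.
exact: (@sd_pair_continuous _ 1%g _ (@src_continuous G)).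
Qed.

Lemma sd_rng_continuous : continuous sd_rng.
Proof.
apply: sd_slice_continuous => gamma.
apply: (@sd_pair_continuous _ 1%g (alpha gamma \o rng)) => g.
by apply: continuous_comp; [apply: rng_continuous|apply: act_continuous].
Qed.

Lemma sd_inv_continuous : continuous sd_inv.
Proof.
apply: sd_slice_continuous => gamma.
apply: (@sd_pair_continuous _ (gamma^-1)%g (alpha gamma \o ginv)) => g.
by apply: continuous_comp; [apply: ginv_continuous|apply: act_continuous].
Qed.

Lemma sd_mul_continuous : {within [set p : T * T | sd_src p.1 = sd_rng p.2],
  continuous (fun p => sd_mul p.1 p.2)}.
Proof.
apply/subspace_continuousP => -[[a g] [b h]] /= cp V nV.
have nW : nbhs (gmul (alpha (b^-1)%g g) h) [set k | V ((a * b)%g, k)].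
  have cid : continuous (@idfun G) by move=> x; exact: cvg_id.
  exact: (@sd_pair_continuous G (a * b)%g _ cid
    (gmul (alpha (b^-1)%g g) h) V nV).
have /subspace_continuousP := @gmul_continuous G.
move=> /(_ (alpha (b^-1)%g g, h) (sd_compV cp) _ nW); rewrite /within /= => nC.
have cphi : continuous (fun p : T * T => (alpha (b^-1)%g p.1.2, p.2.2)).
  move=> p; apply: (@cvg_pair _ _ _ (nbhs p)
    (nbhs (alpha (b^-1)%g p.1.2)) (nbhs p.2.2)); last first.
    by apply: continuous_comp; [exact: cvg_snd|exact: cvg_snd].
  apply: (@continuous_comp _ _ _ (fun p : T * T => p.1.2)).
    by apply: continuous_comp; [exact: cvg_fst|exact: cvg_snd].
  exact: act_continuous.
have nA : nbhs ((a, g) : T, (b, h) : T) [set p : T * T | p.1.1 = a].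
  have c : continuous (fun p : T * T => p.1.1).
    by move=> p; apply: continuous_comp; [exact: cvg_fst|exact: cvg_fst].
  exact: (c ((a, g), (b, h)) _ (discrete_set1 (a : D))).
have nB : nbhs ((a, g) : T, (b, h) : T) [set p : T * T | p.2.1 = b].
  have c : continuous (fun p : T * T => p.2.1).
    by move=> p; apply: continuous_comp; [exact: cvg_snd|exact: cvg_fst].
  exact: (c ((a, g), (b, h)) _ (discrete_set1 (b : D))).
have nP := cphi ((a, g), (b, h)) _ nC.
change (nbhs ((a, g) : T, (b, h) : T)
  [set p | sd_src p.1 = sd_rng p.2 -> V (sd_mul p.1 p.2)]).
near=> p => cpp.
have pa : p.1.1 = a by near: p.
have pb : p.2.1 = b by near: p.
have := sd_compV cpp; rewrite pb => e.
have : src (alpha (b^-1)%g p.1.2) = rng p.2.2 ->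
  V ((a * b)%g, gmul (alpha (b^-1)%g p.1.2) p.2.2) by near: p.
by move=> /(_ e); rewrite /sd_mul pa pb.
Unshelve. all: by end_near.
Qed.

Definition semidirect : topGroupoid :=
  @TopGroupoid T sd_src sd_rng sd_mul sd_inv
    sd_src_src sd_rng_src sd_src_rng sd_rng_rng sd_src_mul sd_rng_mul sd_mulA
    sd_mul_src sd_mul_rng sd_src_inv sd_rng_inv sd_mulVg sd_mulgV
    sd_src_continuous sd_rng_continuous sd_inv_continuous sd_mul_continuous.

End SemiDirect.

Section UnitAction.
Variables (Gamma : groupType) (G : topGroupoid) (alpha : gpd_action Gamma G).

Lemma act_units gamma (u : set_type (units G)) :
  alpha gamma (val u) \in units G.
Proof.
by apply/mem_set; rewrite /units /= act_src; congr (alpha gamma _);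
  exact: (set_mem (valP u)).
Qed.

Definition unit_act (gamma : Gamma) (u : set_type (units G)) :
    set_type (units G) :=
  exist _ (alpha gamma (val u)) (act_units gamma u).

Lemma unit_act1 u : unit_act 1%g u = u.
Proof. by apply: val_inj => /=; rewrite act1. Qed.

Lemma unit_actM gamma delta u :
  unit_act (gamma * delta)%g u = unit_act gamma (unit_act delta u).
Proof. by apply: val_inj => /=; rewrite actM. Qed.

Lemma unit_act_continuous gamma : continuous (unit_act gamma).
Proof.
apply: (@continuous_comp_initial (set_type (units G))
  (set_type (units G)) G val (unit_act gamma)) => u.
have cv : continuous (val : set_type (units G) -> G).
  exact: initial_continuous.
exact: (continuous_comp (cv u) (@act_continuous _ _ alpha gamma (val u))).
Qed.

Lemma unit_act_iso gamma :
  @groupoid_iso (space_groupoid (set_type (units G)))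
    (space_groupoid (set_type (units G))) (unit_act gamma).
Proof.
exists (unit_act (gamma^-1)%g); split;
  last by split; exact: unit_act_continuous.
- by move=> u; rewrite -unit_actM mulVg unit_act1.
- by move=> u; rewrite -unit_actM mulgV unit_act1.
- by move=> u v; rewrite /composable /= => ->.
- by move=> u v; rewrite /composable /= => ->.
Qed.

Definition unit_action :
    gpd_action Gamma (space_groupoid (set_type (units G))) :=
  @GpdAction Gamma (space_groupoid (set_type (units G))) unit_act
    unit_act1 unit_actM unit_act_iso.

End UnitAction.

Definition coe (Gamma1 Gamma2 : groupType) (G1 G2 : topGroupoid)
    (alpha1 : gpd_action Gamma1 G1) (alpha2 : gpd_action Gamma2 G2) :=
  exists (phi : G1 -> G2) (psi : G2 -> G1)
    (a : discrete_topology Gamma1 * set_type (units G1) ->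
         discrete_topology Gamma2)
    (b : discrete_topology Gamma2 * set_type (units G2) ->
         discrete_topology Gamma1),
  [/\ groupoid_iso_with phi psi, continuous a, continuous b,
      forall gamma g,
        phi (alpha1 gamma g) = alpha2 (a (gamma, urng g)) (phi g) /\
        phi (alpha1 gamma g) = alpha2 (a (gamma, usrc g)) (phi g) &
      forall gamma g,
        psi (alpha2 gamma g) = alpha1 (b (gamma, urng g)) (psi g) /\
        psi (alpha2 gamma g) = alpha1 (b (gamma, usrc g)) (psi g)].

Section L2.
Variables (R : realType) (T : choiceType).

Definition l2normsq (xi : T -> R[i]) : \bar R :=
  \esum_(x in [set: T]) ((Normc.normc (xi x)) ^+ 2)%:E.

Definition l2 : set (T -> R[i]) := [set xi | (l2normsq xi < +oo)%E].

(* An unordered sum, absolutely convergent when [xi] and [eta] are in [l2]. *)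
Definition l2inner (xi eta : T -> R[i]) : R[i] :=
  @summability.sum T R[i] R[i]^o (fun x => xi x * (eta x)^*).

Definition oper := (T -> R[i]) -> (T -> R[i]).

Definition opnorm_le (A : oper) (M : R) :=
  forall xi, l2 xi -> (l2normsq (A xi) <= (M ^+ 2)%:E * l2normsq xi)%E.

(* Bounded operators on [l^2(T)]; they are extended by 0 outside [l2], so that
   equality in [oper] is equality of operators on [l^2(T)]. *)
Record bounded_oper (A : oper) : Prop := {
  bounded_oper_linear : forall (c : R[i]) xi eta, l2 xi -> l2 eta ->
    A (c *: xi + eta) = c *: A xi + A eta ;
  bounded_oper_bounded : exists M : R, opnorm_le A M ;
  bounded_oper_out : forall xi, ~ l2 xi -> A xi = 0 }.

Definition adjoint (A B : oper) :=
  forall xi eta, l2 xi -> l2 eta -> l2inner (A xi) eta = l2inner xi (B eta).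

Definition oper_cvg (A_ : nat -> oper) (A : oper) :=
  forall e : R, 0 < e -> \forall n \near \oo, opnorm_le (A_ n - A) e.

End L2.

(* [theta] restricts to a *-isomorphism of [A] onto [B]; its values outside [A]
   are irrelevant. *)
Record star_iso (R : realType) (T1 T2 : choiceType)
    (A : set (oper R T1)) (B : set (oper R T2))
    (theta : oper R T1 -> oper R T2) : Prop := {
  star_iso_bij : set_bij A B theta ;
  star_isoD : forall S T, A S -> A T -> theta (S + T) = theta S + theta T ;
  star_isoZ : forall (c : R[i]) S, A S -> theta (c *: S) = c *: theta S ;
  star_isoM : forall S T, A S -> A T -> theta (S \o T) = theta S \o theta T ;
  star_isoJ : forall S T, A S -> A T -> adjoint S T ->
    adjoint (theta S) (theta T) }.

Section FunctionSpaces.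
Variables (R : realType) (X : topologicalType).

Definition Cc : set (X -> R[i]) := [set f | continuous (f : X -> R[i]^o) /\
  compact (closure [set x | f x != 0])].

Definition C0 : set (X -> R[i]) := [set f | continuous (f : X -> R[i]^o) /\
  forall e : R, 0 < e -> exists2 K : set X, compact K &
    forall x, ~ K x -> Normc.normc (f x) < e].

End FunctionSpaces.

Section ReducedAlgebra.
Variables (R : realType) (G : topGroupoid).

Definition convol (f xi : G -> R[i]) (g : G) : R[i] :=
  \sum_(h \in [set h | rng h = rng g]) f h * xi (gmul (ginv h) g).

(* The direct sum over the units [u] of the left regular representations on
   [l^2(src^-1(u))]; the direct sum of these Hilbert spaces is [l^2(G)]. *)
Definition lambda (f : G -> R[i]) : oper R G :=
  fun xi => if `[< l2 xi >] then convol f xi else 0.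

(* The completion of [Cc(G)] in the reduced norm [f |-> ||lambda f||],
   realised as the norm closure of [lambda (Cc(G))]. *)
Definition Cstar : set (oper R G) := [set A | bounded_oper A /\
  forall e : R, 0 < e -> exists2 f : G -> R[i],
    Cc f & opnorm_le (lambda f - A) e].

End ReducedAlgebra.

Section Embeddings.
Variable R : realType.

(* Extension by zero along an injection [j]: the sum has at most one term. *)
Definition extend0 (X Y : choiceType) (j : X -> Y) (f : X -> R[i]) :
    Y -> R[i] :=
  fun y => \sum_(x \in j @^-1` [set y]) f x.

(* Graph of the embedding of [C*_r(H)] into [C*_r(G)] induced by an isomorphism
   [j] of [H] onto an open subgroupoid of [G]: it extends by continuity the
   inclusion of [Cc(H)] into [Cc(G)]. *)
Definition Cstar_embedding (H G : topGroupoid) (j : H -> G)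
    (S : oper R H) (T : oper R G) :=
  exists f_ : nat -> H -> R[i],
    [/\ forall n, Cc (f_ n),
        oper_cvg (fun n => lambda (f_ n)) S &
        oper_cvg (fun n => lambda (extend0 j (f_ n))) T].

Definition Cstar_image (H G : topGroupoid) (j : H -> G) : set (oper R G) :=
  [set T | bounded_oper T /\ exists2 S, Cstar S & Cstar_embedding j S T].

Variables (Gamma : groupType) (G : topGroupoid) (alpha : gpd_action Gamma G).

Definition emb_groupoid (g : G) : semidirect alpha :=
  (1%g : discrete_topology Gamma, g).

Definition emb_crossed (p : semidirect (unit_action alpha)) :
    semidirect alpha :=
  (p.1, val p.2).

Definition emb_units (u : set_type (units G)) : semidirect alpha :=
  (1%g : discrete_topology Gamma, val u).

Definition alg_groupoid : set (oper R (semidirect alpha)) :=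
  Cstar_image emb_groupoid.

(* The reduced crossed product of [C_0] of the unit space by [Gamma] is taken as
   the reduced C*-algebra of the transformation groupoid. *)
Definition alg_crossed : set (oper R (semidirect alpha)) :=
  Cstar_image emb_crossed.

(* Convolution by [extend0 emb_units f] is multiplication by [f \o rng]. *)
Definition alg_units : set (oper R (semidirect alpha)) :=
  [set lambda (extend0 emb_units f) | f in @C0 R (set_type (units G))].

End Embeddings.

Arguments alg_groupoid R [Gamma G] alpha.
Arguments alg_crossed R [Gamma G] alpha.
Arguments alg_units R [Gamma G] alpha.

Definition semidirect_iso_preserving (Gamma1 Gamma2 : groupType)
    (G1 G2 : topGroupoid)
    (alpha1 : gpd_action Gamma1 G1) (alpha2 : gpd_action Gamma2 G2) :=
  exists psi : semidirect alpha1 -> semidirect alpha2,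
    [/\ groupoid_iso psi,
        psi @` [set p | units G1 p.2] = [set p | units G2 p.2] &
        psi @` [set p | p.1 = 1%g] = [set p | p.1 = 1%g]].

Definition Cstar_iso_preserving (R : realType) (Gamma1 Gamma2 : groupType)
    (G1 G2 : topGroupoid)
    (alpha1 : gpd_action Gamma1 G1) (alpha2 : gpd_action Gamma2 G2) :=
  exists theta :
      oper R (semidirect alpha1) -> oper R (semidirect alpha2),
    [/\ star_iso (@Cstar R (semidirect alpha1)) (@Cstar R (semidirect alpha2))
          theta,
        theta @` alg_units R alpha1 = alg_units R alpha2,
        theta @` alg_crossed R alpha1 = alg_crossed R alpha2 &
        theta @` alg_groupoid R alpha1 = alg_groupoid R alpha2].

(* Main.v *)
(* (1) <=> (2): an orbit equivalence [(phi, a, b)] gives the isomorphism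
   [(c, g) |-> (a(c, r g), phi g)].  Topological freeness, together with local
   constancy of [a], turns equalities between the actions of two group elements
   into equalities between the elements: this yields the cocycle identity for
   [a] and [b(a(c, u), phi u) = c].  Conversely [a] and [phi] are read off the
   components of the isomorphism.

   (2) => (3): conjugation by the induced unitary of the l^2 spaces.

   (3) => (2): write [coef T g = <T delta_(s g), delta_g>], and let [t f] be the
   coefficient function of the image under [theta] of a function [f] supported
   on a bisection.  On functions of the units [theta] is composition with a
   homeomorphism, since characters of C_0 are evaluations.  Principality then
   shows that [theta] intertwines the restrictions of coefficients to units,
   hence the inner products of the vectors [f delta_x].  It follows that [t f]
   is again supported on a bisection and that [t f] is nonzero exactly on the
   image under some [psi] of the set where [f] is nonzero; this [psi] is the
   isomorphism of groupoids, and it respects any open subgroupoid whose algebra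
   is respected by [theta].  Only algebraic properties of [theta] and the
   relation between adjoints are used, never its continuity. *)

Require Import Defs.
From mathcomp Require Import all_boot all_order all_algebra.
From mathcomp Require Import complex finmap.
From mathcomp Require Import all_classical all_reals all_analysis.
From mathcomp Require summability.
From mathcomp Require Import ring lra.

Set Implicit Arguments.
Unset Strict Implicit.
Unset Printing Implicit Defensive.

Import Order.TTheory GRing.Theory Num.Theory.
Import numFieldNormedType.Exports.

Local Open Scope classical_set_scope.
Local Open Scope ring_scope.

(** * Square-summable functions *)

(** Convolution by a function supported on a bisection is a weighted partial permutation of the
    coordinates: the sums defining it have at most one nonzero term, so boundedness, products and
    adjoints on [l2] follow by reindexing, with no question of convergence. Bump functions of this
    kind exist at every arrow of an etale groupoid. The reconstruction follows supports of
    coefficient functions instead of germs of normalizers: [g] is sent to the only arrow over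
    [sg (src g)] that survives in the image of a bump function at [g], and a nonzero inner product
    makes the result independent of the bump. Since [theta] is controlled only on [Cstar], its
    inverse is a homomorphism only once [Cstar] is known to be closed under sums and products.
    Products rest on writing a function in [Cc] as a finite sum of bisection functions, the case in
    which [lambda] is known to be multiplicative. *)

Notation nc := Normc.normc.

Section ComplexModulus.
Variable R : realType.
Implicit Types z w : R[i].

Lemma normr_nc z : `|z| = (nc z)%:C%C.
Proof. by []. Qed.

Lemma nc0 : nc (0 : R[i]) = 0.
Proof. exact: Normc.normc0. Qed.

Lemma nc1 : nc (1 : R[i]) = 1.
Proof. exact: Normc.normc1. Qed.

Lemma nc_ge0 z : 0 <= nc z.
Proof. by case: z => a b; exact: sqrtr_ge0. Qed.

Lemma nc_eq0 z : (nc z == 0) = (z == 0).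
Proof. by apply/eqP/eqP => [/Normc.eq0_normc //|->]; exact: nc0. Qed.

Lemma nc_gt0 z : (0 < nc z) = (z != 0).
Proof. by rewrite lt_neqAle nc_ge0 andbT eq_sym nc_eq0. Qed.

Lemma ncM z w : nc (z * w) = nc z * nc w.
Proof. exact: Normc.normcM. Qed.

Lemma ncV z : nc z^-1 = (nc z)^-1.
Proof. exact: Normc.normcV. Qed.

Lemma ler_ncD z w : nc (z + w) <= nc z + nc w.
Proof. exact: le_normcD. Qed.

Lemma ncN z : nc (- z) = nc z.
Proof. exact: normcN. Qed.

Lemma nc_distC z w : nc (z - w) = nc (w - z).
Proof. by rewrite -ncN opprB. Qed.

Lemma nc_real (r : R) : nc r%:C%C = `|r|.
Proof. by rewrite /= expr0n /= addr0 sqrtr_sqr. Qed.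

Lemma nc_conj z : nc z^* = nc z.
Proof. by case: z => a b /=; rewrite sqrrN. Qed.

Lemma mulr_conj z : z * z^* = (nc z ^+ 2)%:C%C.
Proof. by rewrite -normCK normr_nc -rmorphXn. Qed.

(** The norm of [R[i]^o] takes values in [R[i]] itself, so its epsilons are complex numbers; being
    positive they are real, and real epsilons suffice. *)
Lemma nc_cvgP (T : Type) (F : set_system T) (f : T -> R[i]) (l : R[i]) :
  Filter F ->
  (f @ F --> (l : R[i]^o)) <->
  forall e : R, 0 < e -> \forall x \near F, nc (f x - l) < e.
Proof.
move=> FF; split => [/(@cvgrPdist_lt _ R[i]^o) H e e0|H].
  have /H : (0 : R[i]) < e%:C%C by rewrite ltcR.
  by apply: filterS => x; rewrite -normrN opprB normr_nc ltcR.
apply/(@cvgrPdist_lt _ R[i]^o) => e e0.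
have eE : e = (complex.Re e)%:C%C.
  by move: e0; case: e => a b; rewrite ltcE /= => /andP[/eqP -> _].
have e0' : 0 < complex.Re e by move: e0; rewrite {1}eE ltcR.
apply: filterS (H _ e0') => x; rewrite eE -normrN opprB normr_nc ltcR.
by [].
Qed.

Lemma nc_continuousP (X : topologicalType) (f : X -> R[i]) :
  continuous (f : X -> R[i]^o) <->
  forall x (e : R), 0 < e -> \forall y \near x, nc (f y - f x) < e.
Proof. by split=> H x; apply/nc_cvgP; exact: H. Qed.

End ComplexModulus.

Section SquareSummable.
Variables (R : realType) (T : choiceType).
Implicit Types (xi eta : T -> R[i]) (A : set T).

Lemma sqnc_ge0 (z : R[i]) : (0 <= ((nc z) ^+ 2)%:E)%E.
Proof. by rewrite lee_fin sqr_ge0. Qed.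

Definition delta (h : T) : T -> R[i] := fun g => (g == h)%:R.

Lemma l2normsq_delta h : l2normsq (delta h) = 1%E.
Proof.
rewrite /l2normsq (esumID [set h]) => [|x _]; last exact: sqnc_ge0.
rewrite setTI esum_set1 ?sqnc_ge0// /delta eqxx nc1 expr1n esum1 ?adde0//.
by move=> x [_ /= /eqP /negbTE ->]; rewrite nc0 expr0n.
Qed.

Lemma l2_delta h : l2 (delta h).
Proof. by rewrite /l2 /= l2normsq_delta ltry. Qed.

Lemma l2normsq_ge0 xi : (0 <= l2normsq xi)%E.
Proof. by apply: esum_ge0 => x _; exact: sqnc_ge0. Qed.

Lemma ge_l2normsq xi x : ((nc (xi x) ^+ 2)%:E <= l2normsq xi)%E.
Proof.
rewrite /l2normsq (esumID [set x]) => [|y _]; last exact: sqnc_ge0.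
rewrite setTI esum_set1 ?sqnc_ge0// leeDl// esum_ge0// => y _.
exact: sqnc_ge0.
Qed.

Lemma le_l2normsq xi eta :
  (forall x, nc (xi x) <= nc (eta x)) -> (l2normsq xi <= l2normsq eta)%E.
Proof.
move=> h; apply: le_esum => x _; rewrite lee_fin.
by rewrite lerXn2r// nnegrE nc_ge0.
Qed.

Lemma l2normsqZ (c : R[i]) xi :
  l2normsq (c *: xi) = ((nc c ^+ 2)%:E * l2normsq xi)%E.
Proof.
have [->|c0] := eqVneq c 0.
  rewrite nc0 expr0n mul0e /l2normsq esum1// => x _.
  by rewrite scale0r nc0 expr0n.
have e0 : 0 < nc c ^+ 2 by rewrite exprn_gt0// nc_gt0.
(* One inequality for all scalars suffices: applied to [c^-1] and [c *: xi] it yields the opposite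
   one. *)
suff le c' xi' : (l2normsq (c' *: xi') <= (nc c' ^+ 2)%:E * l2normsq xi')%E.
  apply/eqP; rewrite eq_le le /= -lee_pdivlMl//.
  rewrite -{1}[xi](scalerK c0) (le_trans (le _ _))// ncV exprVn.
  by [].
apply: ge_ereal_sup => _ [X [fX _]] <-.
rewrite (eq_fsbigr (fun x => ((nc c' ^+ 2)%:E * (nc (xi' x) ^+ 2)%:E)%E));
  last by move=> x _; rewrite -EFinM -exprMn -ncM.
rewrite -ge0_mule_fsumr; last by move=> x; exact: sqnc_ge0.
rewrite lee_wpmul2l ?sqnc_ge0//.
by apply: esum_ge; exists X.
Qed.

Lemma l2Z (c : R[i]) xi : l2 xi -> l2 (c *: xi).
Proof.
rewrite /l2 /= l2normsqZ => h.
by apply: lte_mul_pinfty; rewrite ?sqnc_ge0// ltNyr.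
Qed.

(** From |x + y|^2 <= 2 |x|^2 + 2 |y|^2 at each point. This replaces the triangle inequality of
    [l2]; [opnorm_leD] absorbs the factor 2 by asking for halves. *)
Lemma l2normsqD xi eta :
  (l2normsq (xi + eta)%R <= 2%:E * l2normsq xi + 2%:E * l2normsq eta)%E.
Proof.
have scale2 (zeta : T -> R[i]) : (2%:E * l2normsq zeta =
    l2normsq ((Num.sqrt 2)%:C%C *: zeta)%R)%E.
  by rewrite l2normsqZ nc_real real_normK ?num_real// sqr_sqrtr.
rewrite !scale2 /l2normsq -esumD; [|by move=> x _; exact: sqnc_ge0..].
apply: le_esum => x _; rewrite -EFinD lee_fin.
rewrite -[X in _ <= X ^+ 2 + _]/(nc ((Num.sqrt 2)%:C%C * xi x)).
rewrite -[X in _ <= _ + X ^+ 2]/(nc ((Num.sqrt 2)%:C%C * eta x)).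
rewrite !ncM !exprMn nc_real real_normK ?num_real// sqr_sqrtr//.
have := ler_ncD (xi x) (eta x); rewrite -[(xi + eta) x]/(xi x + eta x).
move=> h; apply: (@le_trans _ _ ((nc (xi x) + nc (eta x)) ^+ 2)).
  by rewrite lerXn2r// nnegrE ?addr_ge0 ?nc_ge0.
have := sqr_ge0 (nc (xi x) - nc (eta x)); nra.
Qed.

Lemma l2D xi eta : l2 xi -> l2 eta -> l2 (xi + eta).
Proof.
move=> l2xi l2eta; rewrite /l2 /=; apply: le_lt_trans (l2normsqD _ _) _.
by apply: lte_add_pinfty; apply: lte_mul_pinfty; rewrite ?lee_fin ?ltry.
Qed.

Lemma l2_0 : l2 (0 : T -> R[i]).
Proof.
by rewrite /l2 /= /l2normsq esum1 ?ltry// => x _; rewrite nc0 expr0n.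
Qed.

Definition restrict A xi : T -> R[i] := fun x => if x \in A then xi x else 0.

Lemma l2_restrict A xi : l2 xi -> l2 (restrict A xi).
Proof.
apply: le_lt_trans; apply: le_l2normsq => x; rewrite /restrict.
by case: ifP => // _; rewrite nc0 nc_ge0.
Qed.

Lemma l2_tail xi (e : R) : l2 xi -> 0 < e ->
  exists2 A : set T, finite_set A &
    (l2normsq (restrict (~` A) xi) <= e%:E)%E.
Proof.
move=> l2xi e0; have fn : l2normsq xi \is a fin_num.
  by rewrite ge0_fin_numE// l2normsq_ge0.
have /(_ _ e0) := @ub_ereal_sup_adherent R _ _ _ fn.
move=> [_ [A [fA _] <-]] hA; exists A => //.
have E : l2normsq xi = (\sum_(x \in A) (nc (xi x) ^+ 2)%:E +
    l2normsq (restrict (~` A) xi))%E.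
  rewrite {1}/l2normsq (esumID A) => [|x _]; last exact: sqnc_ge0.
  rewrite !setTI esum_fset//; last by move=> x _; exact: sqnc_ge0.
  congr (_ + _)%E; rewrite esum_mkcond; apply: eq_esum => x _.
  by rewrite /restrict; case: ifP => //; rewrite nc0 expr0n.
have fA' : (\sum_(x \in A) (nc (xi x) ^+ 2)%:E)%E \is a fin_num.
  rewrite ge0_fin_numE; last by rewrite fsume_ge0// => x _; exact: sqnc_ge0.
  apply: le_lt_trans l2xi; rewrite E leeDl// l2normsq_ge0//.
move: hA; rewrite -[ereal_sup _]/(l2normsq xi) E lteBlDr//.
by rewrite lteD2lE// => /ltW.
Qed.

Lemma l2_finite_ind (P : (T -> R[i]) -> Prop) A xi : l2 xi -> finite_set A ->
  P 0 -> (forall c h eta, l2 eta -> P eta -> P (c *: delta h + eta)) ->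
  P (restrict A xi).
Proof.
move=> l2xi /finite_setP[n]; elim: n A => [|n IH] A.
  rewrite II0 card_eq0 => /eqP -> P0 _.
  by rewrite (_ : restrict _ _ = 0)// funeqE => x; rewrite /restrict in_set0.
move=> /eq_cardSP[h Ah /IH{}IH] P0 PD.
rewrite (_ : restrict A xi = xi h *: delta h + restrict (A `\ h) xi).
  by apply: (PD); [exact: l2_restrict|exact: (IH P0 PD)].
rewrite funeqE => x; rewrite -[RHS]/(xi h * (x == h)%:R + restrict _ xi x).
rewrite /restrict in_setD classical_sets.in_set1; case: eqVneq => [->|xh] /=.
  by rewrite andbF addr0 mulr1 mem_set.
by rewrite mulr0 add0r andbT.
Qed.

End SquareSummable.

Arguments delta R {T} h.

(** * Unordered sums and the inner product of [l2] *)

Section UnorderedSums.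
Variables (R : realType).
#[local] Existing Instance summability.totally_filter.

Lemma partial_sumE (T : choiceType) (F : T -> R[i]) (A : {fset T}) :
  @summability.partial_sum T R[i] F A = \sum_(x \in [set` A]) F x.
Proof.
by rewrite /summability.partial_sum -fsbig_seq ?fset_uniq// big_seq_fsetE.
Qed.

(** A finite set [B'] of [T'] sees the same sum as the set of its preimages in [A]. Enlarging the
    latter by a given [A0] changes nothing as soon as [B'] contains the image of [A0], because
    points outside [A] contribute 0. *)
Let cvg_sum_widen (T T' : choiceType) (A : set T) (s : T -> T')
    (F : T -> R[i]) (F' : T' -> R[i]) (l : R[i]^o) :
  set_inj A s -> (forall x, A x -> F x = F' (s x)) ->
  (forall x, ~ A x -> F x = 0) -> (forall y, ~ (s @` A) y -> F' y = 0) ->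
  summability.partial_sum F @ summability.totally --> l ->
  summability.partial_sum F' @ summability.totally --> l.
Proof.
move=> sinj FF' F0 F'0 cF V nV.
have [A0 _ hA0] := cF V nV.
exists [fset s x | x in A0]%fset => //= B' /fsubsetP hB'; rewrite /= partial_sumE.
pose C0 := A `&` s @^-1` [set` B'].
have fC0 : finite_set C0.
  have iC : set_inj C0 s by apply: sub_in2 sinj => x; rewrite !inE => -[].
  rewrite -(eq_finite_set (inj_card_eq iC)).
  by apply: sub_finite_set (finite_fset B') => _ [x [_ ?] <-].
have fC : finite_set ([set` A0] `|` C0).
  by rewrite finite_setU; split => //; exact: finite_fset.
suff -> : \sum_(x \in [set` B']) F' x =
    @summability.partial_sum T R[i] F (fset_set ([set` A0] `|` C0)).
  by apply: hA0 => /=; apply/fsubsetP => x xA0; rewrite in_fset_set// inE; left.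
rewrite partial_sumE fset_setK//.
rewrite -(@fsbig_widen _ _ _ _ C0); first last.
- move=> x [xU nC0] /=; apply: F0 => Ax; apply: nC0; split => //=.
  case: xU => [xA0|[]//]; apply: hB'; apply/imfsetP.
  by exists x.
- by move=> x; right.
have iC : set_inj C0 s by apply: sub_in2 sinj => x; rewrite !inE => -[].
rewrite (eq_fsbigr (F' \o s)); last by move=> x /set_mem[Ax _]; exact: FF'.
rewrite -(fsbig_image _ _ _ iC); symmetry; apply: fsbig_widen.
  by move=> _ [x [_ ?] <-].
move=> y [yB' nC] /=; apply: F'0 => -[x Ax sxy]; apply: nC.
by exists x => //; split => //=; rewrite /= sxy.
Qed.

Let cvg_sum_narrow (T T' : choiceType) (A : set T) (s : T -> T')
    (F : T -> R[i]) (F' : T' -> R[i]) (l : R[i]^o) :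
  set_inj A s -> (forall x, A x -> F x = F' (s x)) ->
  (forall x, ~ A x -> F x = 0) -> (forall y, ~ (s @` A) y -> F' y = 0) ->
  summability.partial_sum F' @ summability.totally --> l ->
  summability.partial_sum F @ summability.totally --> l.
Proof.
move=> sinj FF' F0 F'0 cF'.
have inv y : exists x : option T,
    if x is Some x then A x /\ s x = y else ~ (s @` A) y.
  have [[x Ax sxy]|n] := pselect ((s @` A) y); first by exists (Some x).
  by exists None.
have [t tP] := choice inv.
(* A total inverse of [s] needs a default value; if [T] is empty, both functions are zero. *)
have [x0|n0] := pselect (exists x0 : T, True); last first.
  have -> : F = fun=> 0 by rewrite funeqE => x; case: n0; exists x.
  have F'E : F' = fun=> 0.
    by rewrite funeqE => y; apply: F'0 => -[x]; case: n0; exists x.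
  move: cF'; rewrite F'E => cF' V /cF' [A0 _ h].
  exists fset0 => // B _ /=; rewrite partial_sumE fsbig1//.
  by have := h A0 (fsubset_refl _); rewrite /= partial_sumE fsbig1.
have {x0}[x0 _] := x0.
pose t' y := odflt x0 (t y).
have t'K x : A x -> t' (s x) = x.
  move=> Ax; rewrite /t'; have := tP (s x); case: (t (s x)) => [z [Az]|[]].
    by move=> /sinj; apply => //; rewrite inE.
  by exists x.
apply: (@cvg_sum_widen _ _ (s @` A) t' F' F) => //.
- move=> _ _ /set_mem[x Ax <-] /set_mem[y Ay <-].
  by rewrite !t'K// => ->.
- by move=> _ [x Ax <-]; rewrite t'K// FF'.
- move=> x nA; apply: F0 => Ax; apply: nA; exists (s x); first by exists x.
  exact: t'K.
Qed.

(** The two families have the same set of limits, so the chosen limits agree whether or not the sums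
    converge. *)
Lemma sum_reindex (T T' : choiceType) (A : set T) (s : T -> T')
    (F : T -> R[i]) (F' : T' -> R[i]) :
  set_inj A s -> (forall x, A x -> F x = F' (s x)) ->
  (forall x, ~ A x -> F x = 0) -> (forall y, ~ (s @` A) y -> F' y = 0) ->
  @summability.sum T R[i] R[i]^o F = @summability.sum T' R[i] R[i]^o F'.
Proof.
move=> sinj FF' F0 F'0; rewrite /summability.sum /lim; congr (get _).
rewrite funeqE => l; apply/propext.
by split; [exact: (cvg_sum_widen sinj FF' F0 F'0)|exact: (cvg_sum_narrow sinj FF' F0 F'0)].
Qed.

Lemma sum_single (T : choiceType) (F : T -> R[i]) (k : T) :
  (forall x, x <> k -> F x = 0) -> @summability.sum T R[i] R[i]^o F = F k.
Proof.
move=> F0; apply: (@cvg_lim R[i]^o); first exact: norm_hausdorff.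
move=> V nV; exists [fset k]%fset => // B /fsubsetP kB /=.
suff -> : @summability.partial_sum T R[i] F B = F k by exact: (nbhs_singleton nV).
rewrite partial_sumE -(@fsbig_widen _ _ _ _ [set k]) ?fsbig_set1//.
  by move=> _ ->; apply: kB; rewrite inE.
by move=> x [_ /= xk]; exact: F0.
Qed.

Variable T : choiceType.
Implicit Types xi eta : T -> R[i].

Lemma l2inner_deltar xi k : l2inner xi (delta R k) = xi k.
Proof.
rewrite /l2inner (@sum_single _ _ k).
  by rewrite /delta eqxx rmorph1 mulr1.
by move=> x /eqP /negbTE xk; rewrite /delta xk rmorph0 mulr0.
Qed.

Lemma l2inner_deltal eta k : l2inner (delta R k) eta = (eta k)^*.
Proof.
rewrite /l2inner (@sum_single _ _ k).
  by rewrite /delta eqxx mul1r.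
by move=> x /eqP /negbTE xk; rewrite /delta xk mul0r.
Qed.

Lemma l2inner_single xi eta k : (forall x, x <> k -> eta x = 0) ->
  l2inner xi eta = xi k * (eta k)^*.
Proof.
move=> e0; rewrite /l2inner (@sum_single _ _ k)// => x /e0 ->.
by rewrite rmorph0 mulr0.
Qed.

Lemma l2inner_self xi : l2 xi -> l2inner xi xi = (fine (l2normsq xi))%:C%C.
Proof.
move=> l2xi; have fn : l2normsq xi \is a fin_num.
  by rewrite ge0_fin_numE// l2normsq_ge0.
pose r (B : {fset T}) : R := \sum_(x <- B) nc (xi x) ^+ 2.
have rE B : (r B)%:E = (\sum_(x \in [set` B]) (nc (xi x) ^+ 2)%:E)%E.
  by rewrite /r -sumEFin fsbig_seq// fset_uniq.
have rle B : r B <= fine (l2normsq xi).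
  rewrite -lee_fin fineK// rE; by apply: esum_ge; exists [set` B].
have rhomo A B : (A `<=` B)%fset -> r A <= r B.
  move=> /fsubsetP AB; rewrite -lee_fin !rE.
  apply: lee_fsum_nneg_subset => //; [exact: finite_fset..| |].
    by move=> x; rewrite !inE; exact: AB.
  by move=> x _; exact: sqnc_ge0.
rewrite /l2inner /summability.sum; apply: (@cvg_lim R[i]^o); first exact: norm_hausdorff.
apply/nc_cvgP => e e0.
have /(_ _ e0) [_ [A [fA _] <-]] := @ub_ereal_sup_adherent R _ _ _ fn.
rewrite -[ereal_sup _]/(l2normsq xi) => hA.
exists (fset_set A) => // B /= AB.
have -> : @summability.partial_sum T R[i] (fun x => xi x * (xi x)^*) B =
    (r B)%:C%C.
  rewrite partial_sumE fsbig_finite ?finite_fset// set_fsetK rmorph_sum.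
  by apply: eq_bigr => x _; rewrite mulr_conj.
rewrite -rmorphB nc_real ler0_norm ?subr_le0// opprB.
rewrite ltrBlDr -ltrBlDl (lt_le_trans _ (rhomo _ _ AB))//.
by rewrite -lte_fin rE fset_setK// EFinB fineK.
Qed.

Lemma l2inner_self0 xi : l2 xi -> l2inner xi xi = 0 -> xi = 0.
Proof.
move=> l2xi; rewrite l2inner_self// => -[f0].
have fn : l2normsq xi \is a fin_num by rewrite ge0_fin_numE// l2normsq_ge0.
rewrite funeqE => x; apply/eqP; rewrite -nc_eq0 -sqrf_eq0 eq_le sqr_ge0 andbT.
by rewrite -lee_fin -f0 fineK// ge_l2normsq.
Qed.

End UnorderedSums.

(** * Convolution by functions supported on bisections *)

Section GroupoidTheory.
Variable G : topGroupoid.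
Implicit Types g h k u : G.

Lemma unit_rng u : units G u -> rng u = u.
Proof. by move=> e; rewrite -[u in LHS]e rng_src. Qed.

Lemma unitsP u : units G u -> src u = u. Proof. by []. Qed.

Lemma src_unit g : units G (src g). Proof. exact: src_src. Qed.

Lemma rng_unit g : units G (rng g). Proof. exact: src_rng. Qed.

Lemma gmul_srcE g u : u = src g -> gmul g u = g.
Proof. by move=> ->; rewrite gmul_src. Qed.

Lemma gmulKV k g : rng k = rng g -> gmul k (gmul (ginv k) g) = g.
Proof.
by move=> e; rewrite gmulA ?rng_ginv// ?src_ginv// gmulgV e gmul_rng.
Qed.

Lemma gmulK k h : src k = rng h -> gmul (ginv k) (gmul k h) = h.
Proof.
by move=> e; rewrite gmulA ?src_ginv// gmulVg e gmul_rng.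
Qed.

Lemma gmulgK k h : src k = rng h -> gmul (gmul k h) (ginv h) = k.
Proof. by move=> e; rewrite -gmulA ?rng_ginv// gmulgV -e gmul_src. Qed.

Lemma ginvK : involutive (@ginv G).
Proof.
move=> g; have := gmulK (src_ginv g); rewrite gmulVg => {2}<-.
by rewrite gmul_srcE// src_ginv rng_ginv.
Qed.

Lemma ginv_unit u : units G u -> ginv u = u.
Proof.
move=> eu; have := gmulVg u; rewrite (eu : src u = u).
by rewrite gmul_srcE// src_ginv unit_rng.
Qed.

Lemma src_mulV k g : rng k = rng g -> src (gmul (ginv k) g) = src g.
Proof. by move=> e; rewrite src_gmul// src_ginv. Qed.

Lemma rng_mulV k g : rng k = rng g -> rng (gmul (ginv k) g) = src k.
Proof. by move=> e; rewrite rng_gmul ?src_ginv// rng_ginv. Qed.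

Lemma ginvM k h : src k = rng h -> ginv (gmul k h) = gmul (ginv h) (ginv k).
Proof.
move=> e; have e' : src (ginv h) = rng (ginv k) by rewrite src_ginv rng_ginv.
have ez : src (gmul k h) = rng (gmul (ginv h) (ginv k)).
  by rewrite src_gmul// rng_gmul// rng_ginv.
rewrite -(gmulK ez) [gmul (gmul k h) _]gmulA ?gmulgK//; last by rewrite src_gmul// rng_ginv.
by rewrite gmulgV [RHS]gmul_srcE// src_ginv rng_gmul.
Qed.

End GroupoidTheory.

Section MorphismTheory.
Variables (G H : topGroupoid) (phi : G -> H).
Hypothesis phiM : groupoid_morphism phi.

(** [groupoid_morphism] speaks only of composable pairs and products; sources, ranges and inverses
    are preserved because units are the idempotents of a groupoid. *)
Lemma morph_idem_unit (x : H) : src x = rng x -> gmul x x = x -> units H x.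
Proof.
by move=> e /(congr1 (gmul (ginv x))); rewrite gmulK// gmulVg => /esym.
Qed.

Lemma morph_unit u : units G u -> units H (phi u).
Proof.
move=> uu; have c : src u = rng u by rewrite unit_rng.
have [c' e] := phiM c; apply: morph_idem_unit => //.
by rewrite -e gmul_srcE// (uu : src u = u).
Qed.

Lemma morph_src g : src (phi g) = phi (src g).
Proof.
have c : src g = rng (src g) by rewrite rng_src.
have [-> _] := phiM c; exact/unit_rng/morph_unit/src_unit.
Qed.

Lemma morph_rng g : rng (phi g) = phi (rng g).
Proof.
have c : src (rng g) = rng g by rewrite src_rng.
have [<- _] := phiM c; exact/unitsP/morph_unit/rng_unit.
Qed.

Lemma morph_ginv g : phi (ginv g) = ginv (phi g).
Proof.
have c : src g = rng (ginv g) by rewrite rng_ginv.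
have [c' e] := phiM c; rewrite -(gmulK c') -e gmulgV gmul_srcE//.
by rewrite src_ginv morph_rng.
Qed.

End MorphismTheory.

Section BisectionFunctions.
Variables (R : realType) (G : topGroupoid).
Implicit Types (f xi eta : G -> R[i]) (g h k : G).

Definition src_injective f :=
  forall k k', f k != 0 -> f k' != 0 -> src k = src k' -> k = k'.

Definition rng_injective f :=
  forall k k', f k != 0 -> f k' != 0 -> rng k = rng k' -> k = k'.

Definition nc_bounded f := exists M : R, forall g, nc (f g) <= M.

(** Topology is left out: these three conditions already make [lambda f] bounded, with explicit
    products and adjoint. *)
Definition bisection f :=
  [/\ src_injective f, rng_injective f & nc_bounded f].

(** The involution of the convolution algebra; for bisection functions [lambda] turns it into the
    adjoint. *)
Definition fstar f : G -> R[i] := fun g => (f (ginv g))^*.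

Lemma fstarK f : fstar (fstar f) = f.
Proof. by rewrite funeqE => g; rewrite /fstar ginvK conjCK. Qed.

Lemma bisection_fstar f : bisection f -> bisection (fstar f).
Proof.
move=> [sf rf [M fM]]; split; last by exists M => g; rewrite nc_conj.
- move=> k k'; rewrite !conjC_eq0 => fk fk' e; apply: (can_inj (@ginvK G)).
  by apply: rf => //; rewrite !rng_ginv.
- move=> k k'; rewrite !conjC_eq0 => fk fk' e; apply: (can_inj (@ginvK G)).
  by apply: sf => //; rewrite !src_ginv.
Qed.

Lemma convol_single f xi k g :
  rng k = rng g -> (forall h, rng h = rng g -> f h != 0 -> h = k) ->
  convol f xi g = f k * xi (gmul (ginv k) g).
Proof.
move=> rk only; rewrite /convol -(@fsbig_widen _ _ _ _ [set k]) ?fsbig_set1//.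
  by move=> _ ->.
move=> h [/= rh hk]; apply/eqP; rewrite mulf_eq0; apply/orP; left.
by apply/negPn/negP => fh; apply: hk; apply: only.
Qed.

Lemma convol_at f xi k g : rng_injective f -> f k != 0 -> rng k = rng g ->
  convol f xi g = f k * xi (gmul (ginv k) g).
Proof.
move=> rf fk rk; apply: convol_single => // h rh fh.
by apply: rf => //; rewrite rh.
Qed.

Lemma convol_eq0 f xi g : (forall k, rng k = rng g -> f k = 0) ->
  convol f xi g = 0.
Proof. by move=> h; apply: fsbig1 => k /= /h ->; rewrite mul0r. Qed.

Lemma convol_mul f xi k h : rng_injective f -> src k = rng h -> f k != 0 ->
  convol f xi (gmul k h) = f k * xi h.
Proof.
by move=> rf e fk; rewrite (@convol_at _ _ k)// ?rng_gmul// gmulK.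
Qed.

Lemma convol_neq0 f xi g : rng_injective f -> convol f xi g != 0 ->
  exists k h, [/\ src k = rng h, g = gmul k h, f k != 0 & xi h != 0].
Proof.
move=> rf; have [[k [rk fk]]|n] := pselect (exists k, rng k = rng g /\ f k != 0).
  rewrite (@convol_at _ _ k)// mulf_eq0 negb_or => /andP[_ xk].
  by exists k, (gmul (ginv k) g); rewrite rng_mulV// gmulKV.
rewrite convol_eq0 ?eqxx// => k rk; apply/eqP/negPn/negP => fk.
by apply: n; exists k.
Qed.

Lemma bisection_convol f f' : bisection f -> bisection f' ->
  bisection (convol f f').
Proof.
move=> [sf rf [M fM]] [sf' rf' [M' fM']]; split.
- move=> g g' /(convol_neq0 rf)[k [h [e -> fk fh]]].
  move=> /(convol_neq0 rf)[k' [h' [e' -> fk' fh']]].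
  rewrite !src_gmul// => /(sf' _ _ fh fh') hh'; rewrite hh' in e *.
  by rewrite (sf k k')// e e'.
- move=> g g' /(convol_neq0 rf)[k [h [e -> fk fh]]].
  move=> /(convol_neq0 rf)[k' [h' [e' -> fk' fh']]].
  rewrite !rng_gmul// => /(rf _ _ fk fk') kk'; rewrite kk' in e *.
  by rewrite (rf' h h')// -e e'.
- exists (M * M') => g; have M0 : 0 <= M by exact: le_trans (nc_ge0 _) (fM g).
  have M0' : 0 <= M' by exact: le_trans (nc_ge0 _) (fM' g).
  have [->|] := eqVneq (convol f f' g) 0; first by rewrite nc0 mulr_ge0.
  move=> /(convol_neq0 rf)[k [h [e -> fk fh]]].
  by rewrite convol_mul// ncM ler_pM// nc_ge0.
Qed.

(** If [f] has an arrow [k] with the range of [g], and [f'] an arrow [h] with the range of [k^-1 g],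
    both sides are [f k * f' h] times the value of [xi] at [(k h)^-1 g]. Otherwise both vanish, by
    uniqueness of the arrow of [f] with a given range. *)
Lemma convolA f f' xi : bisection f -> bisection f' ->
  convol f (convol f' xi) = convol (convol f f') xi.
Proof.
move=> bf bf'; have [sff rff _] := bisection_convol bf bf'.
have [_ rf _] := bf; have [_ rf' _] := bf'; rewrite funeqE => g.
have [[k [rk fk]]|n] := pselect (exists k, rng k = rng g /\ f k != 0); last first.
  rewrite !convol_eq0// => k rk; apply/eqP/negPn/negP => fk.
    move: fk => /(convol_neq0 rf)[k' [h [e kE fk' _]]]; apply: n.
    by exists k'; rewrite -rk kE rng_gmul.
  by apply: n; exists k.
rewrite (convol_at _ rf fk rk).
have [[h [rh fh]]|n] :=
    pselect (exists h, rng h = rng (gmul (ginv k) g) /\ f' h != 0).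
  have e : src k = rng h by rewrite rh rng_mulV.
  have fkh : convol f f' (gmul k h) = f k * f' h by rewrite convol_mul.
  rewrite (convol_at _ rf' fh rh) (@convol_at (convol f f') _ (gmul k h))//.
  - rewrite fkh -mulrA ginvM// gmulA//.
    + by rewrite src_ginv rng_ginv.
    + by rewrite src_ginv.
  - by rewrite fkh mulf_neq0.
  - by rewrite rng_gmul.
rewrite [X in _ * X]convol_eq0 ?mulr0.
  rewrite convol_eq0// => k' rk'; apply/eqP/negPn/negP.
  move=> /(convol_neq0 rf)[l [h [e kE fl fh]]]; apply: n; exists h; split=> //.
  rewrite rng_mulV// -e; congr src; apply: rf => //.
  by rewrite rk -rk' kE rng_gmul.
by move=> h rh; apply/eqP/negPn/negP => fh; apply: n; exists h.
Qed.

Let pick_rng f : exists kf : G -> G, rng_injective f -> forall g k,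
  f k != 0 -> rng k = rng g -> kf g = k.
Proof.
have H g : exists k', rng_injective f ->
    forall k, f k != 0 -> rng k = rng g -> k' = k.
  have [[k [rk fk]]|n] := pselect (exists k, rng k = rng g /\ f k != 0).
    by exists k => rf k' fk' rk'; apply: rf => //; rewrite rk rk'.
  by exists g => _ k fk rk; case: n; exists k.
by have [kf kfP] := choice H; exists kf => rf g; exact: kfP.
Qed.

(* Convolution by a bisection function [f] moves the coordinates along the
   partial bijection [g |-> k^-1 g], where [k] is the point of the support of
   [f] with range [rng g]. *)
Let shift f : bisection f -> exists (A : set G) (s : G -> G),
  [/\ set_inj A s,
      forall xi g, A g -> exists k, [/\ f k != 0, rng k = rng g,
        s g = gmul (ginv k) g & convol f xi g = f k * xi (s g)],
      forall xi g, ~ A g -> convol f xi g = 0 &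
      forall k h, f k != 0 -> src k = rng h -> (s @` A) h].
Proof.
move=> [sf rf _]; have [kf /(_ rf) kfP] := pick_rng f.
exists [set g | exists k, f k != 0 /\ rng k = rng g].
exists (fun g => gmul (ginv (kf g)) g); split.
- move=> g g' /set_mem[k [fk rk]] /set_mem[k' [fk' rk']].
  rewrite (kfP _ _ fk rk) (kfP _ _ fk' rk') => e.
  have kk' : k = k'.
    by apply: sf => //; rewrite -(rng_mulV rk) -(rng_mulV rk') e.
  by rewrite -(gmulKV rk) e {1}kk' gmulKV.
- move=> xi g [k [fk rk]]; exists k; rewrite (kfP _ _ fk rk); split=> //.
  exact: convol_at.
- move=> xi g nA; apply: convol_eq0 => k rk; apply/eqP/negPn/negP => fk.
  by apply: nA; exists k.
- move=> k h fk e; exists (gmul k h); first by exists k; rewrite rng_gmul.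
  by rewrite (kfP _ k)// ?rng_gmul// gmulK.
Qed.

(** [shift] moves the coordinates injectively and multiplies them by factors of modulus at most
    [M]. *)
Lemma l2normsq_convol f xi (M : R) : bisection f -> (forall g, nc (f g) <= M) ->
  (l2normsq (convol f xi) <= (M ^+ 2)%:E * l2normsq xi)%E.
Proof.
move=> bf fM; have [A [s [sinj sA sN _]]] := shift bf.
rewrite {1}/l2normsq (esumID A) => [|x _]; last exact: sqnc_ge0.
rewrite [X in (_ + X)%E]esum1 ?adde0; last first.
  by move=> g [_ nA]; rewrite sN// nc0 expr0n.
rewrite setTI.
have M0 g : A g -> 0 <= M.
  by move=> _; exact: le_trans (nc_ge0 _) (fM g).
apply: (@le_trans _ _ (\esum_(g in A) ((nc ((M%:C%C *: xi) (s g))) ^+ 2)%:E)).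
  apply: le_esum => g Ag; have [k [fk rk _ ->]] := sA xi g Ag.
  rewrite lee_fin -[X in _ <= X ^+ 2]/(nc (M%:C%C * xi (s g))) !ncM !exprMn.
  rewrite ler_wpM2r ?sqr_ge0// lerXn2r ?nnegrE ?nc_ge0// nc_real.
  by rewrite ger0_norm ?(M0 _ Ag).
rewrite -(esum_image A s (fun g => (nc ((M%:C%C *: xi) g) ^+ 2)%:E) sinj).
have -> : M ^+ 2 = nc M%:C%C ^+ 2 by rewrite nc_real real_normK ?num_real.
rewrite -l2normsqZ /l2normsq (esumID (s @` A) setT) => [|x _].
  by rewrite setTI leeDl// esum_ge0// => x _; exact: sqnc_ge0.
exact: sqnc_ge0.
Qed.

Lemma l2_convol f xi : bisection f -> l2 xi -> l2 (convol f xi).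
Proof.
move=> bf; have [_ _ [M fM]] := bf; rewrite /l2 /= => l2xi.
apply: le_lt_trans (l2normsq_convol xi bf fM) _.
by apply: lte_mul_pinfty; rewrite ?lee_fin ?sqr_ge0// ltNyr.
Qed.

Lemma lambdaE f xi : l2 xi -> lambda f xi = convol f xi.
Proof. by move=> l2xi; rewrite /lambda asboolT. Qed.

Lemma lambda_out f xi : ~ l2 xi -> lambda f xi = 0.
Proof. by move=> l2xi; rewrite /lambda asboolF. Qed.

Lemma convolDr f (c : R[i]) xi eta : rng_injective f ->
  convol f (c *: xi + eta) = c *: convol f xi + convol f eta.
Proof.
move=> rf; rewrite funeqE => g.
rewrite -[RHS]/(c * convol f xi g + convol f eta g).
have [[k [rk fk]]|n] := pselect (exists k, rng k = rng g /\ f k != 0).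
  rewrite !(convol_at _ rf fk rk).
  rewrite -[(_ + _) _]/(c * xi (gmul (ginv k) g) + eta (gmul (ginv k) g)).
  by rewrite mulrDr mulrCA.
by rewrite !convol_eq0 ?mulr0 ?addr0// => k rk; apply/eqP/negPn/negP => fk;
  apply: n; exists k.
Qed.

Lemma opnorm_lambda f (M : R) : bisection f -> (forall g, nc (f g) <= M) ->
  opnorm_le (lambda f) M.
Proof. by move=> bf fM xi l2xi; rewrite lambdaE//; exact: l2normsq_convol. Qed.

Lemma bounded_lambda f : bisection f -> bounded_oper (lambda f).
Proof.
move=> bf; split; last by move=> xi; exact: lambda_out.
  move=> c xi eta l2xi l2eta; have [_ rf _] := bf.
  by rewrite !lambdaE ?convolDr//; apply: l2D => //; exact: l2Z.
by have [_ _ [M fM]] := bf; exists M; exact: opnorm_lambda.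
Qed.

Lemma lambda_comp f f' : bisection f -> bisection f' ->
  lambda f \o lambda f' = lambda (convol f f').
Proof.
move=> bf bf'; rewrite funeqE => xi /=.
have [l2xi|nl2] := pselect (l2 xi).
  rewrite (lambdaE _ l2xi) lambdaE; last exact: l2_convol.
  by rewrite lambdaE// convolA.
rewrite !(lambda_out _ nl2) lambdaE; last exact: l2_0.
by rewrite funeqE => g; apply: fsbig1 => k _; rewrite mulr0.
Qed.

Lemma adjoint_lambda f : bisection f -> adjoint (lambda f) (lambda (fstar f)).
Proof.
move=> bf xi eta l2xi l2eta; rewrite !lambdaE//.
have [A [s [sinj sA sN sI]]] := shift bf.
have [_ rf' _] := bisection_fstar bf; have [_ rf _] := bf.
apply: (sum_reindex (A := A) (s := s)) => //.
- move=> g Ag; have [k [fk rk sE ->]] := sA xi g Ag.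
  rewrite (@convol_at _ _ (ginv k))//.
  + rewrite /fstar ginvK rmorphM /= conjCK sE gmulKV//.
    by rewrite [RHS]mulrCA [RHS]mulrA.
  + by rewrite /fstar ginvK conjC_eq0.
  + by rewrite sE rng_ginv rng_mulV.
- by move=> g nA; rewrite sN// mul0r.
- move=> h nA; rewrite convol_eq0 ?rmorph0 ?mulr0// => k rk.
  apply/eqP/negPn/negP; rewrite /fstar conjC_eq0 => fk; apply: nA.
  by apply: (sI (ginv k)) => //; rewrite src_ginv.
Qed.

(** It is [delta R h] that leaves a single term, whatever [f] is. This lets coefficients be read off
    approximants in [Cc] that are not supported on bisections. *)
Lemma lambda_delta f g h :
  lambda f (delta R h) g = if src g == src h then f (gmul g (ginv h)) else 0.
Proof.
rewrite lambdaE; last exact: l2_delta.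
case: eqP => [e|ne].
  rewrite /convol -(@fsbig_widen _ _ _ _ [set gmul g (ginv h)]).
  - rewrite fsbig_set1 ginvM ?rng_ginv// ginvK -gmulA ?src_ginv ?rng_ginv//.
    by rewrite gmulVg e gmul_src /delta eqxx mulr1.
  - by move=> _ ->; rewrite /= rng_gmul// rng_ginv.
  - move=> k [/= rk kgh]; apply/eqP; rewrite mulf_eq0; apply/orP; right.
    rewrite /delta (_ : _ == h = false) ?eqxx//.
    apply/eqP => kgE; case: kgh; rewrite /= -kgE ginvM ?src_ginv// ginvK.
    by rewrite gmulKV.
apply: fsbig1 => k rk; rewrite /delta (_ : _ == h = false) ?mulr0//.
by apply/eqP => kgE; case: ne; rewrite -kgE src_mulV.
Qed.

End BisectionFunctions.

(** * Coefficients of operators in the reduced algebra *)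

Section ComplexContinuity.
Variables (R : realType) (X : topologicalType).
Implicit Types (f g : X -> R[i]) (r : X -> R).

Lemma continuous_nc f : continuous (f : X -> R[i]^o) ->
  continuous (fun x => nc (f x)).
Proof.
move=> /nc_continuousP cf x; apply/cvgrPdist_lt => e e0.
apply: filterS (cf x e e0) => y; apply: le_lt_trans.
have h1 := ler_ncD (f y - f x) (f x); have h2 := ler_ncD (f x - f y) (f y).
rewrite !subrK in h1 h2; rewrite nc_distC in h2.
by rewrite ler_norml; apply/andP; split; lra.
Qed.

Lemma continuous_realC r : continuous r ->
  continuous ((fun x => (r x)%:C%C) : X -> R[i]^o).
Proof.
move=> cr; apply/nc_continuousP => x e e0.
have /cvgrPdist_lt/(_ e e0) := cr x; apply: filterS => y.
by rewrite -rmorphB nc_real distrC.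
Qed.

Lemma continuous_conj f : continuous (f : X -> R[i]^o) ->
  continuous ((fun x => (f x)^*) : X -> R[i]^o).
Proof.
move=> /nc_continuousP cf; apply/nc_continuousP => x e e0.
by apply: filterS (cf x e e0) => y; rewrite -rmorphB nc_conj.
Qed.

Lemma continuous_mulC f g : continuous (f : X -> R[i]^o) ->
  continuous (g : X -> R[i]^o) -> continuous ((f \* g) : X -> R[i]^o).
Proof.
move=> cf cg x; exact: (@cvgM R[i] _ (nbhs x) _ f g _ _ (cf x) (cg x)).
Qed.

Lemma continuous_addC f g : continuous (f : X -> R[i]^o) ->
  continuous (g : X -> R[i]^o) -> continuous ((f \+ g) : X -> R[i]^o).
Proof.
move=> cf cg x; exact: (@cvgD _ R[i]^o _ (nbhs x) _ f g _ _ (cf x) (cg x)).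
Qed.

Lemma open_nc_gt f (e : R) : continuous (f : X -> R[i]^o) ->
  open [set x | e < nc (f x)].
Proof.
move=> /continuous_nc cf.
by apply: (open_comp (D := [set y | e < y])) => [x _|]; [exact: cf|exact: open_gt].
Qed.

Lemma open_neq0 f : continuous (f : X -> R[i]^o) ->
  open [set x | f x != 0].
Proof.
move=> cf; rewrite (_ : mkset _ = [set x | 0 < nc (f x)]).
  exact: open_nc_gt.
by apply/seteqP; split=> x; rewrite /= nc_gt0.
Qed.

Lemma closed_nc_ge f (e : R) : continuous (f : X -> R[i]^o) ->
  closed [set x | e <= nc (f x)].
Proof.
move=> /continuous_nc cf.
exact: (preimage_closed (D := [set y | e <= y]) (fun x _ => cf x) (@closed_ge _ _)).
Qed.

Lemma C0_continuous f : C0 f -> continuous (f : X -> R[i]^o). Proof. by case. Qed.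

Lemma Cc_C0 f : Cc f -> C0 f.
Proof.
move=> [cf kf]; split=> // e e0; exists (closure [set x | f x != 0]) => // x nx.
have [->|f0] := eqVneq (f x) 0; first by rewrite nc0.
by case: nx; exact: subset_closure.
Qed.

Lemma C0_compact f (e : R) : C0 f -> 0 < e -> compact [set x | e <= nc (f x)].
Proof.
move=> [cf f0] e0; have [K kK hK] := f0 e e0.
apply: (subclosed_compact (closed_nc_ge cf) kK) => x /= ex.
by apply: contrapT => /hK; rewrite ltNge ex.
Qed.

Lemma C0_compactP f : continuous (f : X -> R[i]^o) ->
  (forall e : R, 0 < e -> compact [set x | e <= nc (f x)]) -> C0 f.
Proof.
move=> cf kf; split=> // e e0; exists [set x | e <= nc (f x)]; first exact: kf.
by move=> x /negP; rewrite -ltNge.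
Qed.

Lemma C0_bounded f : C0 f -> exists2 M : R, 0 < M & forall x, nc (f x) <= M.
Proof.
move=> f0; have cf := C0_continuous f0.
have := C0_compact f0 ltr01; set K := mkset _ => kK.
have : compact ((fun x => nc (f x)) @` K).
  apply: continuous_compact => //; apply: continuous_subspaceT.
  exact: continuous_nc.
move=> /compact_bounded/pinfty_ex_gt0[M M0 hM].
exists (1 + M) => [|x]; first by rewrite addr_gt0.
have [Kx|] := leP 1 (nc (f x)); last first.
  by move=> /ltW h; rewrite (le_trans h)// lerDl ltW.
have /= := hM _ (ex_intro2 _ _ x Kx erefl); rewrite ger0_norm ?nc_ge0// => h.
by rewrite (le_trans h)// lerDr.
Qed.

(** Shrinks the modulus by [e] and cuts it at 0. The result stays within [e] of [f] everywhere and
    has no larger support, so a bisection function remains one. *)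
Definition soft_threshold (e : R) f : X -> R[i] :=
  fun x => f x * (1 - e / Num.max (nc (f x)) e)%:C%C.

Lemma soft_threshold_continuous (e : R) f : 0 < e ->
  continuous (f : X -> R[i]^o) ->
  continuous (soft_threshold e f : X -> R[i]^o).
Proof.
move=> e0 cf; apply: continuous_mulC => //; apply: continuous_realC => x.
apply: (@cvgB R R^o); first exact: cvg_cst.
apply: (@cvgM R); first exact: cvg_cst.
apply: (@cvgV R); first by rewrite gt_eqF// lt_max e0 orbT.
apply: (@continuous_max R X (fun y => nc (f y)) (cst e)).
  exact: continuous_nc.
exact: cst_continuous.
Qed.

Lemma soft_threshold_eq0 (e : R) f x : 0 < e -> nc (f x) <= e ->
  soft_threshold e f x = 0.
Proof.
move=> e0 h; rewrite /soft_threshold max_r// divff ?gt_eqF// subrr.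
by rewrite mulr0.
Qed.

Lemma soft_threshold_dist (e : R) f x : 0 < e ->
  nc (soft_threshold e f x - f x) <= e.
Proof.
move=> e0; rewrite /soft_threshold rmorphB rmorph1 mulrBr mulr1 addrAC subrr.
rewrite sub0r ncN ncM nc_real.
have m0 : 0 < Num.max (nc (f x)) e by rewrite lt_max e0 orbT.
rewrite ger0_norm; last by rewrite divr_ge0// ltW.
by rewrite mulrA ler_pdivrMr// [leLHS]mulrC ler_pM2l// le_max lexx.
Qed.

Lemma soft_threshold_Cc (e : R) f : 0 < e -> C0 f -> Cc (soft_threshold e f).
Proof.
move=> e0 f0; have cf := C0_continuous f0; split.
  exact: soft_threshold_continuous.
apply: (subclosed_compact (@closed_closure _ _) (C0_compact f0 e0)).
rewrite [X in _ `<=` X](closure_id _).1; last exact: closed_nc_ge.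
apply: closureS => x /=; apply: contraNT; rewrite -ltNge.
by move=> /ltW h; rewrite soft_threshold_eq0.
Qed.

End ComplexContinuity.

Lemma bounded_l2 (R : realType) (T : choiceType) (A : oper R T) xi :
  bounded_oper A -> l2 xi -> l2 (A xi).
Proof.
move=> [_ [M bA] _] l2xi; rewrite /l2 /=; apply: le_lt_trans (bA _ l2xi) _.
by apply: lte_mul_pinfty; rewrite ?lee_fin ?sqr_ge0// ltNyr.
Qed.

Section ReducedCstar.
Variables (R : realType) (G : topGroupoid).
Implicit Types (f xi : G -> R[i]) (g h k : G) (S T : oper R G).

Definition coef T g : R[i] := T (delta R (src g)) g.

Lemma opnorm_le_coord (S T : oper R G) (e : R) h g : 0 <= e ->
  opnorm_le (S - T) e ->
  nc (S (delta R h) g - T (delta R h) g) <= e.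
Proof.
move=> e0 /(_ _ (l2_delta R h)); rewrite l2normsq_delta mule1 => he.
have := le_trans (ge_l2normsq ((S - T) (delta R h)) g) he.
by rewrite lee_fin ler_sqr ?nnegrE ?nc_ge0.
Qed.

Lemma coef_lambda f g : coef (lambda f) g = f g.
Proof.
by rewrite /coef lambda_delta src_src eqxx ginv_unit ?gmul_src//; exact: src_unit.
Qed.

Lemma coef_approx T (e : R) : Cstar T -> 0 < e ->
  exists2 f, Cc f & opnorm_le (lambda f - T) e /\
    forall g, nc (f g - coef T g) <= e.
Proof.
move=> [_ aT] e0; have [f cf fT] := aT e e0; exists f => //; split=> // g.
by rewrite -coef_lambda; apply: opnorm_le_coord fT; exact: ltW.
Qed.

Lemma eq_nc_small (z w : R[i]) : (forall e : R, 0 < e -> nc (z - w) <= e) -> z = w.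
Proof.
move=> h; apply/eqP; rewrite -subr_eq0 -nc_eq0 eq_le nc_ge0 andbT.
by apply/ler_addgt0Pr => e e0; rewrite add0r h.
Qed.

(** Convolution operators commute with right translations, so their entry at [(g, h)] depends only
    on [g h^-1]; this passes to norm limits. Hence [coef] determines an element of [Cstar]. *)
Lemma Cstar_delta T h g : Cstar T ->
  T (delta R h) g = if src g == src h then coef T (gmul g (ginv h)) else 0.
Proof.
move=> cT; apply: eq_nc_small => e e0.
have e20 : 0 < e / 2 by rewrite divr_gt0.
have [f _ [fT fcoef]] := coef_approx cT e20.
have := opnorm_le_coord h g (ltW e20) fT; rewrite lambda_delta.
case: eqP => [_ h1|_]; last first.
  by rewrite nc_distC => h1; lra.
have h2 := fcoef (gmul g (ginv h)).
set a := f _ in h1 h2; set b := coef _ _ in h2 *.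
have := ler_ncD (T (delta R h) g - a) (a - b).
by rewrite addrA subrK nc_distC => h3; apply: le_trans h3 _; lra.
Qed.

Lemma coef_C0 T : Cstar T -> C0 (coef T).
Proof.
move=> cT; have e20 (e : R) : 0 < e -> 0 < e / 4 by move=> ?; rewrite divr_gt0.
split=> [|e e0].
  apply/nc_continuousP => x e e0.
  have [f [/nc_continuousP cf _] [_ fT]] := coef_approx cT (e20 e e0).
  have := cf x _ (e20 e e0); apply: filterS => y hy.
  have h1 := fT x; have h2 := fT y; rewrite nc_distC in h2.
  have h3 := ler_ncD (coef T y - f y) (f y - f x).
  have h4 := ler_ncD (coef T y - f x) (f x - coef T x).
  by move: h3 h4; rewrite !addrA !subrK => h3 h4; lra.
have [f /Cc_C0[cf f0] [_ fT]] := coef_approx cT (e20 e e0).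
have [K kK hK] := f0 _ (e20 e e0); exists K => // x /hK fx.
have h1 := fT x; rewrite nc_distC in h1.
by have := ler_ncD (coef T x - f x) (f x); rewrite subrK; lra.
Qed.

(** Linearity gives equality on finitely supported vectors, and boundedness controls the tail of any
    other vector. *)
Lemma bounded_oper_eq S T : bounded_oper S -> bounded_oper T ->
  (forall h, S (delta R h) = T (delta R h)) -> S = T.
Proof.
move=> [linS [MS bS] outS] [linT [MT bT] outT] ST.
rewrite funeqE => xi; have [l2xi|nl2] := pselect (l2 xi); last first.
  by rewrite outS// outT.
have l20 := @l2_0 R G.
have S0 A : (forall c xi eta, l2 xi -> l2 eta ->
    A (c *: xi + eta) = c *: A xi + A eta) -> A 0 = 0 :> (G -> R[i]).
  move=> linA; have := linA (-1) 0 0 l20 l20.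
  by rewrite scaler0 addr0 scaleN1r addNr.
pose M := `|MS| + `|MT| + 1; have M0 : 0 < M by rewrite ltr_wpDl// addr_ge0.
rewrite funeqE => x; apply: eq_nc_small => e e0.
(* Chosen so that [M ^+ 2 * t] is [(e / 2) ^+ 2]. [M] dominates absolute values because [opnorm_le]
   squares its bound, so that [MS] and [MT] may be negative. *)
pose t := (e / 2 / M) ^+ 2; have t0 : 0 < t by rewrite exprn_gt0// !divr_gt0.
have [A fA tA] := l2_tail l2xi t0.
have eA : S (restrict A xi) = T (restrict A xi).
  apply: (@l2_finite_ind _ _ (fun eta => S eta = T eta) _ _ l2xi fA) => [|c h eta l2eta E].
    by rewrite (S0 _ linS) (S0 _ linT).
  by rewrite linS ?linT ?ST ?E//; exact: l2_delta.
have l2t := l2_restrict (~` A) l2xi.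
have xiE : xi = 1 *: restrict A xi + restrict (~` A) xi.
  rewrite scale1r funeqE => y; rewrite -[RHS]/(restrict A xi y + restrict (~` A) xi y).
  by rewrite /restrict in_setC; case: ifP => _ /=; rewrite ?addr0 ?add0r.
have small B MB : MB ^+ 2 <= M ^+ 2 -> opnorm_le B MB ->
    nc (B (restrict (~` A) xi) x) <= e / 2.
  move=> MBM bB; have := ge_l2normsq (B (restrict (~` A) xi)) x.
  move=> /le_trans/(_ (bB _ l2t))/le_trans h.
  have : ((nc (B (restrict (~` A) xi) x) ^+ 2)%:E <= ((e / 2) ^+ 2)%:E)%E.
    apply: h; rewrite (_ : (e / 2) ^+ 2 = M ^+ 2 * t); last first.
      by rewrite /t -exprMn [M * _]mulrC divfK ?gt_eqF.
    by rewrite [X in (_ <= X)%E]EFinM lee_pmul ?lee_fin ?sqr_ge0 ?l2normsq_ge0.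
  by rewrite lee_fin ler_sqr ?nnegrE ?nc_ge0// divr_ge0// ltW.
have ltM m : `|m| <= M -> m ^+ 2 <= M ^+ 2.
  by move=> mM; rewrite -real_normK ?num_real// ler_sqr ?nnegrE// ltW.
have hS : nc (S (restrict (~` A) xi) x) <= e / 2.
  by apply: small bS; apply: ltM; rewrite /M -addrA lerDl addr_ge0.
have hT : nc (T (restrict (~` A) xi) x) <= e / 2.
  by apply: small bT; apply: ltM; rewrite /M addrAC lerDr addr_ge0.
have -> : S xi x - T xi x =
    S (restrict (~` A) xi) x - T (restrict (~` A) xi) x.
  rewrite {1 2}xiE linS ?linT ?eA//; try exact: l2_restrict.
  by rewrite !fctE opprD addrACA subrr add0r.
apply: le_trans (ler_ncD _ _) _; rewrite ncN.
by rewrite [e]splitr lerD.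
Qed.

Lemma Cstar_coef_inj S T : Cstar S -> Cstar T -> coef S = coef T -> S = T.
Proof.
move=> cS cT e; apply: bounded_oper_eq; [by case: cS|by case: cT|].
by move=> h; rewrite funeqE => g; rewrite !Cstar_delta// e.
Qed.

(** The soft threshold of [f] lies in [Cc], and its difference with [f] is still a bisection
    function, so the operator norm of the difference is bounded by its sup norm, at most [e]. *)
Lemma Cstar_lambda f : C0 f -> src_injective f -> rng_injective f ->
  Cstar (lambda f).
Proof.
move=> f0 sf rf; have [M _ fM] := C0_bounded f0.
have bf : bisection f by split=> //; exists M.
split; first exact: bounded_lambda.
move=> e e0; exists (soft_threshold e f); first exact: soft_threshold_Cc.
have sub g : soft_threshold e f g - f g != 0 -> f g != 0.
  by apply: contraNN => /eqP fg; rewrite /soft_threshold fg mul0r subrr.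
have bd : bisection (soft_threshold e f - f).
  split; [| |by exists e => g; exact: soft_threshold_dist].
  - by move=> k k' /sub fk /sub fk'; exact: sf.
  - by move=> k k' /sub fk /sub fk'; exact: rf.
have sub' g : soft_threshold e f g != 0 -> f g != 0.
  by apply: contraNN => /eqP fg; rewrite /soft_threshold fg mul0r.
have rt : rng_injective (soft_threshold e f).
  by move=> k k' /sub' fk /sub' fk'; exact: rf.
suff -> : lambda (soft_threshold e f) - lambda f = lambda (soft_threshold e f - f).
  by apply: opnorm_lambda => // g; exact: soft_threshold_dist.
rewrite funeqE => xi; rewrite -[LHS]/(lambda _ xi - lambda _ xi).
have [l2xi|nl2] := pselect (l2 xi); last by rewrite !lambda_out// subrr.
rewrite !lambdaE// funeqE => g.
rewrite -[LHS]/(convol _ xi g - convol _ xi g).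
have [[k [rk fk]]|n] := pselect (exists k, rng k = rng g /\ f k != 0).
  have only (F : G -> R[i]) : (forall h, F h != 0 -> f h != 0) ->
      convol F xi g = F k * xi (gmul (ginv k) g).
    move=> Ff; apply: convol_single => // h rh /Ff fh.
    by apply: rf => //; rewrite rh rk.
  by rewrite !only// -mulrBl.
have f0' h : rng h = rng g -> f h = 0.
  by move=> rh; apply/eqP/negPn/negP => fh; apply: n; exists h.
rewrite !convol_eq0 ?subrr// => h /f0' fh; rewrite ?/(_ \- _)//=.
  rewrite -[LHS]/(soft_threshold e f h - f h).
  by rewrite /soft_threshold fh mul0r subrr.
by rewrite /soft_threshold fh mul0r.
Qed.

End ReducedCstar.

(** * Etale groupoids *)

Section TopologyComplements.

Lemma hausdorff_sep (T : topologicalType) (x y : T) : hausdorff_space T ->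
  x <> y -> exists U V : set T,
    [/\ open_nbhs x U, open_nbhs y V & U `&` V = set0].
Proof.
rewrite open_hausdorff => hT /eqP /hT[[U V] /= [xU yV] [oU oV /eqP UV]].
by exists U, V; split=> //; split=> //; exact/set_mem.
Qed.

Lemma closed_equalizer (X Y : topologicalType) (f g : X -> Y) :
  hausdorff_space Y -> continuous f -> continuous g ->
  closed [set x | f x = g x].
Proof.
move=> hY cf cg x clx; apply: contrapT => fgx.
have [U [V [nU nV UV]]] := hausdorff_sep hY fgx.
have nUV : nbhs x (f @^-1` U `&` g @^-1` V).
  by apply: filterI; [apply: cf|apply: cg]; exact: open_nbhs_nbhs.
have [z [/= fgz [Uz Vz]]] := clx _ nUV.
have : (U `&` V) (f z) by split => //; rewrite /= fgz.
by rewrite UV.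
Qed.

Lemma compact_bump (R : realType) (X : topologicalType) (x : X) (U : set X) :
  hausdorff_space X -> locally_compact [set: X] -> open U -> U x ->
  exists f : X -> R[i], [/\ continuous (f : X -> R[i]^o), f x = 1,
    compact (closure [set y | f y != 0]) &
    closure [set y | f y != 0] `<=` U].
Proof.
move=> hX lX oU Ux.
have [C] := lX x I; rewrite withinET => nC [cC clC].
pose W := U `&` C°.
have oW : open W by apply: openI => //; exact: open_interior.
have Wx : W x by split.
have := @locally_compact_completely_regular X R lX hX x (~` W).
move=> /(_ (open_closedC oW)) /(_ (fun nW => nW Wx)).
move=> /(@uniform_separatorP _ R)[p [cp _ p0 p1]].
have px : p x = 0 by apply: p0; exists x.
have pW y : ~ W y -> p y = 1 by move=> nW; apply: p1; exists y.
(* Cutting [p] at level 1/2 keeps the closed support inside [p <= 1/2], hence inside [W]; a cut at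
   level 1 would only keep the support itself there. *)
pose f y : R[i] := (Num.max (1 - 2 * p y) 0)%:C%C.
have cl : closed [set y | p y <= 2^-1].
  by apply: (@preimage_closed _ _ p [set y | y <= 2^-1]) => [y _|]; [exact: cp|exact: closed_le].
have sub : closure [set y | f y != 0] `<=` [set y | p y <= 2^-1].
  rewrite [X in _ `<=` X](closure_id _).1//; apply: closureS => y /=.
  apply: contraNT; rewrite -ltNge => h.
  by rewrite /f max_r//; lra.
have subW : closure [set y | f y != 0] `<=` W.
  move=> y /sub /= py; apply: contrapT => /pW e; move: py; rewrite e; lra.
exists f; split.
- apply: continuous_realC => y.
  apply: (@continuous_max R X (fun y => 1 - 2 * p y) (cst 0)).
    move=> z; apply: (@cvgB R R^o); first exact: cvg_cst.
    by apply: (@cvgM R); [exact: cvg_cst|exact: cp].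
  exact: cst_continuous.
- by rewrite /f px mulr0 subr0 max_l ?ler01.
- apply: (subclosed_compact (@closed_closure _ _) cC).
  by move=> y /subW[_ /interior_subset].
- by move=> y /subW[].
Qed.

Lemma closure_support (R : realType) (X : topologicalType) (f : X -> R[i]) x :
  f x != 0 -> closure [set y | f y != 0] x.
Proof. by move=> fx; apply: subset_closure. Qed.

End TopologyComplements.

(** The form in which the hypotheses are used: [src] and [rng] map into [G] itself and not into the
    subtype of units, and every clause passes to a semidirect product. *)
Record etale_groupoid (G : topGroupoid) : Prop := {
  eg_hausdorff : hausdorff_space G ;
  eg_locally_compact : locally_compact [set: G] ;
  eg_open_units : open (units G) ;
  eg_bisection : forall g : G, exists2 U : set G, open_nbhs g U &
    (forall k k', U k -> U k' -> src k = src k' -> k = k') /\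
    (forall k k', U k -> U k' -> rng k = rng k' -> k = k') ;
  eg_open_src : forall U : set G, open U -> open (src @` U) ;
  eg_open_rng : forall U : set G, open U -> open (rng @` U) }.

Section EtaleGroupoid.
Variables (R : realType) (G : topGroupoid).
Hypothesis eG : etale_groupoid G.
Implicit Types (f : G -> R[i]) (g h k u : G).

Definition C0bis f := [/\ C0 f, src_injective f & rng_injective f].

(** [C0] of the unit space, seen as functions on the groupoid; convolution of two of them is their
    pointwise product. *)
Definition C0units f := C0 f /\ forall g, f g != 0 -> units G g.

Lemma C0bis_bisection f : C0bis f -> bisection f.
Proof. by move=> [/C0_bounded[M _ fM] sf rf]; split=> //; exists M. Qed.

Lemma C0bis_Cstar f : C0bis f -> Cstar (lambda f).
Proof. by move=> [f0 sf rf]; exact: Cstar_lambda. Qed.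

Lemma C0units_bis f : C0units f -> C0bis f.
Proof.
move=> [f0 fu]; split=> // k k' /fu uk /fu uk'.
  by rewrite (uk : src k = k) (uk' : src k' = k').
by rewrite !unit_rng.
Qed.

Lemma C0bis_fstar f : C0bis f -> C0bis (fstar f).
Proof.
move=> bf; have [sf rf _] := bisection_fstar (C0bis_bisection bf).
split=> //; have [f0 _ _] := bf; have cf := C0_continuous f0.
have cs : continuous (fstar f : G -> R[i]^o).
  apply: continuous_conj => g; apply: (@continuous_comp _ _ R[i]^o ginv f).
    exact: ginv_continuous.
  exact: cf.
apply: C0_compactP => // e e0.
have -> : [set x | e <= nc (fstar f x)] = ginv @` [set x | e <= nc (f x)].
  apply/seteqP; split=> [g /=|_ [g /= ge <-]].
    by rewrite nc_conj => ge; exists (ginv g) => //; exact: ginvK.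
  by rewrite nc_conj ginvK.
apply: continuous_compact; last exact: C0_compact.
by apply: continuous_subspaceT; exact: ginv_continuous.
Qed.

Lemma composable_closed :
  closed [set p : G * G | src p.1 = rng p.2].
Proof.
apply: closed_equalizer; first exact: eg_hausdorff eG.
  by move=> p; apply: continuous_comp; [exact: cvg_fst|exact: src_continuous].
by move=> p; apply: continuous_comp; [exact: cvg_snd|exact: rng_continuous].
Qed.

Lemma divl_nbhs k g (V : set G) : rng k = rng g ->
  nbhs (gmul (ginv k) g) V -> exists U W : set G,
  [/\ open_nbhs k U, open_nbhs g W & forall k' g', U k' -> W g' ->
    rng k' = rng g' -> V (gmul (ginv k') g')].
Proof.
move=> rkg nV; have /subspace_continuousP := @gmul_continuous G.
have e : src (ginv k) = rng g by rewrite src_ginv.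
move=> /(_ (ginv k, g) e V nV); rewrite /within /=.
move=> [[A B] /= [nA nB] AB].
have := ginv_continuous nA; rewrite nbhsE => -[U nU UA].
move: nB; rewrite nbhsE => -[W nW WB].
exists U, W; split=> // k' g' Uk' Wg' e'.
apply: (AB (ginv k', g')) => /=; last by rewrite src_ginv.
by split; [exact: UA|exact: WB].
Qed.

(** If some [k] with range [rng g] has [f k] nonzero, openness of [rng] gives such an arrow near [k]
    for every [g'] near [g], and the formula of [convol_at] varies continuously. If there is none,
    [rng g] avoids the compact, hence closed, set of ranges of arrows where [f] has modulus at least
    [e / M], so near [g] the values stay below [e]. *)
Lemma convol_continuous f f' : C0bis f -> C0bis f' ->
  continuous (convol f f' : G -> R[i]^o).
Proof.
move=> [f0 sf rf] [f0' sf' rf']; apply/nc_continuousP => g e e0.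
have cf := C0_continuous f0; have cf' := C0_continuous f0'.
have [M M0 fM] := C0_bounded f0'.
have [[k [rk fk]]|n] := pselect (exists k, rng k = rng g /\ f k != 0).
  have E := convol_at f' rf fk rk.
  set l := gmul (ginv k) g in E.
  have cm : continuous ((fun p : G * G => f p.1 * f' p.2) : G * G -> R[i]^o).
    apply: (@continuous_mulC R _ (f \o fst) (f' \o snd)) => p.
      by apply: continuous_comp; [exact: cvg_fst|exact: cf].
    by apply: continuous_comp; [exact: cvg_snd|exact: cf'].
  move/nc_continuousP : cm => /(_ (k, l) e e0)[[A V] /= [nA nV] AV].
  have [U [W [nU nW UW]]] := divl_nbhs rk nV.
  have nk : nbhs k ([set x | f x != 0] `&` U `&` A).
    apply: filterI => //; apply: filterI; last exact: open_nbhs_nbhs.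
    by apply: open_nbhs_nbhs; split=> //; exact: open_neq0.
  move: nk; rewrite nbhsE => -[N [oN Nk] NS].
  have nr : nbhs g (rng @^-1` (rng @` N)).
    apply: rng_continuous; apply: open_nbhs_nbhs; split.
      exact: eg_open_rng eG _ oN.
    by exists k.
  apply: (filterS2 _ _ nr (open_nbhs_nbhs nW)) => g' [k' Nk' rk'] Wg'.
  have [[/= fk' Uk'] Ak'] := NS _ Nk'.
  rewrite E (convol_at _ rf fk' rk').
  by apply: (AV (k', gmul (ginv k') g')); split=> //=; exact: UW.
have E : convol f f' g = 0.
  by apply: convol_eq0 => k rk; apply/eqP/negPn/negP => fk; apply: n; exists k.
have eM0 : 0 < e / M by rewrite divr_gt0.
have kC := C0_compact f0 eM0; set C := mkset _ in kC.
have clC : closed (rng @` C).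
  apply: compact_closed; first exact: eg_hausdorff eG.
  by apply: continuous_compact => //; apply: continuous_subspaceT;
    exact: rng_continuous.
have : nbhs g (rng @^-1` (~` (rng @` C))).
  apply: rng_continuous; apply: open_nbhs_nbhs; split; first exact: closed_openC.
  move=> [k /= Ck rk]; apply: n; exists k; split=> //.
  by rewrite -nc_gt0 (lt_le_trans eM0).
apply: filterS => g' nC; rewrite E subr0.
have [->|] := eqVneq (convol f f' g') 0; first by rewrite nc0.
move=> /(convol_neq0 rf)[k [h [ekh g'E fk fh]]].
rewrite g'E convol_mul// ncM.
have : nc (f k) < e / M.
  rewrite ltNge; apply/negP => Ck; apply: nC; exists k => //.
  by rewrite g'E rng_gmul.
rewrite ltr_pdivlMr// => h1; apply: le_lt_trans h1.
by rewrite ler_wpM2l ?nc_ge0.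
Qed.

(** The set where the modulus is at least [e] lies in the image under [gmul] of the composable pairs
    in a product of two compact sets; composability is a closed condition because [G] is
    Hausdorff. *)
Lemma C0bis_convol f f' : C0bis f -> C0bis f' -> C0bis (convol f f').
Proof.
move=> bf bf'.
have [sff rff _] := bisection_convol (C0bis_bisection bf) (C0bis_bisection bf').
split=> //; have cff := convol_continuous bf bf'.
have [f0 _ rf] := bf; have [f0' _ _] := bf'.
have [M M0 fM] := C0_bounded f0; have [M' M0' fM'] := C0_bounded f0'.
apply: C0_compactP => // e e0.
pose C := [set x | e / M' <= nc (f x)]; pose C' := [set x | e / M <= nc (f' x)].
have kC : compact C by apply: C0_compact => //; rewrite divr_gt0.
have kC' : compact C' by apply: C0_compact => //; rewrite divr_gt0.
pose K := (C `*` C') `&` [set p : G * G | src p.1 = rng p.2].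
have kK : compact K.
  apply: (@compact_closedI (G * G)%type); first exact: compact_setX.
  exact: composable_closed.
have : compact ((fun p : G * G => gmul p.1 p.2) @` K).
  apply: continuous_compact => //.
  by apply: continuous_subspaceW (@gmul_continuous G) => p [_].
move=> kI; apply: (subclosed_compact _ kI); first exact: closed_nc_ge.
move=> g /= eg.
have : convol f f' g != 0 by rewrite -nc_gt0 (lt_le_trans e0).
move=> /(convol_neq0 rf)[k [h [ekh gE fk fh]]]; exists (k, h) => //.
move: eg; rewrite gE convol_mul// ncM => eg.
split=> //; split; rewrite /= /C /C' /= ler_pdivrMr//.
  by apply: le_trans eg _; rewrite ler_wpM2l ?nc_ge0.
by apply: le_trans eg _; rewrite mulrC ler_wpM2l ?nc_ge0.
Qed.

Lemma bump_bis g (U : set G) : open U -> U g -> exists f,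
  [/\ C0bis f, f g = 1, Cc f & closure [set x | f x != 0] `<=` U].
Proof.
move=> oU Ug; have [V [oV Vg] [sV rV]] := eg_bisection eG g.
have [f [cf fg kf fUV]] := @compact_bump R G g _ (eg_hausdorff eG)
  (eg_locally_compact eG) (openI oU oV) (conj Ug Vg).
have fV k : f k != 0 -> V k by move=> fk; have [] := fUV _ (closure_support fk).
exists f; split=> //; last by move=> x /fUV[].
split; first exact: Cc_C0.
  by move=> k k' /fV Vk /fV Vk'; exact: sV.
by move=> k k' /fV Vk /fV Vk'; exact: rV.
Qed.

Lemma bump_units u (U : set G) : open U -> U u -> units G u -> exists f,
  [/\ C0units f, f u = 1 & forall x, f x != 0 -> U x].
Proof.
move=> oU Uu uu.
have [f [cf fg kf fU]] := @compact_bump R G u _ (eg_hausdorff eG)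
  (eg_locally_compact eG) (openI oU (eg_open_units eG)) (conj Uu uu).
exists f; split=> //; last by move=> x fx; have [] := fU _ (closure_support fx).
by split; [exact: Cc_C0|move=> x fx; have [] := fU _ (closure_support fx)].
Qed.

End EtaleGroupoid.

(** * Characters of the diagonal subalgebra *)

Section UnitFunctions.
Variables (R : realType) (G : topGroupoid).
Hypothesis eG : etale_groupoid G.
Implicit Types (f m : G -> R[i]).

Lemma C0units_add f m : C0units f -> C0units m -> C0units (f \+ m).
Proof.
move=> [f0 fu] [m0 mu]; split; last first.
  move=> g fmg; have [fg|/fu//] := eqVneq (f g) 0; apply: mu.
  by apply: contra fmg => /eqP mg; rewrite /= fg mg addr0.
have cf := C0_continuous f0; have cm := C0_continuous m0.
apply: C0_compactP; first exact: continuous_addC.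
move=> e e0; have e20 : 0 < e / 2 by rewrite divr_gt0.
have kU := compactU (C0_compact f0 e20) (C0_compact m0 e20).
apply: (subclosed_compact _ kU).
  by apply: closed_nc_ge; exact: continuous_addC.
move=> x /= ex; have [?|h] := leP (e / 2) (nc (f x)); [by left|right => /=].
by have := ler_ncD (f x) (m x); lra.
Qed.

Lemma C0units_mul f m : C0units f -> continuous (m : G -> R[i]^o) ->
  nc_bounded m -> C0units (f \* m).
Proof.
move=> [f0 fu] cm [M mM]; split; last first.
  by move=> g /=; rewrite mulf_eq0 negb_or => /andP[/fu].
have cf := C0_continuous f0.
pose M' := `|M| + 1; have M'0 : 0 < M' by rewrite ltr_wpDl.
apply: C0_compactP; first exact: continuous_mulC.
move=> e e0; have eM0 : 0 < e / M' by rewrite divr_gt0.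
apply: (subclosed_compact _ (C0_compact f0 eM0)).
  by apply: closed_nc_ge; exact: continuous_mulC.
move=> x /=; rewrite ncM ler_pdivrMr// => /le_trans; apply.
rewrite ler_wpM2l ?nc_ge0// (le_trans (mM x))// (le_trans (ler_norm _))//.
by rewrite lerDl.
Qed.

Lemma C0units_bounded f : C0units f -> nc_bounded f.
Proof. by move=> [/C0_bounded[M _ fM] _]; exists M. Qed.

Lemma C0units_continuous f : C0units f -> continuous (f : G -> R[i]^o).
Proof. by move=> [/C0_continuous]. Qed.

Lemma C0units_mul2 f m : C0units f -> C0units m -> C0units (f \* m).
Proof.
move=> fu mu; apply: C0units_mul => //; first exact: C0units_continuous.
exact: C0units_bounded.
Qed.

Lemma C0units_scale (c : R[i]) f : C0units f -> C0units (f \* cst c).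
Proof.
move=> fu; apply: C0units_mul => //; first exact: cst_continuous.
by exists (nc c) => g.
Qed.

Lemma C0units_conj f : C0units f -> C0units (fun g => (f g)^*).
Proof.
move=> [f0 fu]; split; last by move=> g; rewrite conjC_eq0; exact: fu.
have cf := C0_continuous f0; apply: C0_compactP; first exact: continuous_conj.
by move=> e e0; under eq_set do rewrite nc_conj; exact: C0_compact.
Qed.

Lemma convol_units f (xi : G -> R[i]) g : C0units f ->
  convol f xi g = f (rng g) * xi g.
Proof.
move=> [_ fu]; rewrite (@convol_single _ _ _ _ (rng g)) ?rng_rng//.
  by rewrite ginv_unit ?gmul_rng//; exact: rng_unit.
by move=> h rh /fu uh; rewrite -rh unit_rng.
Qed.

Lemma convol_units2 f m : C0units f -> C0units m -> convol f m = f \* m.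
Proof.
move=> fu mu; rewrite funeqE => g; rewrite convol_units//=.
have [->|mg] := eqVneq (m g) 0; first by rewrite !mulr0.
by rewrite unit_rng//; exact: mu.2.
Qed.

Lemma lambda_units_mul f m : C0units f -> C0units m ->
  lambda f \o lambda m = lambda (f \* m).
Proof.
move=> fu mu; rewrite lambda_comp ?convol_units2//.
  exact/C0bis_bisection/C0units_bis.
exact/C0bis_bisection/C0units_bis.
Qed.

Lemma lambda_units_add f m : C0units f -> C0units m ->
  lambda (f \+ m) = lambda f + lambda m.
Proof.
move=> fu mu; rewrite funeqE => xi; rewrite -[RHS]/(lambda f xi + lambda m xi).
have [l2xi|nl2] := pselect (l2 xi); last by rewrite !lambda_out// addr0.
rewrite !lambdaE// funeqE => g.
rewrite -[RHS]/(convol f xi g + convol m xi g) !convol_units//.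
  by rewrite -mulrDl.
exact: C0units_add.
Qed.

Lemma lambda_units_scale f (c : R[i]) : C0units f ->
  lambda (f \* cst c) = c *: lambda f.
Proof.
move=> fu; rewrite funeqE => xi; rewrite -[RHS]/(c *: (lambda f xi)).
have [l2xi|nl2] := pselect (l2 xi); last by rewrite !lambda_out// scaler0.
rewrite !lambdaE// funeqE => g; rewrite -[RHS]/(c * convol f xi g).
rewrite !convol_units//; last exact: C0units_scale.
by rewrite /= [f _ * c]mulrC mulrA.
Qed.

Lemma Cstar_units f : C0units f -> Cstar (lambda f).
Proof. by move=> /C0units_bis/C0bis_Cstar. Qed.

End UnitFunctions.

(** Formulated so that a star isomorphism respecting functions of the units and its inverse satisfy
    it alike. Compatibility with adjoints stays a separate hypothesis on [theta]. *)
Record cartan_morphism (R : realType) (G H : topGroupoid)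
    (theta : oper R G -> oper R H) : Prop := {
  cm_Cstar : forall T, Cstar T -> Cstar (theta T) ;
  cmD : forall S T, Cstar S -> Cstar T -> theta (S + T) = theta S + theta T ;
  cmZ : forall (c : R[i]) S, Cstar S -> theta (c *: S) = c *: theta S ;
  cmM : forall S T, Cstar S -> Cstar T -> theta (S \o T) = theta S \o theta T ;
  cm_units : forall f, C0units f ->
    exists2 f', C0units f' & theta (lambda f) = lambda f' }.

Section Characters.
Variables (R : realType) (G H : topGroupoid).
Hypotheses (eG : etale_groupoid G) (eH : etale_groupoid H).
Variable theta : oper R G -> oper R H.
Hypothesis cm : cartan_morphism theta.
Hypothesis cm_units_surj : forall f', C0units f' ->
  exists2 f, C0units f & theta (lambda f) = lambda f'.
Implicit Types f m : G -> R[i].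

Local Notation t f := (coef (theta (lambda f))).

Lemma cm_unitsE f : C0units f -> C0units (t f) /\ theta (lambda f) = lambda (t f).
Proof.
move=> /(cm_units cm)[f' fu' E]; rewrite E.
suff -> : coef (lambda f') = f' by [].
by rewrite funeqE => g; rewrite coef_lambda.
Qed.

Lemma cm_units_mul f m : C0units f -> C0units m -> t (f \* m) = t f \* t m.
Proof.
move=> fu mu; have [tf Ef] := cm_unitsE fu; have [tm Em] := cm_unitsE mu.
have cf := Cstar_units fu; have cm' := Cstar_units mu.
rewrite funeqE => y; rewrite -lambda_units_mul// (cmM cm)//.
by rewrite {1}Ef {1}Em lambda_units_mul// coef_lambda.
Qed.

Lemma cm_units_add f m : C0units f -> C0units m -> t (f \+ m) = t f \+ t m.
Proof.
move=> fu mu; have cf := Cstar_units fu; have cm' := Cstar_units mu.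
by rewrite funeqE => y; rewrite lambda_units_add// (cmD cm).
Qed.

Lemma cm_units_scale f (c : R[i]) : C0units f -> t (f \* cst c) = t f \* cst c.
Proof.
move=> fu; have cf := Cstar_units fu; rewrite funeqE => y.
by rewrite lambda_units_scale// (cmZ cm)//= mulrC.
Qed.

(* [f |-> t f y] is a nonzero character of [C0 (units G)].  If its kernel had no
   common zero, then by compactness some [v] with [t v y = 1] would satisfy
   [|v| <= 1/2], and [w = v / (1 - v)] would give [w = v + w v], which no
   character taking the value 1 at [v] can satisfy. *)
Lemma character_eval y : units H y ->
  exists2 x, units G x & forall f, C0units f -> t f y = f x.
Proof.
move=> uy; apply: contrapT => nx.
have {}nx x : units G x -> exists f, C0units f /\ t f y != f x.
  move=> ux; apply: contrapT => nf; apply: nx; exists x => // f fu.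
  by apply: contrapT => /eqP ne; apply: nf; exists f.
have [e eu ey] : exists2 e, C0units e & t e y = 1.
  have [f [fu fy _]] := bump_units R eH (@openT _) I uy.
  have [e eu E] := cm_units_surj fu; exists e => //.
  by rewrite E coef_lambda.
have [Me Me0 eMe] := C0_bounded eu.1.
have e20 : 0 < 2^-1 :> R by rewrite invr_gt0.
have kK := C0_compact eu.1 e20; set K := mkset _ in kK.
(* Large enough that [1 + F0] exceeds [2 * Me] on [K]: dividing [e] by it brings the modulus to at
   most 1/2 there, as is already the case off [K]. *)
pose N := 2 * Me + 1.
have hm x : exists m, K x -> [/\ C0units m, t m y = 0 & N < nc (m x)].
  have [Kx|] := pselect (K x); last by exists (cst 0).
  have ex : e x != 0 by rewrite -nc_gt0 (lt_le_trans e20).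
  have [f [fu fyx]] := nx _ (eu.2 _ ex).
  (* Killed by the character since [t e y = 1], yet nonzero at [x] since [f] distinguishes the
     character from evaluation at [x]. *)
  pose m0 := (f \* e) \+ (e \* cst (- t f y)).
  have m0u : C0units m0.
    by apply: C0units_add; [exact: C0units_mul2|exact: C0units_scale].
  have m0x : m0 x != 0.
    rewrite /m0 /= mulrN [e x * _]mulrC -mulrBl mulf_neq0// subr_eq0 eq_sym.
    exact: fyx.
  have m0y : t m0 y = 0.
    rewrite (cm_units_add (C0units_mul2 fu eu) (C0units_scale _ eu)).
    rewrite (cm_units_mul fu eu) (cm_units_scale _ eu) /=.
    by rewrite ey mulr1 mul1r subrr.
  exists (m0 \* cst ((N + 1) / nc (m0 x))%:C%C) => _; split.
  - exact: C0units_scale.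
  - by rewrite cm_units_scale//= m0y mul0r.
  - have N0 : 0 < N + 1 by rewrite /N; lra.
    rewrite ncM nc_real ger0_norm ?divr_ge0 ?nc_ge0 ?ltW//.
    by rewrite mulrC divfK ?nc_eq0// ltrDl.
have [mf mfP] := choice hm.
have [D KD] : exists D : seq G, {subset D <= K} /\
    forall z, K z -> exists2 x, x \in D & N < nc (mf x z).
  (* Extracts a finite subcover, the auxiliary filter being that of finite sets of centres ordered
     by inclusion. *)
  move/compact_near_coveringP :
    kK => /(_ _ (@summability.totally G) (fun D z => exists x, [/\ K x, x \in D
      & N < nc (mf x z)]) (@filter_filter _ _ (@summability.totally_filter G))).
  case=> [x Kx|D0 _ hD0].
    have [mu _ Nx] := mfP x Kx.
    have := open_nc_gt N (C0units_continuous mu); rewrite openE => /(_ x Nx) nN.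
    exists ([set z | N < nc (mf x z)], [set D : {fset G} | x \in D]) => /=.
      split=> //; exists [fset x]%fset => // D /fsubsetP; apply.
      by rewrite inE.
    by move=> [z D] /= [Nz xD]; exists x.
  exists [seq x <- D0 | x \in K]; split.
    by move=> x; rewrite mem_filter => /andP[].
  move=> z Kz; have [x [Kx xD Nz]] := hD0 _ (fsubset_refl D0) z Kz.
  by exists x => //; rewrite mem_filter mem_set.
have [DK {}KD] := KD.
(* Squared moduli add up without cancellation, and their sum stays in the kernel of the
   character. *)
pose F (s : seq G) z := \sum_(x <- s) nc (mf x z) ^+ 2.
have FE (s : seq G) : {subset s <= K} ->
    C0units (fun z => (F s z)%:C%C) /\ t (fun z => (F s z)%:C%C) y = 0.
  elim: s => [_|x s IH sK].
    rewrite (_ : (fun _ => _) = e \* cst 0); last first.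
      by rewrite funeqE => z; rewrite /F big_nil /= mulr0.
    split; first exact: C0units_scale.
    by rewrite cm_units_scale//= mulr0.
  have Kx : K x by apply/set_mem/sK; rewrite mem_head.
  have [mu my _] := mfP x Kx; have cu := C0units_conj mu.
  have [|Fu Fy] := IH; first by move=> z zs; apply: sK; rewrite in_cons zs orbT.
  rewrite (_ : (fun _ => _) = (mf x \* (fun z => (mf x z)^*)) \+
      (fun z => (F s z)%:C%C)); last first.
    by rewrite funeqE => z; rewrite /F big_cons /= mulr_conj -rmorphD.
  have mcu := C0units_mul2 mu cu.
  split; first exact: C0units_add.
  by rewrite cm_units_add//= cm_units_mul//= my Fy mul0r addr0.
have [Fu Fy] := FE D DK.
pose F0 := F D; rewrite -/F0 in Fu Fy.
have F0ge z : 0 <= F0 z by apply: sumr_ge0 => x _; exact: sqr_ge0.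
have F0gt z : K z -> 2 * Me < 1 + F0 z.
  move=> /KD[x xD Nx].
  have : nc (mf x z) ^+ 2 <= F0 z.
    rewrite /F0 /F (big_rem x)//= lerDl.
    by apply: sumr_ge0 => x' _; exact: sqr_ge0.
  move: Nx; rewrite /N; set a := nc _ => Nx aF; nra.
pose h z : R[i] := ((1 + F0 z)^-1)%:C%C.
have F01 z : 0 < 1 + F0 z by rewrite ltr_pwDl.
have ch : continuous (h : G -> R[i]^o).
  apply: continuous_realC => z; apply: (@cvgV R); first by rewrite gt_eqF.
  apply: (@cvgD R R^o); first exact: cvg_cst.
  have := continuous_nc (C0units_continuous Fu) => /(_ z).
  by rewrite (_ : (fun x => nc _) = F0)// funeqE => x; rewrite nc_real ger0_norm.
have bh : nc_bounded h.
  exists 1 => z; rewrite nc_real ger0_norm; last by rewrite invr_ge0 ltW.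
  by rewrite invf_le1// lerDl.
pose v := e \* h; have vu : C0units v by exact: C0units_mul.
have vE : e = v \+ ((fun z => (F0 z)%:C%C) \* v).
  rewrite funeqE => z /=; rewrite /v /=.
  have hz : (1 + (F0 z)%:C%C) * h z = 1.
    rewrite -(rmorph1 (@real_complex R)) -rmorphD -rmorphM /=.
    by rewrite divff// gt_eqF.
  have -> : e z * h z + (F0 z)%:C%C * (e z * h z) =
      e z * ((1 + (F0 z)%:C%C) * h z) by ring.
  by rewrite hz mulr1.
have vy : t v y = 1.
  have Fvu := C0units_mul2 Fu vu.
  by move: ey; rewrite {1}vE (cm_units_add vu Fvu) (cm_units_mul Fu vu) /= Fy mul0r addr0.
have v2 z : nc (v z) <= 2^-1.
  rewrite /v [(_ \* _) _]/= ncM nc_real ger0_norm; last by rewrite invr_ge0 ltW.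
  rewrite ler_pdivrMr//.
  have [Kz|] := pselect (K z); last first.
    move=> /negP; rewrite -ltNge => ez; apply: le_trans (ltW ez) _.
    by rewrite ler_peMr// lerDl.
  by have := eMe z; have := F0gt _ Kz; lra.
pose u z : R[i] := (1 - v z)^-1.
have v1 z : 2^-1 <= nc (1 - v z).
  by have := ler_ncD (1 - v z) (v z); rewrite subrK nc1; have := v2 z; lra.
have v1n0 z : 1 - v z != 0 by rewrite -nc_gt0 (lt_le_trans e20).
have cu : continuous (u : G -> R[i]^o).
  move=> z; apply: (@cvgV R[i]); first exact: v1n0.
  apply: (@cvgB R[i] R[i]^o); first exact: cvg_cst.
  exact: (C0units_continuous vu).
have bu : nc_bounded u.
  exists 2 => z; rewrite ncV -[2]invrK lef_pV2 ?posrE//.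
  by rewrite (lt_le_trans e20).
have wu : C0units (v \* u) by exact: C0units_mul.
have wE : v \* u = v \+ ((v \* u) \* v).
  rewrite funeqE => z /=; rewrite /u; move: (v1n0 z) => nz.
  by field.
have := congr1 (fun f => t f y) wE.
rewrite (cm_units_add vu (C0units_mul2 wu vu)) (cm_units_mul wu vu) /= vy.
rewrite mulr1 => /eqP.
by rewrite addrC -subr_eq0 opprD addrA subrr sub0r oppr_eq0 oner_eq0.
Qed.

End Characters.

(** * Reconstruction of the groupoid *)

(** Topological principality of a groupoid: the units with trivial isotropy are dense. Principal
    freeness of an action yields it for the semidirect product. *)
Definition principal_dense (G : topGroupoid) := exists D : set G,
  [/\ D `<=` units G, units G `<=` closure D &
    forall g, D (src g) -> rng g = src g -> units G g].

Section Intertwining.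
Variables (R : realType) (G H : topGroupoid).
Hypotheses (eG : etale_groupoid G) (eH : etale_groupoid H).
Variable theta : oper R G -> oper R H.
Hypothesis cm : cartan_morphism theta.
Implicit Types f b : G -> R[i].

Local Notation t f := (coef (theta (lambda f))).

Lemma Cstar_l2 (K : topGroupoid) (T : oper R K) (xi : K -> R[i]) :
  Cstar T -> l2 xi -> l2 (T xi).
Proof. by move=> [bT _]; exact: bounded_l2. Qed.

Lemma lambda_units_comp (K : topGroupoid) (f : K -> R[i]) (T : oper R K) xi g :
  Cstar T -> C0units f -> l2 xi ->
  lambda f (T xi) g = f (rng g) * T xi g.
Proof.
move=> cT fu l2xi; rewrite lambdaE ?convol_units//; exact: Cstar_l2.
Qed.

Lemma coef_units_comp f T k : C0units f -> Cstar T ->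
  coef (theta (lambda f \o T)) k = t f (rng k) * coef (theta T) k.
Proof.
move=> fu cT; have [tfu E] := cm_unitsE cm fu.
rewrite (cmM cm)//; last exact: Cstar_units.
rewrite {1}/coef {1}E /= lambda_units_comp//; first exact: cm_Cstar cm _ cT.
exact: l2_delta.
Qed.

Lemma lambda_units_delta (K : topGroupoid) (f : K -> R[i]) h : C0units f ->
  lambda f (delta R h) = f (rng h) *: delta R h.
Proof.
move=> fu; rewrite lambdaE; last exact: l2_delta.
rewrite funeqE => g; rewrite convol_units// -[RHS]/(f (rng h) * delta R h g).
by rewrite /delta; case: eqP => [->//|_]; rewrite !mulr0.
Qed.

Lemma convol_unitsr (K : topGroupoid) (b f : K -> R[i]) k :
  rng_injective b -> C0units f -> convol b f k = b k * f (src k).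
Proof.
move=> rb [_ fu]; have [bk|bk] := eqVneq (b k) 0; last first.
  by rewrite -{1}(gmul_src k) convol_mul// rng_src.
rewrite bk mul0r; apply/eqP/negPn/negP => /(convol_neq0 rb)[k' [h [e kE bk' fh]]].
have uh := fu _ fh; move: bk'; rewrite -(gmul_srcE (g := k') (u := h)).
  by rewrite -kE bk eqxx.
by rewrite e unit_rng.
Qed.

Variable sg : G -> H.
Hypothesis sg_units : forall x, units G x -> units H (sg x).
Hypothesis sgE : forall x f, units G x -> C0units f -> t f (sg x) = f x.
Hypothesis sg_continuous : forall x (V : set H), units G x -> open V ->
  V (sg x) -> exists W : set G, open_nbhs x W /\
    forall x', W x' -> units G x' -> V (sg x').

(** Cutting [theta (lambda b)] by the image of [f] on both sides keeps its coefficient at [sg x],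
    because [t f] is 1 there. *)
Let intertwine_local b x (W : set G) : C0bis b -> units G x -> open W -> W x ->
  (forall k, b k != 0 -> W (src k) -> W (rng k) -> units G k) ->
  t b (sg x) = b x.
Proof.
move=> bb ux oW Wx hW; have [f [fu fx fW]] := bump_units R eG oW Wx ux.
have fb := C0units_bis fu; have bbf := C0bis_convol eG bb fb.
have [_ rb _] := C0bis_bisection bb.
have cE k : convol f (convol b f) k = f (rng k) * (b k * f (src k)).
  by rewrite convol_units// convol_unitsr//; case: bb.
have cu : C0units (convol f (convol b f)).
  split; first by have [] := C0bis_convol eG fb bbf.
  move=> k; rewrite cE !mulf_eq0 !negb_or => /and3P[fr bk fs].
  by apply: hW => //; exact: fW.
have := sgE ux cu; rewrite cE (unit_rng ux) (ux : src x = x) fx mul1r mulr1 => <-.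
have cb := C0bis_Cstar bb.
have cf := Cstar_units fu.
rewrite -lambda_comp; [|exact: C0bis_bisection..].
rewrite coef_units_comp//; last exact: C0bis_Cstar.
have usx := sg_units ux.
rewrite (unit_rng usx) (sgE ux fu) fx mul1r.
rewrite -lambda_comp; [|exact: C0bis_bisection..].
rewrite (cmM cm)// {2}/coef /=.
have [tfu E] := cm_unitsE cm fu.
by rewrite E lambda_units_delta// rng_src (usx : src _ = _) (sgE ux fu) fx
  scale1r /coef (usx : src _ = _).
Qed.

(* No norm estimate on [theta] is needed: at a unit [x] with trivial isotropy, a
   bump function [f] at [x] turns [b] into a function [f * b * f] supported on
   units, where [theta] is already known; the other units follow by density. *)
Lemma coef_intertwine b x : principal_dense G -> C0bis b -> units G x ->
  t b (sg x) = b x.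
Proof.
move=> [D [Du Dd Di]] bb ux; apply: contrapT => /eqP ne.
have [b0 sb _] := bb; have cb := C0_continuous b0.
have ctb : continuous (t b : H -> R[i]^o).
  by apply: C0_continuous; apply: coef_C0; apply: (cm_Cstar cm); exact: C0bis_Cstar.
(* Both sides are continuous in the unit, so a failure at [x] spreads to an open set, in which a
   unit of [D] can be looked for. *)
have [N [oN Nx] hN] : exists2 N : set G, open_nbhs x N &
    forall x', N x' -> units G x' /\ t b (sg x') != b x'.
  pose d := nc (t b (sg x) - b x) / 2.
  have d0 : 0 < d by rewrite divr_gt0// nc_gt0 subr_eq0.
  pose V := [set y | nc (t b y - t b (sg x)) < d].
  have nV : nbhs (sg x) V by move/nc_continuousP : ctb; exact.
  move: nV; rewrite nbhsE => -[V' [oV' V'x] V'V].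
  have [W [nW WV]] := sg_continuous ux oV' V'x.
  have nB : nbhs x [set x' | nc (b x' - b x) < d].
    by move/nc_continuousP : cb; exact.
  have nU : nbhs x (units G) by apply: open_nbhs_nbhs; split=> //; case: eG.
  have : nbhs x (units G `&` ([set x' | nc (b x' - b x) < d] `&` W)).
    by apply: filterI => //; apply: filterI => //; exact: open_nbhs_nbhs.
  rewrite nbhsE => -[N nN NS]; exists N => // x' /NS[ux' [/= bx' Wx']].
  split=> //; apply/eqP => e; have := V'V _ (WV _ Wx' ux').
  rewrite /V /= e nc_distC => h1.
  have := ler_ncD (t b (sg x) - b x') (b x' - b x); rewrite addrA subrK => h2.
  have h3 : nc (t b (sg x) - b x) = 2 * d by rewrite /d mulrC divfK.
  by move: h1 h2 bx'; rewrite h3; lra.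
have oS : open (src @` [set k | b k != 0]).
  by apply: eg_open_src eG _ _; exact: open_neq0.
(* If no arrow of the support of [b] has its source in [N], [intertwine_local] applies vacuously at
   [x]. Otherwise the open set of such sources meets [D]. *)
have [[z [Nz Sz]]|n] := pselect (N `&` src @` [set k | b k != 0] !=set0); last first.
  have [_ /eqP] := hN x Nx; apply.
  apply: (@intertwine_local _ _ N) => // k bk Nk; case: n.
  by exists (src k); split=> //; exists k.
have [uz _] := hN z Nz.
have [x1 [Dx1 [Nx1 [k0 /= bk0 sk0]]]] : D `&` (N `&` src @` [set k | b k != 0]) !=set0.
  by apply: Dd uz _ _; apply: open_nbhs_nbhs; split => //; exact: openI.
have [ux1 /eqP] := hN x1 Nx1; apply.
have [rk0|rk0] := pselect (rng k0 = x1).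
  have uk0 : units G k0 by apply: Di; rewrite sk0.
  have bx1 : b x1 != 0 by rewrite -sk0 (uk0 : src k0 = k0).
  apply: (@intertwine_local _ _ [set k | b k != 0]) => //; first exact: open_neq0.
  move=> k bk /= bsk _; rewrite (sb _ _ bk bsk) ?src_src//; exact: src_unit.
(* When [rng k0] differs from [x1], the arrows of the support with source close to [x1] end in [B],
   away from [A], so none of them has both ends near [x1]. *)
have [A [B [[oA Ax1] [oB Bk0] AB]]] := hausdorff_sep (eg_hausdorff eG) (nesym rk0).
pose N1 := [set k | b k != 0] `&` rng @^-1` B.
have oN1 : open N1.
  apply: openI; first exact: open_neq0.
  by apply: open_comp => // k _; exact: rng_continuous.
apply: (@intertwine_local _ _ (src @` N1 `&` A)) => //.
- by apply: openI => //; exact: eg_open_src eG _ oN1.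
- by split=> //; exists k0.
- move=> k bk [[k1 [bk1 Bk1] sk1] _] [_ Ak].
  have kk1 : k = k1 by apply: sb.
  have : (A `&` B) (rng k) by split=> //; rewrite kk1.
  by rewrite AB.
Qed.

End Intertwining.

Section UnitMap.
Variables (R : realType) (G H : topGroupoid).
Hypotheses (eG : etale_groupoid G) (eH : etale_groupoid H).
Variables (theta : oper R G -> oper R H) (theta' : oper R H -> oper R G).
Hypotheses (cm : cartan_morphism theta) (cm' : cartan_morphism theta').
Hypothesis thetaK : forall T, Cstar T -> theta' (theta T) = T.
Hypothesis thetaKV : forall S, Cstar S -> theta (theta' S) = S.

Local Notation t f := (coef (theta (lambda f))).

Lemma C0units_separate (K : topGroupoid) (x x' : K) : etale_groupoid K ->
  units K x -> (forall f : K -> R[i], C0units f -> f x = f x') -> x = x'.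
Proof.
move=> eK ux h; apply: contrapT => ne.
have [U [V [[oU Ux] [_ Vx] UV]]] := hausdorff_sep (eg_hausdorff eK) ne.
have [f [fu fx fU]] := bump_units R eK oU Ux ux.
have : (U `&` V) x' by split=> //; apply: fU; rewrite -h// fx oner_eq0.
by rewrite UV.
Qed.

Lemma cm_units_surj f' : C0units f' ->
  exists2 f, C0units f & theta (lambda f) = lambda f'.
Proof.
move=> fu'; have [f fu E] := cm_units cm' fu'; exists f => //.
by rewrite -E thetaKV//; exact: Cstar_units.
Qed.

Lemma cm_units_surj' f : C0units f ->
  exists2 f', C0units f' & theta' (lambda f') = lambda f.
Proof.
move=> fu; have [f' fu' E] := cm_units cm fu; exists f' => //.
by rewrite -E thetaK//; exact: Cstar_units.
Qed.

(** The point [sg x] comes from the inverse: the coefficient at [x] of [theta' (lambda f')] is a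
    character in [f'], hence evaluation at a unit of [H]. Surjectivity uses the characters of
    [theta] in the same way; continuity holds because bump functions detect neighbourhoods. *)
Lemma unit_map : exists sg : G -> H,
  [/\ forall x, units G x -> units H (sg x),
      forall x f, units G x -> C0units f -> t f (sg x) = f x,
      (forall x x', units G x -> units G x' -> sg x = sg x' -> x = x'),
      (forall y, units H y -> exists2 x, units G x & y = sg x) &
      (forall x (V : set H), units G x -> open V ->
        V (sg x) -> exists W : set G, open_nbhs x W /\
          forall x', W x' -> units G x' -> V (sg x'))].
Proof.
(* Stated at [src x], so that the choice is total on [G]. *)
have ex x : exists y, units H y /\ forall f, C0units f -> t f y = f (src x).
  have [y uy hy] := character_eval eG cm' cm_units_surj' (src_unit x).
  exists y; split=> // f fu; have [tfu E] := cm_unitsE cm fu.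
  by rewrite -hy// -E thetaK ?coef_lambda//; exact: Cstar_units.
have [sg sgP] := choice ex.
have sgu x : units H (sg x) by have [] := sgP x.
have sgE x f : units G x -> C0units f -> t f (sg x) = f x.
  by move=> ux fu; have [_ ->//] := sgP x; rewrite (ux : src x = x).
exists sg; split => //.
- move=> x x' ux ux' e; apply: (C0units_separate eG ux) => f fu.
  by rewrite -sgE// e sgE.
- move=> y uy; have [x ux hx] := character_eval eH cm cm_units_surj uy.
  exists x => //; apply: (C0units_separate eH uy) => f' fu'.
  have [f fu E] := cm_units_surj fu'.
  by rewrite -!(coef_lambda f') -E hx// sgE.
- move=> x V ux oV Vx.
  have [f' [fu' f'x f'V]] := bump_units R eH oV Vx (sgu x).
  have [f fu E] := cm_units_surj fu'.
  exists [set z | f z != 0]; split.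
    split; first by apply: open_neq0; exact: C0units_continuous.
    by rewrite /= -sgE// E coef_lambda f'x oner_neq0.
  move=> x' /= fx' ux'; apply: f'V.
  by rewrite -(coef_lambda f') -E sgE.
Qed.

End UnitMap.

Section StarProduct.
Variables (R : realType) (G : topGroupoid).
Implicit Types T : G -> R[i].

(** At a unit [x], [convol (fstar T') T] is the inner product of the vectors [T delta_x] and
    [T' delta_x], reduced here to a single term. *)
Lemma convol_fstar_at T T' k : C0bis T' -> T' k != 0 ->
  convol (fstar T') T (src k) = (T' k)^* * T k.
Proof.
move=> bT' Tk; have [_ rs _] := bisection_fstar (C0bis_bisection bT').
rewrite (@convol_at _ _ _ _ (ginv k))//.
- by rewrite /fstar !ginvK gmul_src.
- by rewrite /fstar ginvK conjC_eq0.
- by rewrite rng_ginv rng_src.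
Qed.

Lemma convol_fstar_eq0 T T' x : units G x -> C0bis T' ->
  (forall k, src k = x -> T' k != 0 -> T k = 0) -> convol (fstar T') T x = 0.
Proof.
move=> ux bT' h; have [_ rs _] := bisection_fstar (C0bis_bisection bT').
apply/eqP/negPn/negP => /(convol_neq0 rs)[k [l [e xE Tk Tl]]].
have rk : rng k = x by rewrite -(rng_gmul e) -xE unit_rng.
have lE : l = ginv k.
  by rewrite -(gmulK e) -xE gmul_srcE// src_ginv rk.
move: Tl; rewrite lE h ?eqxx// ?src_ginv//.
by move: Tk; rewrite /fstar conjC_eq0.
Qed.

End StarProduct.

Section Reconstruction.
Variables (R : realType) (G H : topGroupoid).
Hypotheses (eG : etale_groupoid G) (eH : etale_groupoid H).
Hypotheses (pG : principal_dense G) (pH : principal_dense H).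
Variables (theta : oper R G -> oper R H) (theta' : oper R H -> oper R G).
Hypotheses (cm : cartan_morphism theta) (cm' : cartan_morphism theta').
Hypothesis thetaK : forall T, Cstar T -> theta' (theta T) = T.
Hypothesis thetaKV : forall S, Cstar S -> theta (theta' S) = S.
Hypothesis theta_adjoint : forall S T, Cstar S -> Cstar T -> adjoint S T ->
  adjoint (theta S) (theta T).
Implicit Types (f T : G -> R[i]) (S : H -> R[i]).

Local Notation t f := (coef (theta (lambda f))).
Local Notation t' f := (coef (theta' (lambda f))).

Variable sg : G -> H.
Hypothesis sg_units : forall x, units G x -> units H (sg x).
Hypothesis sgE : forall x f, units G x -> C0units f -> t f (sg x) = f x.
Hypothesis sg_inj : forall x x', units G x -> units G x' ->
  sg x = sg x' -> x = x'.
Hypothesis sg_surj : forall y, units H y -> exists2 x, units G x & y = sg x.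
Hypothesis sg_continuous : forall x (V : set H), units G x -> open V ->
  V (sg x) -> exists W : set G, open_nbhs x W /\ forall x', W x' -> units G x' -> V (sg x').

Let tE T x : C0bis T -> units G x -> t T (sg x) = T x.
Proof. exact: (coef_intertwine eG cm sg_units sgE sg_continuous pG). Qed.

Let tE' S x : C0bis S -> units G x -> t' S x = S (sg x).
Proof.
move=> bS ux.
(* The unit map of [theta'] inverts [sg], since functions of the units do not distinguish
   [sg' (sg x)] from [x]. *)
have [sg' [su' sE' _ _ sc']] := unit_map eH eG cm' cm thetaKV thetaK.
have e : sg' (sg x) = x.
  have ux' := su' _ (sg_units ux).
  apply: (C0units_separate eG ux') => f fu.
  have [tfu E] := cm_unitsE cm fu.
  rewrite -(sgE ux fu) -(sE' _ _ (sg_units ux) tfu) -E thetaK ?coef_lambda//.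
  exact: Cstar_units.
rewrite -{1}e.
exact: (coef_intertwine eH cm' su' sE' sc' pH bS (sg_units ux)).
Qed.

Let theta_Cstar T : C0bis T -> Cstar (theta (lambda T)).
Proof. by move=> bT; apply: (cm_Cstar cm); exact: C0bis_Cstar. Qed.

(* Both sides are the coefficient at [sg x] of the image of [T'^* * T]. *)
Lemma inner_theta T T' x : C0bis T -> C0bis T' -> units G x ->
  l2inner (theta (lambda T) (delta R (sg x)))
    (theta (lambda T') (delta R (sg x))) = convol (fstar T') T x.
Proof.
move=> bT bT' ux; have bs := C0bis_fstar bT'.
have cs := C0bis_Cstar bs; have cT := C0bis_Cstar bT.
have cT' := C0bis_Cstar bT'.
have adj : adjoint (lambda (fstar T')) (lambda T').
  by rewrite -{2}(fstarK T'); apply: adjoint_lambda; exact: C0bis_bisection.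
have l2T : l2 (theta (lambda T) (delta R (sg x))).
  by apply: Cstar_l2; [exact: theta_Cstar|exact: l2_delta].
rewrite -(theta_adjoint cs cT' adj l2T (l2_delta R _)) l2inner_deltar.
rewrite -(tE _ ux); last exact: C0bis_convol.
rewrite -lambda_comp; [|exact: C0bis_bisection..].
by rewrite (cmM cm)// /coef/= (sg_units ux : src _ = _).
Qed.

Let theta_delta T x k : C0bis T -> units G x ->
  theta (lambda T) (delta R (sg x)) k = if src k == sg x then t T k else 0.
Proof.
move=> bT ux; rewrite (Cstar_delta _ _ (theta_Cstar bT)).
rewrite (sg_units ux : src _ = _); case: eqP => // e.
by rewrite ginv_unit ?gmul_srcE//; exact: sg_units.
Qed.

(** By [inner_theta] the image vector has inner product 0 with itself; supports are thus compared
    without any estimate on [theta]. *)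
Lemma theta_vanish T x : C0bis T -> units G x ->
  (forall k, src k = x -> T k = 0) ->
  theta (lambda T) (delta R (sg x)) = 0.
Proof.
move=> bT ux h; apply: l2inner_self0.
  by apply: Cstar_l2; [exact: theta_Cstar|exact: l2_delta].
rewrite inner_theta// convol_fstar_eq0// => k sk.
by rewrite h.
Qed.

Lemma coef_theta_src T k x : C0bis T -> units G x -> src k = sg x ->
  t T k != 0 -> exists2 g, src g = x & T g != 0.
Proof.
move=> bT ux sk tk; apply: contrapT => n.
move: tk; have := theta_delta k bT ux; rewrite sk eqxx => <-.
rewrite theta_vanish ?eqxx// => g sg'; apply/eqP/negPn/negP => Tg.
by apply: n; exists g.
Qed.

Lemma coef_theta_ex T g : C0bis T -> T g != 0 ->
  exists2 k, src k = sg (src g) & t T k != 0.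
Proof.
move=> bT Tg; apply: contrapT => n; have ux := src_unit g.
have z : theta (lambda T) (delta R (sg (src g))) = 0.
  rewrite funeqE => k; rewrite theta_delta//; case: eqP => // sk.
  by apply/eqP/negPn/negP => tk; apply: n; exists k.
have := inner_theta bT bT ux; rewrite z convol_fstar_at//.
rewrite (l2inner_single _ (k := sg (src g)))// mul0r => /esym/eqP.
by rewrite mulf_eq0 conjC_eq0 orbb (negbTE Tg).
Qed.

(** If [rng k] were [sg x2] with [x2] other than [rng g], multiplying [T] by a function of the units
    that is 1 at [x2] and 0 at [rng g] would remove the arrow [g], hence kill the image vector,
    while leaving the coefficient at [k] unchanged. *)
Lemma coef_theta_rng T g k : C0bis T -> T g != 0 -> src k = sg (src g) ->
  t T k != 0 -> rng k = sg (rng g).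
Proof.
move=> bT Tg sk tk; have [x2 ux2 rk] := sg_surj (rng_unit k).
rewrite rk; congr sg; apply: contrapT => ne.
have oV : open (~` [set rng g]).
  apply: closed_openC; apply: accessible_closed_set1.
  exact: hausdorff_accessible (eg_hausdorff eG).
have [f [fu fx fV]] := bump_units R eG oV (ne : (~` [set rng g]) x2) ux2.
have fb := C0units_bis fu; have bfT := C0bis_convol eG fb bT.
have [_ sT _] := bT.
have zero k' : src k' = src g -> convol f T k' = 0.
  move=> sk'; rewrite convol_units//; apply/eqP.
  rewrite mulf_eq0; apply/orP; have [_|Tk'] := eqVneq (T k') 0; first by right.
  left; rewrite (sT _ _ Tk' Tg sk'); apply/negPn/negP => /fV.
  exact.
have := theta_delta k bfT (src_unit g); rewrite theta_vanish//; last exact: src_unit.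
rewrite sk eqxx -lambda_comp; [|exact: C0bis_bisection..].
rewrite (coef_units_comp cm)//; last exact: C0bis_Cstar.
by rewrite rk sgE// fx mul1r => /esym/eqP; rewrite (negbTE tk).
Qed.

(** Two arrows of the support with the same source have the same range by [coef_theta_rng]; over [D]
    their quotient is isotropy, hence a unit. In general, disjoint neighbourhoods of two such arrows
    have overlapping open sets of sources, and the overlap meets [D]. *)
Lemma coef_theta_src_injective T : C0bis T -> src_injective (t T).
Proof.
move=> bT; have [_ sT _] := bT; have [D [Du Dd Di]] := pH.
have ctT : continuous (t T : H -> R[i]^o).
  by apply: C0_continuous; apply: coef_C0; exact: theta_Cstar.
have onD k1 k2 : D (src k1) -> t T k1 != 0 -> t T k2 != 0 ->
    src k1 = src k2 -> k1 = k2.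
  move=> Dk tk1 tk2 e; have [x ux yE] := sg_surj (src_unit k1).
  have [g sgx Tg] := coef_theta_src bT ux yE tk1.
  have rk1 : rng k1 = sg (rng g) by apply: coef_theta_rng tk1 => //; rewrite sgx.
  have rk2 : rng k2 = sg (rng g).
    by apply: coef_theta_rng tk2 => //; rewrite sgx -e.
  have r12 : rng k1 = rng k2 by rewrite rk1 rk2.
  have um : units H (gmul (ginv k1) k2).
    by apply: Di; rewrite src_mulV// ?rng_mulV// -e.
  rewrite -(gmulKV r12) -[in LHS](gmul_src k1); congr gmul.
  by rewrite -(um : src _ = _) src_mulV// e.
move=> k1 k2 tk1 tk2 e; apply: contrapT => ne.
have [U1 [U2 [[oU1 Uk1] [oU2 Uk2] U12]]] := hausdorff_sep (eg_hausdorff eH) ne.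
pose V U := src @` (U `&` [set k | t T k != 0]).
have oV U : open U -> open (V U).
  by move=> oU; apply: eg_open_src eH _ _; apply: openI => //; exact: open_neq0.
have [y [Dy [[k1' [Uk1' tk1'] e1] [k2' [Uk2' tk2'] e2]]]] :
    D `&` (V U1 `&` V U2) !=set0.
  apply: (Dd (src k1) (src_unit k1)); apply: open_nbhs_nbhs; split.
    by apply: openI; exact: oV.
  by split; [exists k1|exists k2].
have k12 : k1' = k2' by apply: onD => //; rewrite ?e1 ?e2.
have : (U1 `&` U2) k1' by split => //; rewrite k12.
by rewrite U12.
Qed.

Lemma coef_theta_fstar T k : C0bis T ->
  t (fstar T) k = (t T (ginv k))^*.
Proof.
move=> bT; have bs := C0bis_fstar bT.
have cs := C0bis_Cstar bs; have cT := C0bis_Cstar bT.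
have adj : adjoint (lambda (fstar T)) (lambda T).
  by rewrite -{2}(fstarK T); apply: adjoint_lambda; exact: C0bis_bisection.
have := theta_adjoint cs cT adj (l2_delta R (src k)) (l2_delta R k).
rewrite l2inner_deltar l2inner_deltal -[LHS]/(t (fstar T) k) => ->.
rewrite (Cstar_delta _ _ (theta_Cstar bT)) src_src eqxx.
by rewrite -[src k]rng_ginv gmul_rng.
Qed.

(** Range injectivity is source injectivity for the adjoint; the operators then agree because their
    coefficients do. *)
Lemma coef_theta_bis T : C0bis T ->
  C0bis (t T) /\ theta (lambda T) = lambda (t T).
Proof.
move=> bT; have bt : C0bis (t T).
  split; [by apply: coef_C0; exact: theta_Cstar
         |exact: coef_theta_src_injective|].
  have inj := coef_theta_src_injective (C0bis_fstar bT).
  move=> k k' tk tk' e; apply: (can_inj (@ginvK H)); apply: inj.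
  - by rewrite coef_theta_fstar// ginvK conjC_eq0.
  - by rewrite coef_theta_fstar// ginvK conjC_eq0.
  - by rewrite !src_ginv.
split=> //; apply: Cstar_coef_inj; [exact: theta_Cstar|exact: C0bis_Cstar|].
by rewrite funeqE => k; rewrite coef_lambda.
Qed.

Let inner_single T T' x k : C0bis T -> C0bis T' -> units G x ->
  src k = sg x -> t T' k != 0 ->
  convol (fstar T') T x = t T k * (t T' k)^*.
Proof.
move=> bT bT' ux sk tk; rewrite -inner_theta// (l2inner_single _ (k := k)).
  by rewrite !theta_delta// sk eqxx.
move=> k' ne; rewrite theta_delta//; case: eqP => // sk'.
apply/eqP/negPn/negP => tk'; apply: ne.
by apply: (coef_theta_src_injective bT') => //; rewrite sk sk'.
Qed.

Let psi_ex : exists psi : G -> H, forall g, src (psi g) = sg (src g) /\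
  forall T, C0bis T -> T g != 0 -> t T (psi g) != 0.
Proof.
suff ex g : exists k, src k = sg (src g) /\
    forall T, C0bis T -> T g != 0 -> t T k != 0.
  by have [psi hpsi] := choice ex; exists psi.
have [T0 [bT0 T0g _ _]] := bump_bis R eG (@openT _) (I : setT g).
have T0g0 : T0 g != 0 by rewrite T0g oner_neq0.
have [k sk tk] := coef_theta_ex bT0 T0g0.
exists k; split=> // T bT Tg; have ux := src_unit g.
(* The inner product of the image vectors of [T] and [T0] has its only term at [k]. It equals [T g]
   times the conjugate of [T0 g], hence is nonzero: the arrow found from [T0] serves every [T]. *)
have := inner_single bT bT0 ux sk tk; rewrite convol_fstar_at// => e.
have : (T0 g)^* * T g != 0 by rewrite mulf_neq0 ?conjC_eq0.
by rewrite e mulf_eq0 negb_or => /andP[].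
Qed.

(* The arrow [psi g] is the only one with source [sg (src g)] at which [t T] does
   not vanish, whenever [T g] is nonzero. *)
Lemma reconstruction : exists psi : G -> H,
  [/\ groupoid_iso psi,
      forall T g, C0bis T -> (t T (psi g) != 0) = (T g != 0) &
      forall S g, C0bis S -> (t' S g != 0) = (S (psi g) != 0)].
Proof.
have [psi /all_and2[src_psi psiT]] := psi_ex.
have rng_psi g : rng (psi g) = sg (rng g).
  have [T [bT Tg _ _]] := bump_bis R eG (@openT _) (I : setT g).
  have Tg0 : T g != 0 by rewrite Tg oner_neq0.
  by apply: (coef_theta_rng bT Tg0); [exact: src_psi|exact: psiT].
have psi_uniq T g k : C0bis T -> T g != 0 -> src k = sg (src g) ->
    t T k != 0 -> k = psi g.
  move=> bT Tg sk tk; apply: (coef_theta_src_injective bT) => //.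
    exact: psiT.
  by rewrite src_psi.
(* Bump functions at [g] and [g'] have images that are nonzero at the same arrow, so their inner
   product is nonzero and [T] does not vanish at [g']; its support is a bisection. *)
have psi_inj g g' : psi g = psi g' -> g = g'.
  move=> e; have sgg : src g = src g'.
    by apply: sg_inj; [exact: src_unit|exact: src_unit|rewrite -!src_psi e].
  have [T [bT Tg _ _]] := bump_bis R eG (@openT _) (I : setT g).
  have [T' [bT' Tg' _ _]] := bump_bis R eG (@openT _) (I : setT g').
  have Tg0 : T g != 0 by rewrite Tg oner_neq0.
  have Tg0' : T' g' != 0 by rewrite Tg' oner_neq0.
  have tk := psiT _ _ bT Tg0; have tk' := psiT _ _ bT' Tg0'.
  rewrite -e in tk'.
  have := inner_single bT bT' (src_unit g) (src_psi g) tk'.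
  rewrite sgg convol_fstar_at// => E.
  have : t T (psi g) * (t T' (psi g))^* != 0 by rewrite mulf_neq0 ?conjC_eq0.
  rewrite -E mulf_eq0 negb_or => /andP[_ Tg'0].
  by have [_ sT _] := bT; apply: sT.
have psiE T g : C0bis T -> (t T (psi g) != 0) = (T g != 0).
  move=> bT; apply/idP/idP; last exact: psiT.
  move=> tk; have [g' sg' Tg'] := coef_theta_src bT (src_unit g) (src_psi g) tk.
  suff <- : g' = g by [].
  apply: psi_inj; apply/esym; apply: psi_uniq Tg' _ tk => //.
  by rewrite src_psi sg'.
(* Both sides are the coefficient at the unit [src g] of [theta'] applied to
   [theta (lambda T) \o lambda S], computed once by letting [theta'] undo [theta] and once through
   [tE']. Thus [t' S] is described without an adjoint relation for [theta']. *)
have coef_comp T S g : C0bis T -> C0bis S -> T (ginv g) != 0 ->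
    T (ginv g) * t' S g =
    t T (psi (ginv g)) * S (ginv (psi (ginv g))).
  move=> bT bS Tg; have [bt tE2] := coef_theta_bis bT.
  have ux := src_unit g; have cT := C0bis_Cstar bT; have cS := C0bis_Cstar bS.
  have cS' := cm_Cstar cm' cS.
  have := tE' (C0bis_convol eH bt bS) ux.
  rewrite -lambda_comp; [|exact: C0bis_bisection..].
  rewrite (cmM cm') ?C0bis_Cstar//; last exact: C0bis_Cstar.
  rewrite -tE2 thetaK// {1}/coef /= lambdaE; last first.
    by apply: Cstar_l2 => //; exact: l2_delta.
  rewrite (@convol_at _ _ _ _ (ginv g))//; [|by case: bT|by rewrite rng_ginv rng_src].
  rewrite ginvK src_src gmul_src => ->.
  rewrite (@convol_at _ _ _ _ (psi (ginv g))).
  - by rewrite gmul_srcE// src_ginv rng_psi rng_ginv.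
  - by case: bt.
  - exact: psiT.
  - by rewrite rng_psi rng_ginv unit_rng//; exact: sg_units.
(* Provisional form of [psi g]: the two agree once [psi] is known to respect inverses. *)
pose chi g := ginv (psi (ginv g)).
have chiE S g : C0bis S -> (t' S g != 0) = (S (chi g) != 0).
  move=> bS.
  have [T [bT Tg _ _]] := bump_bis R eG (@openT _) (I : setT (ginv g)).
  have Tg0 : T (ginv g) != 0 by rewrite Tg oner_neq0.
  have := coef_comp _ _ _ bT bS Tg0; rewrite Tg mul1r => ->.
  by rewrite mulf_eq0 negb_or psiT.
(* If [k] were missed, a bump function [S] at [k] would have [theta' (lambda S)] vanish on
   [delta_x], against the value of [convol (fstar S) S] at [sg x]. *)
have chi_surj k : exists g, k = chi g.
  have [x ux yE] := sg_surj (src_unit k).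
  have [S [bS Sk _ _]] := bump_bis R eH (@openT _) (I : setT k).
  have Sk0 : S k != 0 by rewrite Sk oner_neq0.
  apply: contrapT => n.
  have bs := C0bis_fstar bS.
  have zero : theta' (lambda S) (delta R x) = 0.
    rewrite funeqE => g; rewrite (Cstar_delta _ _ (cm_Cstar cm' (C0bis_Cstar bS))).
    rewrite (ux : src x = x); case: eqP => // sgx.
    rewrite ginv_unit// gmul_srcE//; apply/eqP/negPn/negP.
    rewrite chiE// => Sc; apply: n; exists g.
    have [_ sS _] := bS; apply: sS => //.
    by rewrite src_ginv rng_psi rng_ginv sgx.
  have := tE' (C0bis_convol eH bs bS) ux.
  rewrite -lambda_comp; [|exact: C0bis_bisection..].
  rewrite (cmM cm'); [|exact: C0bis_Cstar..].
  rewrite /coef /= (ux : src x = x) zero -yE convol_fstar_at//.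
  have [[lin _ _] _] := cm_Cstar cm' (C0bis_Cstar bs).
  have l20 := @l2_0 R G.
  have := lin (-1) 0 0 l20 l20; rewrite scaler0 addr0 scaleN1r addNr => ->.
  by rewrite Sk mulr1 conjC1 => /esym/eqP; rewrite oner_eq0.
have psi_hom : groupoid_morphism psi.
  move=> g h gh; have gh' : src (psi g) = rng (psi h).
    by rewrite src_psi rng_psi (gh : src g = rng h).
  split=> //.
  have [T [bT Tg _ _]] := bump_bis R eG (@openT _) (I : setT g).
  have Tg0 : T g != 0 by rewrite Tg oner_neq0.
  have [T' [bT' Th _ _]] := bump_bis R eG (@openT _) (I : setT h).
  have Th0 : T' h != 0 by rewrite Th oner_neq0.
  have bTT := C0bis_convol eG bT bT'; have [_ _ rT] := bT.
  have TTgh : convol T T' (gmul g h) != 0.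
    by rewrite convol_mul// Tg Th mulr1 oner_neq0.
  have [bt tE2] := coef_theta_bis bT; have [bt' tE2'] := coef_theta_bis bT'.
  have cT := C0bis_Cstar bT; have cT' := C0bis_Cstar bT'.
  (* The image of the product is a convolution that is nonzero at [psi (gmul g h)], so this arrow is
     a product of arrows of the two supports, which [psi_uniq] identifies. *)
  have := psiT _ _ bTT TTgh.
  rewrite -lambda_comp; [|exact: C0bis_bisection..].
  rewrite (cmM cm)// tE2 tE2' lambda_comp; [|exact: C0bis_bisection..].
  rewrite coef_lambda => /convol_neq0[|k [l [e E tk tl]]]; first by case: bt.
  have lE : l = psi h.
    apply: psi_uniq Th0 _ tl => //.
    by rewrite -(src_gmul e) -E src_psi src_gmul.
  have kE : k = psi g.
    by apply: psi_uniq Tg0 _ tk => //; rewrite e lE -gh' src_psi.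
  by rewrite E kE lE.
have chi_psi g : chi g = psi g by rewrite /chi (morph_ginv psi_hom) ginvK.
have inv_ex k : exists g, psi g = k.
  by have [g ->] := chi_surj k; exists g.
have [phi psiK] := choice inv_ex.
have phiK : cancel psi phi by move=> g; apply: psi_inj; rewrite psiK.
have psiE' S g : C0bis S -> (t' S g != 0) = (S (psi g) != 0).
  by move=> bS; rewrite chiE// chi_psi.
exists psi; split=> //; exists phi; split=> //.
- move=> k l kl; have [k' kE] := inv_ex k; have [l' lE] := inv_ex l.
  have kl' : src k' = rng l'.
    apply: sg_inj; [exact: src_unit|exact: rng_unit|].
    by rewrite -src_psi -rng_psi kE lE.
  rewrite -kE -lE !phiK; split=> //.
  by have [_ <-] := psi_hom _ _ kl'; rewrite phiK.
(* Nonvanishing sets of bump functions detect neighbourhoods, and [psi] matches them with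
   nonvanishing sets of continuous coefficient functions. *)
- split.
    move=> g V; rewrite nbhsE => -[U [oU Ug] UV].
    have [S [bS Sg _ SU]] := bump_bis R eH oU Ug.
    have o : open [set g' | t' S g' != 0].
      apply: open_neq0; apply: C0_continuous; apply: coef_C0.
      by apply: (cm_Cstar cm'); exact: C0bis_Cstar.
    apply: (filterS _ (open_nbhs_nbhs (conj o _))).
      move=> g' /=; rewrite psiE'// => Sg'; apply: UV; apply: SU.
      exact: closure_support.
    by rewrite /= psiE'// Sg oner_neq0.
  move=> k V; rewrite nbhsE => -[U [oU Uk] UV].
  have [T [bT Tk _ TU]] := bump_bis R eG oU Uk.
  have o : open [set k' | t T k' != 0].
    by apply: open_neq0; apply: C0_continuous; apply: coef_C0; exact: theta_Cstar.
  apply: (filterS _ (open_nbhs_nbhs (conj o _))).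
    move=> k' /=; rewrite -{1}(psiK k') psiE// => Tk'; apply: UV; apply: TU.
    exact: closure_support.
  by rewrite /= -{1}(psiK k) psiE// Tk oner_neq0.
Qed.

End Reconstruction.

(** * Etale groupoids from local homeomorphisms, and their semidirect products *)

Section EtaleOfLcsc.
Variable G : topGroupoid.
Hypothesis lG : lcsc_hausdorff_etale G.

Lemma local_homeo_inj (f : G -> set_type (units G)) g : local_homeomorphism f ->
  exists2 U : set G, open_nbhs g U &
    forall k k', U k -> U k' -> f k = f k' -> k = k'.
Proof.
move=> lf; have [U oU [_ _ [h hK _]]] := lf g; exists U => // k k' Uk Uk' e.
by rewrite -(hK k)// e hK.
Qed.

(** For [g] near a unit [u], both [g] and [src g] lie in a neighbourhood where the source map is
    injective, and they have the same source. *)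
Lemma lcsc_open_units : open (units G).
Proof.
rewrite openE => u uu.
have [U [oU Uu] inj] := local_homeo_inj u (etale_src lG).
have : nbhs u (U `&` src @^-1` U).
  apply: filterI; first exact: open_nbhs_nbhs.
  by apply: src_continuous; apply: open_nbhs_nbhs; rewrite (uu : src u = u).
apply: filterS => g [Ug Usg]; apply: inj => //.
by apply: val_inj; rewrite /= src_src.
Qed.

Lemma local_homeo_open (f : G -> set_type (units G)) (W : set G) :
  local_homeomorphism f -> open W -> open ((val \o f) @` W).
Proof.
move=> lf oW; rewrite openE => _ [g Wg <-].
have [U [oU Ug] [ofU _ [h hK /subspace_continuousP ch]]] := lf g.
have fUg : (f @` U) (f g) by exists g.
have nW : nbhs (h (f g)) W by rewrite hK//; exact: open_nbhs_nbhs.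
have nh : nbhs (f g) [set y | (f @` U) y -> W (h y)] := ch _ fUg _ nW.
have : nbhs (f g) (f @` W).
  have nU : nbhs (f g) (f @` U) by apply: open_nbhs_nbhs.
  apply: (filterS2 _ _ nh nU) => y hy [k Uk fk]; exists k => //.
  by have := hy (ex_intro2 _ _ k Uk fk); rewrite -fk hK.
(* Open sets of the subtype are traces of open sets of [G], and such a trace is open in [G] because
   the units are. *)
case=> _ [[V oV <-] /= Vg VS].
have : nbhs (val (f g)) (V `&` units G).
  apply: open_nbhs_nbhs; split; first exact: openI oV lcsc_open_units.
  by split=> //; exact: (set_mem (valP (f g))).
apply: filterS => x [Vx ux].
by have [k Wk fk] := VS (exist _ x (mem_set ux)) Vx; exists k => //=; rewrite fk.
Qed.

Lemma lcsc_etale_groupoid : etale_groupoid G.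
Proof.
split; [exact: etale_hausdorff lG|exact: etale_locally_compact lG
  |exact: lcsc_open_units|move=> g| |].
- have [U [oU Ug] Ui] := local_homeo_inj g (etale_src lG).
  have [V [oV Vg] Vi] := local_homeo_inj g (etale_rng lG).
  exists (U `&` V); first by split=> //; exact: openI.
  split=> k k' [Uk Vk] [Uk' Vk'] e.
    by apply: Ui => //; exact: val_inj.
  by apply: Vi => //; exact: val_inj.
- by move=> U oU; exact: (local_homeo_open (etale_src lG) oU).
- by move=> U oU; exact: (local_homeo_open (etale_rng lG) oU).
Qed.

End EtaleOfLcsc.

Section EtaleSemidirect.
Variables (Gamma : groupType) (G : topGroupoid) (alpha : gpd_action Gamma G).
Hypothesis eG : etale_groupoid G.
Local Notation K := (semidirect alpha).

Lemma sd_units (p : K) : units K p <-> p.1 = 1%g /\ units G p.2.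
Proof.
case: p => c g; rewrite /units /= /sd_src /=; split=> [[<- e]|[-> ->]] //.
Qed.

Lemma sd_openP (A : set K) :
  (forall c : Gamma, open [set g | A (c, g)]) -> open A.
Proof.
move=> h; rewrite openE => -[c g] Acg.
have := h c; rewrite openE => /(_ g Acg) ng.
exists ([set (c : discrete_topology Gamma)], [set h | A (c, h)]) => /=.
  by split => //; exact: discrete_set1.
by move=> [d k] /= [-> ?].
Qed.

Lemma sd_pair_cont (X : topologicalType) (c : Gamma) (f : X -> G) :
  continuous f -> continuous ((fun x => (c, f x)) : X -> K).
Proof. exact: sd_pair_continuous. Qed.

Lemma sd_open_slice (A : set K) (c : Gamma) : open A -> open [set g | A (c, g)].
Proof.
move=> oA; have cid : continuous (@idfun G) by move=> x; exact: cvg_id.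
by apply: (open_comp (f := (fun g => (c, g)) : G -> K)) => // g _; exact: sd_pair_cont.
Qed.

Lemma act_open (c : Gamma) (U : set G) : open U -> open (alpha c @` U).
Proof.
move=> oU; have -> : alpha c @` U = alpha (c^-1)%g @^-1` U.
  apply/seteqP; split=> [_ [g Ug <-]|g Ug]; first by rewrite /= actK.
  by exists (alpha (c^-1)%g g) => //; rewrite actKV.
by apply: open_comp => // g _; exact: act_continuous.
Qed.

Lemma semidirect_etale : etale_groupoid K.
Proof.
split.
- move=> [c g] [d h] cl.
  have cd : c = d.
    apply: (@discrete_hausdorff (discrete_topology Gamma)) => A B nA nB.
    have [||[c' g'] [/= [? _] [? _]]] := cl (A `*` setT) (B `*` setT).
    + by exists (A, setT) => //=; split=> //; exact: filterT.
    + by exists (B, setT) => //=; split=> //; exact: filterT.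
    + by exists c'.
  have gh : g = h.
    apply: (eg_hausdorff eG) => A B nA nB.
    have [||[c' g'] [/= [_ ?] [_ ?]]] := cl (setT `*` A) (setT `*` B).
    + by exists (setT, A) => //=; split=> //; exact: filterT.
    + by exists (setT, B) => //=; split=> //; exact: filterT.
    + by exists g'.
  by rewrite cd gh.
- move=> [c g] _; have := eg_locally_compact eG => /(_ g I)[C].
  rewrite withinET => nC [kC clC]; rewrite /= withinET.
  exists ([set (c : discrete_topology Gamma)] `*` C).
    by exists ([set (c : discrete_topology Gamma)], C) => //=; split=> //;
      exact: discrete_set1.
  split; first by apply: compact_setX => //; exact: compact_set1.
  rewrite (_ : _ `*` _ = fst @^-1` [set (c : discrete_topology Gamma)] `&` snd @^-1` C)//.
  apply: closedI.
    apply: (@preimage_closed K (discrete_topology Gamma) fst) => [p _|].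
      exact: cvg_fst.
    exact: discrete_closed.
  by apply: (@preimage_closed K G snd) => // p _; exact: cvg_snd.
- apply: sd_openP => c; have [->|c1] := eqVneq c 1%g.
    rewrite (_ : mkset _ = units G); first exact: eg_open_units eG.
    apply/seteqP; split=> g /=; first by move=> /sd_units[].
    by move=> ug; apply/sd_units.
  rewrite (_ : mkset _ = set0); first exact: open0.
  by apply/seteqP; split=> g //= /sd_units[/= /eqP]; rewrite (negbTE c1).
- move=> [c g]; have [U [oU Ug] [sU rU]] := eg_bisection eG g.
  exists [set p : K | p.1 = c /\ U p.2].
    split=> //; apply: sd_openP => d; have [->|dc] := eqVneq d c.
      by rewrite (_ : mkset _ = U)//; apply/seteqP; split=> h //= -[].
    rewrite (_ : mkset _ = set0); first exact: open0.
    by apply/seteqP; split=> h //= [/eqP]; rewrite (negbTE dc).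
  split=> -[d h] [d' h'] /= [-> Uh] [-> Uh'] [e]; first by rewrite (sU h h').
  have := congr1 (alpha (c^-1)%g) e; rewrite !actK => {}e.
  by rewrite (rU h h').
- move=> W oW; apply: sd_openP => c; have [->|c1] := eqVneq c 1%g.
    rewrite (_ : mkset _ = \bigcup_(d : Gamma) (src @` [set g | W (d, g)])).
      apply: bigcup_open => d _; apply: eg_open_src eG _ _.
      exact: sd_open_slice.
    apply/seteqP; split=> [g [[d h] Wdh [e]]|g [d _ [h Wh e]]].
      by exists d => //; exists h.
    by exists (d, h) => //; rewrite /= /sd_src /= e.
  rewrite (_ : mkset _ = set0); first exact: open0.
  apply/seteqP; split=> g //= [[d h] _ [e _]].
  by move: c1; rewrite -e eqxx.
- move=> W oW; apply: sd_openP => c; have [->|c1] := eqVneq c 1%g.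
    rewrite (_ : mkset _ =
        \bigcup_(d : Gamma) (alpha d @` (rng @` [set g | W (d, g)]))).
      apply: bigcup_open => d _; apply: act_open; apply: eg_open_rng eG _ _.
      exact: sd_open_slice.
    apply/seteqP; split=> [g [[d h] Wdh [e]]|g [d _ [_ [h Wh <-] e]]].
      by exists d => //; exists (rng h) => //; exists h.
    by exists (d, h) => //; rewrite /= /sd_rng /= e.
  rewrite (_ : mkset _ = set0); first exact: open0.
  apply/seteqP; split=> g //= [[d h] _ [e _]].
  by move: c1; rewrite -e eqxx.
Qed.

(** The equation [alpha gamma (rng g) = src g] says exactly that [(gamma, g)] belongs to the
    isotropy over [src g]. *)
Lemma principal_dense_semidirect : topologically_principally_free alpha ->
  principal_dense K.
Proof.
move=> [U [Uu dU fU]]; exists [set p : K | p.1 = 1%g /\ U p.2]; split.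
- by move=> p [e /Uu u]; apply/sd_units.
- move=> [c u] /sd_units[/= -> uu] V nV.
  have cid : continuous (@idfun G) by move=> x; exact: cvg_id.
  have nV1 : nbhs u [set g | V (1%g, g)] := sd_pair_cont (c := 1%g) cid nV.
  have [v [Uv Vv]] := dU _ uu _ nV1.
  by exists (1%g, v).
- move=> [c g] [/= _ Usg] [e].
  have [c1 ug] := fU (src g) g c Usg erefl e.
  by apply/sd_units; rewrite /= c1.
Qed.

End EtaleSemidirect.

(** * Continuous orbit equivalence *)

Lemma usrc_continuous (G : topGroupoid) : continuous (@usrc G).
Proof.
apply: (@continuous_comp_initial (set_type (units G)) G G val (@usrc G)).
exact: src_continuous.
Qed.

Lemma urng_continuous (G : topGroupoid) : continuous (@urng G).
Proof.
apply: (@continuous_comp_initial (set_type (units G)) G G val (@urng G)).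
exact: rng_continuous.
Qed.

(** If [c] and [d] act alike near [u], then [d^-1 * c] fixes all units near [u], against the density
    of the units that it moves. *)
Lemma free_eq (Gamma : groupType) (G : topGroupoid)
    (alpha : gpd_action Gamma G) u (c d : Gamma) :
  topologically_free alpha -> units G u ->
  (\forall v \near u, units G v -> alpha c v = alpha d v) -> c = d.
Proof.
move=> fa uu nu; apply: contrapT => ne.
have cd : (d^-1 * c)%g <> 1%g.
  move=> e; apply: ne; have := congr1 (fun x => d * x)%g e.
  by rewrite mulgA mulgV mul1g mulg1.
have [v [[uv fv] hv]] := fa _ cd _ uu _ nu.
by apply: fv; rewrite actM (hv uv) actK.
Qed.

Section CoeIso.
Variables (Gamma1 Gamma2 : groupType) (G1 G2 : topGroupoid).
Variables (alpha1 : gpd_action Gamma1 G1) (alpha2 : gpd_action Gamma2 G2).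
Hypotheses (e1 : etale_groupoid G1) (free1 : topologically_free alpha1)
  (free2 : topologically_free alpha2).
Variables (phi : G1 -> G2) (psi : G2 -> G1)
  (a : discrete_topology Gamma1 * set_type (units G1) ->
       discrete_topology Gamma2)
  (b : discrete_topology Gamma2 * set_type (units G2) ->
       discrete_topology Gamma1).
Hypotheses (iso : groupoid_iso_with phi psi) (ca : continuous a)
  (cb : continuous b).
Hypothesis phi_a : forall gamma g,
  phi (alpha1 gamma g) = alpha2 (a (gamma, urng g)) (phi g) /\
  phi (alpha1 gamma g) = alpha2 (a (gamma, usrc g)) (phi g).
Hypothesis psi_b : forall gamma g,
  psi (alpha2 gamma g) = alpha1 (b (gamma, urng g)) (psi g).

Let A (c : Gamma1) (g : G1) : Gamma2 := a (c, urng g).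
Let B (c : Gamma2) (g : G2) : Gamma1 := b (c, urng g).

Let phiK : cancel phi psi. Proof. by case: iso. Qed.
Let psiK : cancel psi phi. Proof. by case: iso. Qed.
Let phiM : groupoid_morphism phi. Proof. by case: iso. Qed.
Let psiM : groupoid_morphism psi. Proof. by case: iso. Qed.
Let cphi : continuous phi. Proof. by case: iso => _ _ _ _ []. Qed.
Let cpsi : continuous psi. Proof. by case: iso => _ _ _ _ []. Qed.

Let urng_rng (G : topGroupoid) (g : G) : urng (rng g) = urng g.
Proof. by apply: val_inj; rewrite /= rng_rng. Qed.

Let urng_src (G : topGroupoid) (g : G) : urng (src g) = usrc g.
Proof. by apply: val_inj; rewrite /= rng_src. Qed.

Let slice_cont (D1 D2 : groupType) (G : topGroupoid)
    (f : discrete_topology D1 * set_type (units G) -> discrete_topology D2) c :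
  continuous f ->
  continuous ((fun g => f (c, urng g)) : G -> discrete_topology D2).
Proof.
move=> cf g; apply: (@continuous_comp _ _ _
  (fun g => (c : discrete_topology D1, urng g)) f); last exact: cf.
apply: (@cvg_pair _ _ _ (nbhs g) (nbhs (c : discrete_topology D1)) (nbhs (urng g))).
  exact: cvg_cst.
exact: urng_continuous.
Qed.

Let A_near c g : \forall h \near g, A c h = A c g.
Proof.
exact: (slice_cont (c := c) ca (discrete_set1 (A c g : discrete_topology Gamma2))).
Qed.

Let B_near c g : \forall h \near g, B c h = B c g.
Proof.
exact: (slice_cont (c := c) cb (discrete_set1 (B c g : discrete_topology Gamma1))).
Qed.

Let phiA c g : phi (alpha1 c g) = alpha2 (A c g) (phi g).
Proof. by have [] := phi_a c g. Qed.

Let free_phi u c d : units G1 u ->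
  (\forall v \near u, units G1 v -> alpha2 c (phi v) = alpha2 d (phi v)) -> c = d.
Proof.
move=> uu nu; apply: (free_eq free2 (morph_unit phiM uu)).
have : nbhs (phi u) (psi @^-1` [set v | units G1 v ->
    alpha2 c (phi v) = alpha2 d (phi v)]) by apply: cpsi; rewrite phiK.
by apply: filterS => w /= hw uw; rewrite -(psiK w) hw//; exact: morph_unit psiM _ uw.
Qed.

Let A_mul c d u : units G1 u -> A (c * d)%g u = (A c (alpha1 d u) * A d u)%g.
Proof.
move=> uu; apply: (free_phi uu).
have nd : \forall v \near u, A c (alpha1 d v) = A c (alpha1 d u).
  exact: (act_continuous (alpha := alpha1) (A_near c (alpha1 d u))).
apply: (filterS3 _ _ (A_near (c * d)%g u) nd (A_near d u)) => v h1 h2 h3 uv.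
by rewrite -h1 -h2 -h3 actM -!phiA actM.
Qed.

(** The two forms of [phi_a] say that the values of the cocycle at both ends of an arrow [h] act
    alike on [phi h], hence on its source. As [src] is open and the cocycle locally constant, this
    covers a neighbourhood of [src g], and freeness applies. *)
Let A_src c g : A c (src g) = A c g.
Proof.
apply: (free_phi (src_unit g)).
have oN : nbhs g [set h | A c h = A c g /\ A c (src h) = A c (src g)].
  apply: filterI; first exact: A_near.
  exact: (src_continuous (A_near c (src g))).
move: oN; rewrite nbhsE => -[N [oN Ng] hN].
have : nbhs (src g) (src @` N).
  by apply: open_nbhs_nbhs; split; [exact: eg_open_src e1 _ oN|exists g].
apply: filterS => _ [h Nh <-] _; have [h1 h2] := hN _ Nh.
have [p1 p2] := phi_a c h.
rewrite -(morph_src phiM) -!act_src; congr src.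
by rewrite -h2 -h1 /A urng_src -p1 -p2.
Qed.

Let A_rng c g : A c (rng g) = A c g.
Proof. by rewrite /A urng_rng. Qed.

Let A1 g : A 1%g g = 1%g.
Proof.
have := A_mul 1%g 1%g (rng_unit g); rewrite act1 mulg1 !A_rng => e.
by have := congr1 (fun x => (A 1 g)^-1 * x)%g e; rewrite mulgA mulVg mul1g.
Qed.

Let BA c g : B (A c g) (phi g) = c.
Proof.
have -> : B (A c g) (phi g) = B (A c (rng g)) (phi (rng g)).
  by rewrite A_rng /B -(morph_rng phiM) urng_rng.
set u := rng g; have uu : units G1 u := rng_unit g.
apply: (free_eq free1 uu).
have nB : \forall v \near u, B (A c u) (phi v) = B (A c u) (phi u).
  exact: (cphi (B_near (A c u) (phi u))).
apply: (filterS2 _ _ nB (A_near c u)) => v h1 h2 uv.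
by rewrite -h1 -h2; have := psi_b (A c v) (phi v); rewrite -phiA !phiK.
Qed.

Definition coe_map (p : semidirect alpha1) : semidirect alpha2 :=
  (a (p.1, urng p.2), phi p.2).
Definition coe_inv (p : semidirect alpha2) : semidirect alpha1 :=
  (b (p.1, urng p.2), psi p.2).

Lemma coe_mapK : cancel coe_map coe_inv.
Proof.
move=> [c g]; rewrite /coe_inv /coe_map /= phiK; congr pair; exact: BA.
Qed.

Lemma coe_map_continuous : continuous coe_map.
Proof.
apply: sd_slice_continuous => c g.
apply: (@cvg_pair _ _ _ (nbhs g) (nbhs (A c g : discrete_topology Gamma2))
  (nbhs (phi g))); last exact: cphi.
exact: (slice_cont (c := c) ca).
Qed.

Lemma coe_map_morphism : groupoid_morphism coe_map.
Proof.
move=> [c g] [d h] /sd_compE /= e.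
have cgh : src (phi g) = alpha2 (A d h) (rng (phi h)).
  by rewrite (morph_src phiM) e phiA A_rng (morph_rng phiM).
split; first by rewrite /composable /= /sd_src /sd_rng /= cgh.
(* The left factor of the [G1] component of the product. It starts at [rng h] and ends at the range
   of the product, which lets [A_mul] and [A_src] combine. *)
set m := alpha1 (d^-1)%g g.
have sm : src m = rng h by rewrite /m act_src e actK.
have gE : g = alpha1 d m by rewrite /m actKV.
rewrite /coe_map /= /sd_mul /= -/(A _ _) -/(A _ _) -/(A _ _) -/m; congr pair.
  rewrite -A_rng rng_gmul// A_mul; last exact: rng_unit.
  by rewrite -act_rng -gE A_rng A_rng -(A_rng d h) -sm A_src.
have [_ ->] := phiM sm; congr gmul.
by rewrite [in RHS]gE phiA -(A_rng d h) -sm A_src actK.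
Qed.

Lemma coe_map_units p : units G1 p.2 -> units G2 (coe_map p).2.
Proof. by move=> up; exact: (morph_unit phiM). Qed.

Lemma coe_map_one p : p.1 = 1%g -> (coe_map p).1 = 1%g.
Proof. by move=> e; rewrite /coe_map /= e; exact: A1. Qed.

End CoeIso.

Lemma iso_with_sym (G H : topGroupoid) (phi : G -> H) (psi : H -> G) :
  groupoid_iso_with phi psi -> groupoid_iso_with psi phi.
Proof. by move=> [? ? ? ? [? ?]]. Qed.

Lemma coe_semidirect_iso (Gamma1 Gamma2 : groupType) (G1 G2 : topGroupoid)
    (alpha1 : gpd_action Gamma1 G1) (alpha2 : gpd_action Gamma2 G2) :
  etale_groupoid G1 -> etale_groupoid G2 ->
  topologically_free alpha1 -> topologically_free alpha2 ->
  coe alpha1 alpha2 -> semidirect_iso_preserving alpha1 alpha2.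
Proof.
move=> e1 e2 f1 f2 [phi [psi [a [b [iso ca cb pa pb]]]]].
have iso' := iso_with_sym iso.
have pa1 c g := (pa c g).1; have pb1 c g := (pb c g).1.
pose F : semidirect alpha1 -> semidirect alpha2 := coe_map alpha2 phi a.
pose F' : semidirect alpha2 -> semidirect alpha1 := coe_map alpha1 psi b.
have FK : cancel F F' := coe_mapK f1 iso ca cb pa pb1.
have F'K : cancel F' F := coe_mapK f2 iso' cb ca pb pa1.
have hom : groupoid_morphism F := coe_map_morphism e1 f2 iso ca pa.
have hom' : groupoid_morphism F' := coe_map_morphism e2 f1 iso' cb pb.
exists F; split.
- exists F'; split=> //; split; first exact: coe_map_continuous iso ca.
  exact: coe_map_continuous iso' cb.
- apply/seteqP; split=> [_ [p up <-]|p up].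
    exact: (coe_map_units alpha1 alpha2 a iso up).
  by exists (F' p) => //; exact: (coe_map_units alpha2 alpha1 b iso' up).
- apply/seteqP; split=> [_ [p p1 <-]|p p1].
    exact: (coe_map_one f2 iso ca pa p1).
  by exists (F' p) => //; exact: (coe_map_one f1 iso' cb pb p1).
Qed.

Section IsoCoe.
Variables (Gamma1 Gamma2 : groupType) (G1 G2 : topGroupoid).
Variables (alpha1 : gpd_action Gamma1 G1) (alpha2 : gpd_action Gamma2 G2).
Variables (P : semidirect alpha1 -> semidirect alpha2).
Hypothesis (PM : groupoid_morphism P) (cP : continuous P).
Hypothesis P_units : forall p, units G1 p.2 -> units G2 (P p).2.
Hypothesis P_one : forall p, p.1 = 1%g -> (P p).1 = 1%g.

Definition iso_phi (g : G1) : G2 := (P (1%g, g)).2.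
Definition iso_a (p : discrete_topology Gamma1 * set_type (units G1)) :
  discrete_topology Gamma2 := (P (p.1, val p.2)).1.

Lemma iso_phiE g : P (1%g, g) = (1%g, iso_phi g).
Proof.
by rewrite /iso_phi -{1}(P_one (p := (1%g, g)) erefl); case: (P _).
Qed.

Lemma iso_phi_continuous : continuous iso_phi.
Proof.
move=> g; have cid : continuous (@idfun G1) by move=> x; exact: cvg_id.
apply: (@continuous_comp _ _ _ (fun g => P (1%g, g)) snd); last exact: cvg_snd.
apply: (@continuous_comp _ _ _ ((fun g => (1%g, g)) : G1 -> semidirect alpha1) P).
  exact: (sd_pair_cont (alpha := alpha1) (c := 1%g) cid).
exact: cP.
Qed.

Lemma iso_a_continuous : continuous iso_a.
Proof.
move=> p; apply: (@continuous_comp (discrete_topology Gamma1 * set_type (units G1))%type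
  (discrete_topology Gamma2 * G2)%type (discrete_topology Gamma2)
  (fun p => P (p.1, val p.2)) fst); last exact: cvg_fst.
apply: (@continuous_comp (discrete_topology Gamma1 * set_type (units G1))%type
  (semidirect alpha1) (semidirect alpha2) (fun p => (p.1, val p.2)) P);
  last exact: cP.
apply: (@cvg_pair _ _ _ (nbhs p) (nbhs p.1) (nbhs (val p.2))).
  exact: cvg_fst.
apply: (@continuous_comp _ (set_type (units G1)) G1 snd val); first exact: cvg_snd.
exact: initial_continuous.
Qed.

Lemma iso_phiM : groupoid_morphism iso_phi.
Proof.
move=> g h gh; have c : composable ((1%g, g) : semidirect alpha1) (1%g, h).
  by rewrite /composable /= /sd_src /sd_rng /= act1 gh.
have [c' e] := PM c; split.
  by move: c'; rewrite !iso_phiE => /sd_compE /=; rewrite act1.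
rewrite /iso_phi.
have -> : P (1%g, gmul g h) = P (gmul ((1%g, g) : semidirect alpha1) (1%g, h)).
  by rewrite /= /sd_mul /= mulg1 invg1 act1.
by rewrite e !iso_phiE /= invg1 act1.
Qed.

Lemma iso_unitE c (u : set_type (units G1)) :
  P (c, val u) = (iso_a (c, u), iso_phi (val u)).
Proof.
have uu : units G1 (val u) := set_mem (valP u).
have up := P_units (p := (c, val u)) uu.
have := morph_src PM (c, val u); rewrite /= /sd_src /= (uu : src _ = _) iso_phiE.
rewrite (up : src _ = _) => -[e]; rewrite -e /iso_a /=; by case: (P _).
Qed.

(** The arrow [(c, g)] factors both as [(c, rng g)] times [(1, g)] and as [(1, alpha1 c g)] times
    [(c, src g)]. Comparing the images, the first components identify the two cocycle values and the
    second components give the orbit relation. *)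
Lemma iso_coe c g :
  iso_phi (alpha1 c g) = alpha2 (iso_a (c, urng g)) (iso_phi g) /\
  iso_phi (alpha1 c g) = alpha2 (iso_a (c, usrc g)) (iso_phi g).
Proof.
have c1 : composable ((c, rng g) : semidirect alpha1) (1%g, g).
  by rewrite /composable /= /sd_src /sd_rng /= act1 src_rng.
have c2 : composable ((1%g, alpha1 c g) : semidirect alpha1) (c, src g).
  by rewrite /composable /= /sd_src /sd_rng /= act_src rng_src.
have [c1' E1] := PM c1; have [c2' E2] := PM c2.
have E : gmul ((c, rng g) : semidirect alpha1) (1%g, g) =
    gmul ((1%g, alpha1 c g) : semidirect alpha1) (c, src g).
  by rewrite /= /sd_mul /= mulg1 mul1g invg1 act1 actK gmul_rng gmul_src.
move: E2 c2'; rewrite -E E1 iso_phiE (iso_unitE c (urng g)) (iso_unitE c (usrc g)) iso_phiE.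
rewrite /= /sd_mul /= mulg1 mul1g invg1 act1 => -[-> e] /sd_compV /= c2'.
have us : units G2 (iso_phi (src g)) by exact: morph_unit iso_phiM _ (src_unit g).
have ep : iso_phi g = alpha2 (iso_a (c, usrc g))^-1%g (iso_phi (alpha1 c g)).
  rewrite [RHS]gmul_srcE in e; last by rewrite c2' unit_rng.
  rewrite -e -[in LHS](gmul_rng g).
  have [_ ->] // := iso_phiM (g := rng g) (h := g) (src_rng g).
by rewrite ep actKV.
Qed.

End IsoCoe.

(** Turns the two equalities of sets into implications for a mutually inverse pair, so that later
    arguments are symmetric. *)
Lemma semidirect_iso_preservingP (Gamma1 Gamma2 : groupType)
    (G1 G2 : topGroupoid)
    (alpha1 : gpd_action Gamma1 G1) (alpha2 : gpd_action Gamma2 G2) :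
  semidirect_iso_preserving alpha1 alpha2 ->
  exists (P : semidirect alpha1 -> semidirect alpha2)
    (Q : semidirect alpha2 -> semidirect alpha1),
  [/\ groupoid_iso_with P Q,
      forall p, units G1 p.2 -> units G2 (P p).2,
      forall p, p.1 = 1%g -> (P p).1 = 1%g,
      forall p, units G2 p.2 -> units G1 (Q p).2 &
      forall p, p.1 = 1%g -> (Q p).1 = 1%g].
Proof.
move=> [P [[Q iso] PU P1]]; have [PK _ _ _ _] := iso.
exists P, Q; split=> // p up.
- by have : (P @` [set p | units G1 p.2]) (P p) by [exists p]; rewrite PU.
- by have : (P @` [set p | p.1 = 1%g]) (P p) by [exists p]; rewrite P1.
- have : [set p | units G2 p.2] p by [].
  by rewrite -PU => -[p' up' <-]; rewrite PK.
- have : [set p : semidirect alpha2 | p.1 = 1%g] p by [].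
  by rewrite -P1 => -[p' up' <-]; rewrite PK.
Qed.

Lemma semidirect_iso_coe (Gamma1 Gamma2 : groupType) (G1 G2 : topGroupoid)
    (alpha1 : gpd_action Gamma1 G1) (alpha2 : gpd_action Gamma2 G2) :
  semidirect_iso_preserving alpha1 alpha2 -> coe alpha1 alpha2.
Proof.
move=> /semidirect_iso_preservingP[P [Q [iso P_units P_one Q_units Q_one]]].
have [PK QK PM QM [cP cQ]] := iso.
exists (iso_phi P), (iso_phi Q), (iso_a P), (iso_a Q); split.
- split; [| |exact: iso_phiM|exact: iso_phiM|].
  + by move=> g; rewrite /iso_phi -/(iso_phi P g) -iso_phiE// PK.
  + by move=> g; rewrite /iso_phi -/(iso_phi Q g) -iso_phiE// QK.
  + by split; exact: iso_phi_continuous.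
- exact: iso_a_continuous.
- exact: iso_a_continuous.
- exact: iso_coe.
- exact: iso_coe.
Qed.

(** * Transport along an isomorphism *)

Section TransportOper.
Variables (R : realType) (T1 T2 : choiceType) (p : T1 -> T2) (q : T2 -> T1).
Hypotheses (pK : cancel p q) (qK : cancel q p).

Lemma bij_setT : set_bij [set: T1] [set: T2] p.
Proof.
split=> //; first by move=> x y _ _; exact: (can_inj pK).
by move=> y _; exists (q y).
Qed.

Lemma l2normsq_comp (xi : T2 -> R[i]) : l2normsq (xi \o p) = l2normsq xi.
Proof. by rewrite /l2normsq [RHS](reindex_esum _ _ p _ bij_setT). Qed.

Lemma l2_comp (xi : T2 -> R[i]) : l2 xi -> l2 (xi \o p).
Proof. by rewrite /l2 /= l2normsq_comp. Qed.

Lemma l2inner_comp (xi eta : T2 -> R[i]) :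
  l2inner (xi \o p) (eta \o p) = l2inner xi eta.
Proof.
apply: (sum_reindex (A := [set: T1]) (s := p)) => //.
- by move=> x y _ _; exact: (can_inj pK).
- by move=> x; case.
- by move=> y []; exists (q y).
Qed.

Definition transport (A : oper R T1) : oper R T2 := fun xi => A (xi \o p) \o q.

End TransportOper.

Arguments transport {R T1 T2} p q A.

Section TransportTheory.
Variables (R : realType) (T1 T2 : choiceType) (p : T1 -> T2) (q : T2 -> T1).
Hypotheses (pK : cancel p q) (qK : cancel q p).
Implicit Types A : oper R T1.

Let compK (xi : T1 -> R[i]) : xi \o q \o p = xi.
Proof. by rewrite funeqE => x /=; rewrite pK. Qed.

Let compK' (xi : T2 -> R[i]) : xi \o p \o q = xi.
Proof. by rewrite funeqE => x /=; rewrite qK. Qed.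

Lemma transportK A : transport q p (transport p q A) = A.
Proof. by rewrite funeqE => xi; rewrite /transport compK [_ \o p]compK. Qed.

Lemma opnorm_transport A (e : R) : opnorm_le A e ->
  opnorm_le (transport p q A) e.
Proof.
move=> hA xi l2xi; rewrite /transport (l2normsq_comp qK pK).
by rewrite -(l2normsq_comp pK qK xi) hA//; exact: (l2_comp pK qK).
Qed.

Lemma bounded_transport A : bounded_oper A -> bounded_oper (transport p q A).
Proof.
move=> [lin [M bA] out]; split; last first.
- move=> xi nl2; rewrite /transport out// => l2xi; apply: nl2.
  by rewrite -(compK' xi); exact: (l2_comp qK pK).
- by exists M; exact: opnorm_transport.
- move=> c xi eta l2xi l2eta.
  by rewrite /transport -[(c *: xi + eta) \o p]/(c *: (xi \o p) + (eta \o p)) lin//;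
    exact: (l2_comp pK qK).
Qed.

Lemma transportM A B : transport p q (A \o B) = transport p q A \o transport p q B.
Proof. by rewrite funeqE => xi; rewrite /transport /= compK. Qed.

Lemma transport_adjoint A B : adjoint A B ->
  adjoint (transport p q A) (transport p q B).
Proof.
move=> adj xi eta l2xi l2eta; rewrite /transport.
rewrite -(l2inner_comp pK qK _ eta) compK adj; [|exact: (l2_comp pK qK)..].
by rewrite -(l2inner_comp pK qK xi) compK.
Qed.

End TransportTheory.

Section TransportGroupoid.
Variables (R : realType) (K1 K2 : topGroupoid) (p : K1 -> K2) (q : K2 -> K1).
Hypothesis iso : groupoid_iso_with p q.

Let pK : cancel p q. Proof. by case: iso. Qed.
Let qK : cancel q p. Proof. by case: iso. Qed.
Let qM : groupoid_morphism q. Proof. by case: iso. Qed.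
Let cp : continuous p. Proof. by case: iso => _ _ _ _ []. Qed.
Let cq : continuous q. Proof. by case: iso => _ _ _ _ []. Qed.

Lemma transport_lambda (f : K1 -> R[i]) :
  transport p q (lambda f) = lambda (f \o q).
Proof.
rewrite funeqE => xi; rewrite /transport.
have [l2xi|nl2] := pselect (l2 xi); last first.
  rewrite !lambda_out// => l2xi; apply: nl2.
  rewrite (_ : xi = xi \o p \o q); last by rewrite funeqE => x /=; rewrite qK.
  exact: (l2_comp qK pK).
rewrite !lambdaE//; last exact: (l2_comp pK qK).
rewrite funeqE => g; rewrite /= /convol.
rewrite (reindex_fsbig q [set h | rng h = rng g]).
  apply: eq_fsbigr => h /set_mem /= rh; congr (_ * xi _).
  rewrite -(morph_ginv qM); have c : src (ginv h) = rng g by rewrite src_ginv.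
  by have [_ <-] := qM c; rewrite qK.
split=> [h /= rh|h h' _ _ /(can_inj qK)//|k /= rk].
  by rewrite !(morph_rng qM) rh.
exists (p k); rewrite /= ?pK//; apply: (can_inj qK).
by rewrite -!(morph_rng qM) pK.
Qed.

Lemma Cc_comp (f : K1 -> R[i]) : Cc f -> Cc (f \o q).
Proof.
move=> [cf kf]; have cfq : continuous ((f \o q) : K2 -> R[i]^o).
  by move=> x; apply: (@continuous_comp _ _ R[i]^o q f); [exact: cq|exact: cf].
split=> //.
have kp : compact (p @` closure [set x | f x != 0]).
  by apply: continuous_compact => //; exact: continuous_subspaceT.
apply: (subclosed_compact (@closed_closure _ _) kp).
have cl : closed (p @` closure [set x | f x != 0]).
  have -> : p @` closure [set x | f x != 0] = q @^-1` closure [set x | f x != 0].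
    apply/seteqP; split=> [_ [x fx <-]|y fy]; first by rewrite /= pK.
    by exists (q y).
  by apply: preimage_closed => [y _|]; [exact: cq|exact: closed_closure].
rewrite [X in _ `<=` X](closure_id _).1//; apply: closureS => y /= fy.
by exists (q y) => //; exact: closure_support.
Qed.

Lemma Cstar_transport A : Cstar A -> Cstar (transport p q A : oper R K2).
Proof.
move=> [bA aA]; split; first exact: bounded_transport.
move=> e e0; have [f cf fA] := aA e e0; exists (f \o q); first exact: Cc_comp.
by rewrite -transport_lambda; exact: (opnorm_transport pK qK fA).
Qed.

End TransportGroupoid.

Lemma extend0_comp (R : realType) (X1 X2 Y1 Y2 : choiceType)
    (p : Y1 -> Y2) (q : Y2 -> Y1) (r : X1 -> X2) (r' : X2 -> X1)
    (j1 : X1 -> Y1) (j2 : X2 -> Y2) (f : X1 -> R[i]) :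
  cancel r r' -> cancel r' r -> cancel p q -> cancel q p ->
  (forall x, j2 (r x) = p (j1 x)) ->
  extend0 j2 (f \o r') = extend0 j1 f \o q.
Proof.
move=> rK r'K pK qK jr; rewrite funeqE => y; rewrite /= /extend0.
rewrite [RHS](reindex_fsbig r' (j2 @^-1` [set y]))//.
split=> [x /= xy|x x' _ _ /(can_inj r'K)//|x /= xy].
  by apply: (can_inj pK); rewrite -jr r'K qK.
by exists (r x); rewrite /= ?rK// jr xy qK.
Qed.

Section TransportImage.
Variables (R : realType) (H1 H2 K1 K2 : topGroupoid).
Variables (p : K1 -> K2) (q : K2 -> K1) (r : H1 -> H2) (r' : H2 -> H1).
Variables (j1 : H1 -> K1) (j2 : H2 -> K2).
Hypotheses (iso : groupoid_iso_with p q) (isor : groupoid_iso_with r r').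
Hypothesis jr : forall x, j2 (r x) = p (j1 x).

(** The approximating functions and both of their limits are carried along the commuting square
    [jr]. *)
Lemma Cstar_image_transport T : Cstar_image j1 T ->
  Cstar_image j2 (transport p q T : oper R K2).
Proof.
have [pK qK _ _ _] := iso; have [rK r'K _ _ _] := isor.
move=> [bT [S cS [f_ [cf cvS cvT]]]].
split; first exact: bounded_transport.
exists (transport r r' S); first exact: (Cstar_transport isor).
exists (fun n => f_ n \o r'); split.
- by move=> n; exact: (Cc_comp isor).
- move=> e e0; apply: filterS (cvS e e0) => n /(opnorm_transport rK r'K).
  by rewrite -(transport_lambda isor).
- move=> e e0; apply: filterS (cvT e e0) => n /(opnorm_transport pK qK).
  rewrite -[transport p q (_ - _)]/(transport p q _ - transport p q _).
  by rewrite (transport_lambda iso) -(extend0_comp _ rK r'K pK qK jr).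
Qed.
End TransportImage.

(** * Restriction of an isomorphism to the transformation groupoids *)

Section EmbCrossed.
Variables (Gamma : groupType) (G : topGroupoid) (alpha : gpd_action Gamma G).
Local Notation H := (semidirect (unit_action alpha)).
Local Notation K := (semidirect alpha).

Lemma emb_crossed_inj : injective (@emb_crossed Gamma G alpha).
Proof. by move=> [c u] [d v] [-> /val_inj ->]. Qed.

Lemma emb_crossed_comp (x y : H) :
  composable x y <-> composable (emb_crossed x) (emb_crossed y).
Proof.
case: x y => [c u] [d v]; have uu : units G (val u) := set_mem (valP u).
have uv : units G (val v) := set_mem (valP v).
rewrite /composable /= /sd_src /sd_rng /emb_crossed /= (uu : src _ = _).
rewrite (unit_rng uv) /=; split=> [[->]//|[e]].
by congr pair; apply: val_inj.
Qed.

Lemma emb_crossed_mul (x y : H) : composable x y ->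
  emb_crossed (gmul x y) = gmul (emb_crossed x) (emb_crossed y).
Proof.
move=> /emb_crossed_comp; case: x y => [c u] [d v] /sd_compV /= e.
have uv : units G (val v) := set_mem (valP v).
rewrite /= /sd_mul /emb_crossed /= /space_mul /=; congr pair.
by rewrite gmul_srcE// e unit_rng.
Qed.

End EmbCrossed.

Section CrossedMap.
Variables (Gamma1 Gamma2 : groupType) (G1 G2 : topGroupoid).
Variables (alpha1 : gpd_action Gamma1 G1) (alpha2 : gpd_action Gamma2 G2).
Variables (P : semidirect alpha1 -> semidirect alpha2).
Hypothesis (PM : groupoid_morphism P) (cP : continuous P).
Hypothesis P_units : forall p, units G1 p.2 -> units G2 (P p).2.
Hypothesis P_one : forall p, p.1 = 1%g -> (P p).1 = 1%g.

Lemma iso_phi_units (u : set_type (units G1)) :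
  iso_phi P (val u) \in units G2.
Proof. exact/mem_set/(morph_unit (iso_phiM PM P_one))/set_mem/valP. Qed.

Definition unit_iso (u : set_type (units G1)) : set_type (units G2) :=
  exist _ (iso_phi P (val u)) (iso_phi_units u).

Lemma unit_iso_continuous : continuous unit_iso.
Proof.
apply: (@continuous_comp_initial (set_type (units G2)) (set_type (units G1)) G2
  val unit_iso) => u.
apply: (@continuous_comp (set_type (units G1)) G1 G2 val (iso_phi P)).
  exact: initial_continuous.
exact: iso_phi_continuous.
Qed.

Definition crossed_iso (x : semidirect (unit_action alpha1)) :
  semidirect (unit_action alpha2) := (iso_a P x, unit_iso x.2).

Lemma emb_crossed_iso x : emb_crossed (crossed_iso x) = P (emb_crossed x).
Proof. by case: x => c u; rewrite /emb_crossed /= (iso_unitE PM P_units P_one). Qed.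

Lemma crossed_iso_continuous : continuous crossed_iso.
Proof.
move=> x; apply: (@cvg_pair _ _ _ (nbhs x)
  (nbhs (iso_a P x : discrete_topology Gamma2)) (nbhs (unit_iso x.2))).
  exact: iso_a_continuous.
apply: (@continuous_comp (discrete_topology Gamma1 * set_type (units G1))%type
  (set_type (units G1)) (set_type (units G2)) snd unit_iso).
  exact: cvg_snd.
exact: unit_iso_continuous.
Qed.

(** Checked after embedding, where [P] is a morphism; the embedding is injective and reflects
    composability. *)
Lemma crossed_isoM : groupoid_morphism crossed_iso.
Proof.
move=> x y xy; have [c' e] := PM ((emb_crossed_comp x y).1 xy).
have c : composable (crossed_iso x) (crossed_iso y).
  by apply/emb_crossed_comp; rewrite !emb_crossed_iso.
split=> //; apply: emb_crossed_inj.
by rewrite emb_crossed_mul// !emb_crossed_iso emb_crossed_mul// e.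
Qed.

End CrossedMap.

Section TransportStar.
Variables (R : realType) (Gamma1 Gamma2 : groupType) (G1 G2 : topGroupoid).
Variables (alpha1 : gpd_action Gamma1 G1) (alpha2 : gpd_action Gamma2 G2).
Variables (P : semidirect alpha1 -> semidirect alpha2)
  (Q : semidirect alpha2 -> semidirect alpha1).
Hypothesis iso : groupoid_iso_with P Q.
Hypothesis P_units : forall p, units G1 p.2 -> units G2 (P p).2.
Hypothesis P_one : forall p, p.1 = 1%g -> (P p).1 = 1%g.
Hypothesis Q_units : forall p, units G2 p.2 -> units G1 (Q p).2.
Hypothesis Q_one : forall p, p.1 = 1%g -> (Q p).1 = 1%g.

Let PK : cancel P Q. Proof. by case: iso. Qed.
Let QK : cancel Q P. Proof. by case: iso. Qed.
Let PM : groupoid_morphism P. Proof. by case: iso. Qed.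
Let QM : groupoid_morphism Q. Proof. by case: iso. Qed.
Let cP : continuous P. Proof. by case: iso => _ _ _ _ []. Qed.
Let cQ : continuous Q. Proof. by case: iso => _ _ _ _ []. Qed.

Let phiK g : iso_phi Q (iso_phi P g) = g.
Proof. by rewrite {1}/iso_phi -(iso_phiE P_one) PK. Qed.

Let psiK g : iso_phi P (iso_phi Q g) = g.
Proof. by rewrite {1}/iso_phi -(iso_phiE Q_one) QK. Qed.

Lemma iso_phi_iso : groupoid_iso_with (iso_phi P) (iso_phi Q).
Proof.
by split; [exact: phiK|exact: psiK|exact: iso_phiM|exact: iso_phiM|
  split; exact: iso_phi_continuous].
Qed.

Lemma crossed_iso_iso :
  groupoid_iso_with (crossed_iso PM P_one) (crossed_iso QM Q_one).
Proof.
split.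
- by move=> x; apply: emb_crossed_inj; rewrite !emb_crossed_iso// PK.
- by move=> x; apply: emb_crossed_inj; rewrite !emb_crossed_iso// QK.
- exact: crossed_isoM.
- exact: crossed_isoM.
- by split; exact: crossed_iso_continuous.
Qed.

Lemma alg_units_transport T : alg_units R alpha1 T ->
  alg_units R alpha2 (transport P Q T).
Proof.
move=> [f [cf f0] <-].
pose ru := unit_iso PM P_one; pose ru' := unit_iso QM Q_one.
have ruK : cancel ru ru' by move=> u; apply: val_inj; rewrite /= phiK.
have ru'K : cancel ru' ru by move=> u; apply: val_inj; rewrite /= psiK.
exists (f \o ru').
  split=> [x|e e0].
    apply: (@continuous_comp _ _ R[i]^o ru' f); last exact: cf.
    exact: unit_iso_continuous.
  have [C kC hC] := f0 e e0; exists (ru @` C).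
    apply: continuous_compact => //; apply: continuous_subspaceT.
    exact: unit_iso_continuous.
  by move=> x nx; apply: hC => Cx; apply: nx; exists (ru' x).
rewrite (transport_lambda iso); congr lambda.
apply: (extend0_comp _ ruK ru'K PK QK) => u.
by rewrite /emb_units /= (iso_phiE P_one).
Qed.

End TransportStar.

Lemma semidirect_iso_Cstar (R : realType) (Gamma1 Gamma2 : groupType)
    (G1 G2 : topGroupoid)
    (alpha1 : gpd_action Gamma1 G1) (alpha2 : gpd_action Gamma2 G2) :
  semidirect_iso_preserving alpha1 alpha2 -> Cstar_iso_preserving R alpha1 alpha2.
Proof.
move=> /semidirect_iso_preservingP[P [Q [iso P_units P_one Q_units Q_one]]].
have iso' := iso_with_sym iso; have [PK QK _ _ _] := iso.
have trK := transportK (R := R) QK.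
have eq_image (A : set (oper R (semidirect alpha1)))
    (B : set (oper R (semidirect alpha2))) :
    (forall T, A T -> B (transport P Q T)) ->
    (forall T, B T -> A (transport Q P T)) ->
    transport P Q @` A = B.
  move=> AB BA; apply/seteqP; split=> [_ [T AT <-]|T BT]; first exact: AB.
  by exists (transport Q P T); [exact: BA|exact: trK].
exists (transport P Q); split.
- split.
  + split=> [T cT|T T' _ _|T cT]; first exact: (Cstar_transport iso).
      exact: (can_inj (transportK (R := R) PK)).
    by exists (transport Q P T); [exact: (Cstar_transport iso')|exact: trK].
  + by [].
  + by [].
  + by move=> S T _ _; exact: transportM.
  + by move=> S T _ _; exact: transport_adjoint.
- apply: eq_image => T; first exact: (alg_units_transport iso).
  exact: (alg_units_transport iso').
- apply: eq_image => T.
    apply: (Cstar_image_transport iso (crossed_iso_iso iso P_units P_one Q_units Q_one)).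
    by move=> x; rewrite emb_crossed_iso.
  apply: (Cstar_image_transport iso' (crossed_iso_iso iso' Q_units Q_one P_units P_one)).
  by move=> x; rewrite emb_crossed_iso.
- apply: eq_image => T.
    apply: (Cstar_image_transport iso (iso_phi_iso iso P_one Q_one)) => x.
    by rewrite /emb_groupoid (iso_phiE P_one).
  apply: (Cstar_image_transport iso' (iso_phi_iso iso' Q_one P_one)) => x.
  by rewrite /emb_groupoid (iso_phiE Q_one).
Qed.

(** * The reduced algebra is an algebra *)

Section OperatorBounds.
Variables (R : realType) (T : choiceType).
Implicit Types A B : oper R T.

(** Halves match the factor 2 of [l2normsqD] exactly: twice [(e / 2) ^+ 2] for each summand adds up
    to [e ^+ 2]. *)
Lemma opnorm_leD A B (e : R) : opnorm_le A (e / 2) -> opnorm_le B (e / 2) ->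
  opnorm_le (A + B) e.
Proof.
move=> hA hB xi l2xi; apply: le_trans (l2normsqD _ _) _.
have h2 C : opnorm_le C (e / 2) ->
    (2%:E * l2normsq (C xi) <= (e ^+ 2 / 2)%:E * l2normsq xi)%E.
  move=> hC; have two : (0 <= 2%:E :> \bar R)%E by rewrite lee_fin.
  apply: le_trans (lee_wpmul2l two (hC xi l2xi)) _.
  rewrite muleA -EFinM (_ : 2 * (e / 2) ^+ 2 = e ^+ 2 / 2)//.
  by rewrite expr_div_n; lra.
apply: le_trans (leeD (h2 _ hA) (h2 _ hB)) _.
rewrite -ge0_muleDl; [|by rewrite lee_fin divr_ge0 ?sqr_ge0..].
by rewrite -EFinD -splitr.
Qed.

Lemma opnorm_le_trans A (e e' : R) : `|e| <= e' -> opnorm_le A e -> opnorm_le A e'.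
Proof.
move=> ee hA xi l2xi; apply: le_trans (hA _ l2xi) _.
rewrite lee_wpmul2r ?l2normsq_ge0// lee_fin -real_normK ?num_real//.
by rewrite lerXn2r// nnegrE// (le_trans _ ee).
Qed.

Lemma opnorm_le_comp A B (a b : R) : (forall xi, l2 xi -> l2 (B xi)) ->
  opnorm_le A a -> opnorm_le B b -> opnorm_le (A \o B) (a * b).
Proof.
move=> l2B hA hB xi l2xi; apply: le_trans (hA _ (l2B _ l2xi)) _.
rewrite exprMn [X in (_ <= X * _)%E]EFinM -muleA.
by rewrite lee_wpmul2l ?lee_fin ?sqr_ge0//; exact: hB.
Qed.

Lemma opnorm_leZ A (c : R[i]) (e : R) : opnorm_le A e ->
  opnorm_le (c *: A) (nc c * e).
Proof.
move=> hA xi l2xi; rewrite -[(c *: A) xi]/(c *: A xi) l2normsqZ exprMn.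
by rewrite [X in (_ <= X * _)%E]EFinM -muleA lee_wpmul2l ?lee_fin ?sqr_ge0//; exact: hA.
Qed.

Lemma bounded_oper_pos A : bounded_oper A -> exists2 M : R, 0 < M & opnorm_le A M.
Proof.
move=> [_ [M bA] _]; exists (`|M| + 1); first by rewrite ltr_wpDl.
by apply: opnorm_le_trans bA; rewrite lerDl.
Qed.

Lemma bounded_operB0 A : bounded_oper A -> forall xi eta, l2 xi -> l2 eta ->
  A (xi - eta) = A xi - A eta.
Proof.
move=> [linA _ _] xi eta l2xi l2eta.
by rewrite addrC -scaleN1r linA// scaleN1r addrC.
Qed.

Lemma bounded_operD A B : bounded_oper A -> bounded_oper B -> bounded_oper (A + B).
Proof.
move=> bA bB; have [MA MA0 hA] := bounded_oper_pos bA.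
have [MB MB0 hB] := bounded_oper_pos bB; have [linA _ outA] := bA.
have [linB _ outB] := bB; split.
- move=> c xi eta l2xi l2eta.
  rewrite -[LHS]/(A (c *: xi + eta) + B (c *: xi + eta)) linA// linB//.
  by rewrite -[(A + B) xi]/(A xi + B xi) scalerDr addrACA.
- exists (2 * (MA + MB)); apply: opnorm_leD; rewrite mulrC mulKf//.
    by apply: opnorm_le_trans hA; rewrite gtr0_norm// lerDl ltW.
  by apply: opnorm_le_trans hB; rewrite gtr0_norm// lerDr ltW.
- by move=> xi nl2; rewrite -[LHS]/(A xi + B xi) outA// outB// addr0.
Qed.

Lemma bounded_operZ A (c : R[i]) : bounded_oper A -> bounded_oper (c *: A).
Proof.
move=> bA; have [linA [M hA] outA] := bA; split.
- move=> d xi eta l2xi l2eta; rewrite -[LHS]/(c *: A (d *: xi + eta)) linA//.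
  by rewrite -[(c *: A) xi]/(c *: A xi) scalerDr !scalerA mulrC.
- by exists (nc c * M); exact: opnorm_leZ.
- by move=> xi nl2; rewrite -[LHS]/(c *: A xi) outA// scaler0.
Qed.

Lemma bounded_oper_comp A B : bounded_oper A -> bounded_oper B ->
  bounded_oper (A \o B).
Proof.
move=> bA bB; have [linA [MA hA] outA] := bA; have [linB [MB hB] outB] := bB.
have l2B xi : l2 xi -> l2 (B xi) by exact: bounded_l2.
split.
- by move=> c xi eta l2xi l2eta; rewrite /= linB// linA//; exact: l2B.
- by exists (MA * MB); exact: opnorm_le_comp.
- move=> xi nl2; rewrite /= outB//; have l20 := @l2_0 R T.
  by have := bounded_operB0 bA l20 l20; rewrite !subrr.
Qed.

Lemma bounded_oper0 : bounded_oper (0 : oper R T).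
Proof.
split=> [c xi eta _ _||xi _ //].
  by rewrite -[LHS]/(0 : T -> R[i]) -[(0 : oper R T) xi]/(0 : T -> R[i]) scaler0 addr0.
exists 0 => xi l2xi; rewrite expr0n mul0e /l2normsq esum1// => x _.
by rewrite nc0 expr0n.
Qed.

End OperatorBounds.

Section CstarAlgebra.
Variables (R : realType) (G : topGroupoid).
Hypothesis eG : etale_groupoid G.
Implicit Types f b : G -> R[i].

(** By [Cc_bisection_sum] this is all of [Cc]; it provides the induction that extends statements
    from bisection functions to sums and products of general elements. *)
Inductive bisection_sum : (G -> R[i]) -> Prop :=
| bisection_sum0 : bisection_sum 0
| bisection_sumD b f : C0bis b -> Cc b -> bisection_sum f -> bisection_sum (b + f).

(** [convol] sums over a possibly infinite fiber, and such a sum is 0 by convention when its support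
    is infinite; finiteness on fibers ensures additivity in [f]. *)
Definition fiber_finite f :=
  forall g, finite_set [set h | rng h = rng g /\ f h != 0].

Lemma fiber_finiteD f f' : fiber_finite f -> fiber_finite f' ->
  fiber_finite (f + f').
Proof.
move=> ff ff' g; have : finite_set ([set h | rng h = rng g /\ f h != 0] `|`
    [set h | rng h = rng g /\ f' h != 0]) by rewrite finite_setU.
apply: sub_finite_set => h [rh fh]; have [fh0|] := eqVneq (f h) 0; last by left.
right; split=> //; apply: contraNN fh => /eqP fh0'.
by rewrite -[(f + f') h]/(f h + f' h) fh0 fh0' addr0.
Qed.

Lemma rng_injective_finite f : rng_injective f -> fiber_finite f.
Proof.
move=> rf g; have [[k [rk fk]]|n] := pselect (exists k, rng k = rng g /\ f k != 0).
  apply: (@sub_finite_set _ _ [set k]); last exact: finite_set1.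
  by move=> h [rh fh] /=; apply: rf => //; rewrite rh.
rewrite (_ : mkset _ = set0)//; apply/seteqP; split=> h // -[rh fh].
by apply: n; exists h.
Qed.

Lemma bisection_sum_finite f : bisection_sum f -> fiber_finite f.
Proof.
elim=> [g|b {}f [_ _ rb] _ _ ff].
  by rewrite (_ : mkset _ = set0)//; apply/seteqP; split=> h // -[_]; rewrite eqxx.
by apply: fiber_finiteD => //; exact: rng_injective_finite.
Qed.

Lemma convolDl f f' (xi : G -> R[i]) : fiber_finite f -> fiber_finite f' ->
  convol (f + f') xi = convol f xi + convol f' xi.
Proof.
move=> ff ff'; rewrite funeqE => g; rewrite -[RHS]/(convol f xi g + convol f' xi g).
pose A := [set h | rng h = rng g /\ f h != 0] `|` [set h | rng h = rng g /\ f' h != 0].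
have fA : finite_set A by rewrite finite_setU.
have E (m : G -> R[i]) : (forall h, rng h = rng g -> ~ A h -> m h = 0) ->
    convol m xi g = \sum_(h \in A) m h * xi (gmul (ginv h) g).
  move=> mA; rewrite /convol; apply/esym/fsbig_widen.
    by move=> h [[]|[]].
  by move=> h [/= rh nA]; rewrite mA// mul0r.
have fA0 h : rng h = rng g -> ~ A h -> f h = 0.
  by move=> rh nA; apply/eqP/negPn/negP => fh; apply: nA; left.
have fA0' h : rng h = rng g -> ~ A h -> f' h = 0.
  by move=> rh nA; apply/eqP/negPn/negP => fh; apply: nA; right.
rewrite !E//; last first.
  by move=> h rh nA; rewrite -[LHS]/(f h + f' h) fA0// fA0'// addr0.
rewrite -fsbig_split//=; apply: eq_fsbigr => h _.
by rewrite -[(f + f') h]/(f h + f' h) mulrDl.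
Qed.

Lemma lambdaD f f' : fiber_finite f -> fiber_finite f' ->
  lambda (f + f') = lambda f + lambda f'.
Proof.
move=> ff ff'; rewrite funeqE => xi; rewrite -[RHS]/(lambda f xi + lambda f' xi).
have [l2xi|nl2] := pselect (l2 xi); last by rewrite !lambda_out// addr0.
by rewrite !lambdaE// convolDl.
Qed.

Lemma lambda0 : lambda (0 : G -> R[i]) = 0.
Proof.
rewrite funeqE => xi; have [l2xi|nl2] := pselect (l2 xi); last by rewrite lambda_out.
by rewrite lambdaE// funeqE => g; exact: convol_eq0.
Qed.

Lemma bisection_sum_bounded f : bisection_sum f -> bounded_oper (lambda f).
Proof.
elim=> [|b {}f bb cb sf bf]; first by rewrite lambda0; exact: bounded_oper0.
rewrite lambdaD; [|by case: bb => _ _ /rng_injective_finite|exact: bisection_sum_finite].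
by apply: bounded_operD => //; apply: bounded_lambda; exact: C0bis_bisection.
Qed.

Lemma CcD f f' : Cc f -> Cc f' -> Cc (f + f').
Proof.
move=> [cf kf] [cf' kf']; split; first exact: continuous_addC.
apply: (subclosed_compact (@closed_closure _ _) (compactU kf kf')).
rewrite -closureU; apply: closureS => x /= ffx.
have [fx|fx] := eqVneq (f x) 0; [right|by left].
apply: contraNN ffx => /eqP fx'.
by rewrite -[(f + f') x]/(f x + f' x) fx fx' addr0.
Qed.

Lemma Cc0 : Cc (0 : G -> R[i]).
Proof.
split; first exact: cst_continuous.
rewrite (_ : mkset _ = set0); first by rewrite closure0; exact: compact0.
by apply/seteqP; split=> x //=; rewrite eqxx.
Qed.

Lemma bisection_sum_Cc f : bisection_sum f -> Cc f.
Proof. by elim=> [|b {}f _ cb _ cf]; [exact: Cc0|exact: CcD]. Qed.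

Lemma bisection_sum_add f f' : bisection_sum f -> bisection_sum f' ->
  bisection_sum (f + f').
Proof.
move=> sf sf'; elim: sf => [|b {}f bb cb _ IH]; first by rewrite add0r.
by rewrite -addrA; exact: bisection_sumD.
Qed.

Lemma Cc_convol b b' : C0bis b -> C0bis b' -> Cc b -> Cc b' -> Cc (convol b b').
Proof.
move=> bb bb' [cb kb] [cb' kb']; split; first exact: convol_continuous.
have [_ _ rb] := bb.
set C := closure _ in kb; set C' := closure _ in kb'.
pose K := (C `*` C') `&` [set p : G * G | src p.1 = rng p.2].
have kK : compact K.
  apply: (@compact_closedI (G * G)%type); first exact: compact_setX.
  exact: composable_closed.
have kI : compact ((fun p : G * G => gmul p.1 p.2) @` K).
  apply: continuous_compact => //.
  by apply: continuous_subspaceW (@gmul_continuous G) => p [_].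
apply: (subclosed_compact (@closed_closure _ _) kI).
rewrite [X in _ `<=` X](closure_id _).1; last first.
  exact: compact_closed (eg_hausdorff eG) kI.
apply: closureS => g /= /(convol_neq0 rb)[k [h [e -> bk bh]]].
exists (k, h) => //; split=> //; split; exact: closure_support.
Qed.

(** Biadditive extension of [lambda_comp], by induction on the first factor and, for each of its
    summands, on the second. *)
Lemma bisection_sum_convol f f' : bisection_sum f -> bisection_sum f' ->
  bisection_sum (convol f f') /\ lambda f \o lambda f' = lambda (convol f f').
Proof.
move=> sf sf'; elim: sf => [|b {}f bb cb sf [IH1 IH2]].
  have -> : convol 0 f' = 0 by rewrite funeqE => g; exact: convol_eq0.
  by split; [exact: bisection_sum0|rewrite lambda0].
have [_ _ rb] := bb; have fb := rng_injective_finite rb.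
have ff := bisection_sum_finite sf.
have bbf : bisection_sum (convol b f') /\
    lambda b \o lambda f' = lambda (convol b f').
  elim: sf' {IH1 IH2} => [|b' {}f' bb' cb' sf' [IH1 IH2]].
    have -> : convol b 0 = 0.
      by rewrite funeqE => g; apply: fsbig1 => h _; rewrite mulr0.
    split; first exact: bisection_sum0.
    rewrite lambda0 funeqE => xi /=.
    rewrite -[(0 : oper R G) xi]/(0 : G -> R[i]) lambdaE; last exact: l2_0.
    by rewrite funeqE => g; apply: fsbig1 => h _; rewrite mulr0.
  have [_ _ rb'] := bb'; have fb' := rng_injective_finite rb'.
  have ff' := bisection_sum_finite sf'.
  have E : convol b (b' + f') = convol b b' + convol b f'.
    by rewrite -{1}(scale1r b') convolDr// scale1r.
  have bbb := C0bis_convol eG bb bb'; have cbb := Cc_convol bb bb' cb cb'.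
  have [_ _ rbb] := bbb.
  rewrite E; split; first exact: bisection_sumD.
  rewrite [RHS]lambdaD; [|exact: rng_injective_finite|exact: bisection_sum_finite].
  rewrite -IH2 -lambda_comp; [|exact: C0bis_bisection..].
  rewrite lambdaD// funeqE => xi.
  rewrite -[LHS]/(lambda b (lambda b' xi + lambda f' xi)).
  rewrite -[RHS]/(lambda b (lambda b' xi) + lambda b (lambda f' xi)).
  have bbo := bounded_lambda (C0bis_bisection bb).
  have bbo' := bounded_lambda (C0bis_bisection bb').
  have bfo' := bisection_sum_bounded sf'.
  have [l2xi|nl2] := pselect (l2 xi).
    have [lin _ _] := bbo.
    by rewrite -{1}(scale1r (lambda b' xi)) lin ?scale1r//; exact: bounded_l2.
  rewrite !(lambda_out _ nl2) addr0; have [_ _ _] := bbo.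
  have l20 := @l2_0 R G.
  by have := bounded_operB0 bbo l20 l20; rewrite !subrr => ->; rewrite addr0.
have [h1 h2] := bbf; rewrite convolDl//; split; first exact: bisection_sum_add.
rewrite lambdaD// [RHS]lambdaD; [|exact: bisection_sum_finite..].
by rewrite -h2 -IH2.
Qed.

(* Partition of unity subordinate to open bisections. *)
Lemma Cc_bisection_sum f : Cc f -> bisection_sum f.
Proof.
move=> [cf kf]; set K := closure _ in kf.
have bump x : exists b : G -> R[i], [/\ C0bis b, b x = 1 & Cc b].
  by have [b [? ? ? _]] := bump_bis R eG (@openT _) (I : setT x); exists b.
have [b bP] := choice bump.
have [D KD] : exists D : seq G,
    forall z, K z -> exists2 x, x \in D & 2^-1 < nc (b x z).
  move/compact_near_coveringP :
    kf => /(_ _ (@summability.totally G)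
      (fun D z => exists2 x, x \in D & 2^-1 < nc (b x z))
      (@filter_filter _ _ (@summability.totally_filter G))).
  case=> [x Kx|D0 _ hD0].
    have [[b0 _ _] bx _] := bP x.
    have oN : open_nbhs x [set z | 2^-1 < nc (b x z)].
      split; first exact/open_nc_gt/C0_continuous.
      by rewrite /= bx nc1 invf_lt1// ltr1n.
    exists ([set z | 2^-1 < nc (b x z)], [set D : {fset G} | x \in D]) => /=.
      split; first exact: open_nbhs_nbhs.
      by exists [fset x]%fset => // D /fsubsetP; apply; rewrite inE.
    by move=> [z D] /= [Nz xD]; exists x.
  by exists D0 => z Kz; exact: hD0 (fsubset_refl D0) z Kz.
(* At each point of [K] some [b x] exceeds 1/2 in modulus, so [h] is at least 1/4 there. Replacing
   [h] by [m] changes nothing on [K] and gives a continuous divisor without zeros. *)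
pose h z : R := \sum_(x <- D) nc (b x z) ^+ 2.
pose m z : R := Num.max (h z) 4^-1.
have cb x : continuous (b x : G -> R[i]^o) by have [[/C0_continuous]] := bP x.
have ch : continuous h.
  suff ch s : continuous (fun z => \sum_(x <- s) nc (b x z) ^+ 2) by exact: ch.
  elim: s => [|x s IH].
    rewrite (_ : (fun _ => _) = cst 0); first exact: cst_continuous.
    by rewrite funeqE => z; rewrite big_nil.
  rewrite (_ : (fun _ => _) = (fun z => nc (b x z) * nc (b x z) +
      \sum_(x <- s) nc (b x z) ^+ 2)); last first.
    by rewrite funeqE => z; rewrite big_cons expr2.
  have cn := continuous_nc (cb x).
  move=> z; apply: (@cvgD R R^o); last exact: IH.
  by apply: (@cvgM R); exact: (cn z).
have m0 z : 0 < m z by rewrite lt_max invr_gt0 ltr0n orbT.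
have cm : continuous ((fun z => (m z)^-1%:C%C) : G -> R[i]^o).
  apply: continuous_realC => z; apply: (@cvgV R); first by rewrite gt_eqF.
  by apply: (@continuous_max R G h (cst 4^-1)); [exact: ch|exact: cst_continuous].
pose w x : G -> R[i] := (b x \* (fun z => (b x z)^*)) \* (f \* (fun z => (m z)^-1%:C%C)).
have cw x : continuous (w x : G -> R[i]^o).
  exact: (continuous_mulC (continuous_mulC (cb x) (continuous_conj (cb x)))
    (continuous_mulC cf cm)).
have wb x z : w x z != 0 -> b x z != 0.
  by apply: contraNN => /eqP bz; rewrite /w /= bz !mul0r.
have cbw x : C0bis (w x) /\ Cc (w x).
  have [[_ sb rb] _ [_ kb]] := bP x.
  have cw' : Cc (w x).
    split; first exact: cw.
    apply: (subclosed_compact (@closed_closure _ _) kb).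
    by apply: closureS => z; exact: wb.
  split; last exact: cw'.
  split; first exact: (Cc_C0 cw').
    by move=> k k' /wb bk /wb bk'; exact: sb.
  by move=> k k' /wb bk /wb bk'; exact: rb.
have sums s : bisection_sum (fun z => \sum_(x <- s) w x z).
  elim: s => [|x s IH].
    rewrite (_ : (fun _ => _) = 0); first exact: bisection_sum0.
    by rewrite funeqE => z; rewrite big_nil.
  rewrite (_ : (fun _ => _) = w x + (fun z => \sum_(x <- s) w x z)).
    by have [? ?] := cbw x; exact: bisection_sumD.
  by rewrite funeqE => z; rewrite big_cons.
rewrite (_ : f = fun z => \sum_(x <- D) w x z)//; rewrite funeqE => z.
rewrite /w /= -mulr_suml (_ : \sum_(x <- D) _ = (h z)%:C%C); last first.
  by rewrite /h rmorph_sum; apply: eq_bigr => x _; rewrite mulr_conj.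
have [fz|fz] := eqVneq (f z) 0; first by rewrite fz mul0r mulr0.
have /KD[x xD bxz] : K z by exact: closure_support.
have hz : 4^-1 <= h z.
  rewrite /h (big_rem x)//=.
  have : 0 <= \sum_(y <- rem x D) nc (b y z) ^+ 2.
    by apply: sumr_ge0 => y _; exact: sqr_ge0.
  move: bxz; set a := nc _; set c := \sum_(_ <- _) _ => ha hc; nra.
rewrite mulrCA -rmorphM /= /m max_l// divff ?mulr1//.
by rewrite gt_eqF// (lt_le_trans _ hz)// invr_gt0 ltr0n.
Qed.

Lemma CstarD S T : Cstar S -> Cstar T -> Cstar (S + T : oper R G).
Proof.
move=> [bS aS] [bT aT]; split; first exact: bounded_operD.
move=> e e0; have e20 : 0 < e / 2 by rewrite divr_gt0.
have [f cf fS] := aS _ e20; have [f' cf' fT] := aT _ e20.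
exists (f + f'); first exact: CcD.
rewrite lambdaD; [|exact/bisection_sum_finite/Cc_bisection_sum..].
by rewrite opprD addrACA; exact: opnorm_leD.
Qed.

Lemma CstarZ (c : R[i]) T : Cstar T -> Cstar (c *: T : oper R G).
Proof.
move=> [bT aT]; split; first exact: bounded_operZ.
move=> e e0; have c0 : 0 < nc c + 1 by rewrite ltr_wpDl ?nc_ge0.
have ec0 : 0 < e / (nc c + 1) by rewrite divr_gt0.
have [f [cf kf] fT] := aT _ ec0; exists (c *: f).
  split; first exact: (continuous_mulC (@cst_continuous _ R[i]^o c) cf).
  apply: (subclosed_compact (@closed_closure _ _) kf).
  apply: closureS => x; apply: contraNN => /eqP fx.
  by rewrite -[(c *: f) x]/(c * f x) fx mulr0.
have -> : lambda (c *: f) - c *: T = c *: (lambda f - T).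
  rewrite scalerBr; congr (_ - _); rewrite funeqE => xi.
  rewrite -[RHS]/(c *: lambda f xi).
  have [l2xi|nl2] := pselect (l2 xi); last by rewrite !lambda_out// scaler0.
  rewrite !lambdaE// funeqE => g; rewrite -[RHS]/(c * convol f xi g) /convol.
  rewrite mulr_fsumr; apply: eq_fsbigr => h _.
  by rewrite -[(c *: f) h]/(c * f h) mulrA.
apply: opnorm_le_trans (opnorm_leZ c fT).
rewrite ger0_norm; last by rewrite mulr_ge0 ?nc_ge0// ltW.
by rewrite mulrA ler_pdivrMr// mulrDr mulr1 mulrC lerDl ltW.
Qed.

Lemma CstarM S T : Cstar S -> Cstar T -> Cstar (S \o T : oper R G).
Proof.
move=> [bS aS] [bT aT]; split; first exact: bounded_oper_comp.
move=> e e0; have [MT MT0 hT] := bounded_oper_pos bT.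
(* The error splits as [(lambda f - S) \o T + lambda f \o (lambda f' - T)]. The first part is scaled
   by a bound of [T], the second by a bound of [lambda f], so [f'] is chosen after [f]. *)
have e10 : 0 < e / 2 / MT by rewrite !divr_gt0.
have [f cf fS] := aS _ e10; have sf := Cc_bisection_sum cf.
have bf := bisection_sum_bounded sf; have [Mf Mf0 hf] := bounded_oper_pos bf.
have e20 : 0 < e / 2 / Mf by rewrite !divr_gt0.
have [f' cf' fT] := aT _ e20; have sf' := Cc_bisection_sum cf'.
have bf' := bisection_sum_bounded sf'.
have [sff E] := bisection_sum_convol sf sf'.
exists (convol f f'); first exact: bisection_sum_Cc.
have h1 : opnorm_le ((lambda f - S) \o T) (e / 2).
  rewrite (_ : e / 2 = e / 2 / MT * MT); last by rewrite divfK// gt_eqF.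
  by apply: opnorm_le_comp => // xi; exact: bounded_l2.
have h2 : opnorm_le (lambda f \o (lambda f' - T)) (e / 2).
  rewrite (_ : e / 2 = Mf * (e / 2 / Mf)); last by rewrite [RHS]mulrC divfK// gt_eqF.
  apply: opnorm_le_comp => // xi l2xi.
  rewrite -[(lambda f' - T) xi]/(lambda f' xi - T xi) -scaleN1r.
  apply: l2D; first exact: bounded_l2.
  by apply: l2Z; exact: bounded_l2.
move=> xi l2xi; have := opnorm_leD h1 h2 l2xi; rewrite -E.
rewrite -[((_ \o _) + _) xi]/((lambda f (T xi) - S (T xi)) +
  lambda f (lambda f' xi - T xi)).
rewrite (bounded_operB0 bf); [|exact: bounded_l2..].
have cancel_mid (a b c : G -> R[i]) : (a - b) + (c - a) = c - b.
  by rewrite addrC addrA subrK.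
by rewrite cancel_mid.
Qed.

End CstarAlgebra.

(** * Subalgebras of the semidirect product *)

Section RetractEmbedding.
Variables (R : realType) (H K : topGroupoid) (j : H -> K) (r : K -> H).

(* The canonical embeddings into a semidirect product have clopen range and a
   continuous retraction, so that extension by zero preserves continuity. *)
Record retract_embedding : Prop := {
  re_morphism : groupoid_morphism j ;
  re_continuous : continuous j ;
  re_retract_continuous : continuous r ;
  re_cancel : cancel j r ;
  re_open : open (range j) ;
  re_closed : closed (range j) }.

Hypothesis rj : retract_embedding.
Implicit Types (f : H -> R[i]) (F : K -> R[i]).

Let jK : cancel j r. Proof. by case: rj. Qed.

Lemma extend0_in f x : extend0 j f (j x) = f x.
Proof.
rewrite /extend0 (_ : j @^-1` [set j x] = [set x]) ?fsbig_set1//.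
apply/seteqP; split=> [y /= /(can_inj jK)//|_ ->//].
Qed.

Lemma extend0_out f y : ~ range j y -> extend0 j f y = 0.
Proof.
move=> ny; rewrite /extend0 (_ : j @^-1` [set y] = set0) ?fsbig_set0//.
by apply/seteqP; split=> x //= xy; apply: ny; exists x.
Qed.

Lemma extend0_comp_j F : (forall y, F y != 0 -> range j y) ->
  extend0 j (F \o j) = F.
Proof.
move=> hF; rewrite funeqE => y; have [[x _ <-]|ny] := pselect (range j y).
  by rewrite extend0_in.
by rewrite extend0_out//; apply/esym/eqP/negPn/negP => /hF.
Qed.

Lemma extend0_continuous f : continuous (f : H -> R[i]^o) ->
  continuous (extend0 j f : K -> R[i]^o).
Proof.
move=> cf; have cfr : continuous ((f \o r) : K -> R[i]^o).
  move=> y; apply: (@continuous_comp _ _ R[i]^o r f); last exact: cf.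
  exact: re_retract_continuous rj _.
apply/nc_continuousP => y e e0; have [jy|ny] := pselect (range j y).
  have nj : nbhs y (range j) by apply: open_nbhs_nbhs; split=> //; exact: re_open.
  move/nc_continuousP : cfr => /(_ y e e0) nf.
  apply: (filterS2 _ _ nj nf) => z [x _ <-] /=; case: jy => x' _ <-.
  by rewrite !extend0_in !jK.
have nj : nbhs y (~` range j).
  by apply: open_nbhs_nbhs; split=> //; apply: closed_openC; exact: re_closed.
by apply: filterS nj => z nz; rewrite !extend0_out// subrr nc0.
Qed.

Lemma extend0_Cc f : Cc f -> Cc (extend0 j f).
Proof.
move=> [cf kf]; split; first exact: extend0_continuous.
set C := closure _ in kf.
have kj : compact (j @` C).
  apply: continuous_compact => //; apply: continuous_subspaceT.
  exact: re_continuous.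
apply: (subclosed_compact (@closed_closure _ _) kj).
have cl : closed (j @` C).
  rewrite (_ : j @` C = range j `&` r @^-1` C).
    apply: closedI; first exact: re_closed.
    apply: preimage_closed => [y _|]; last exact: closed_closure.
    exact: re_retract_continuous rj _.
  apply/seteqP; split=> [_ [x Cx <-]|_ [[x _ <-] /= Cx]].
    by split; [exists x|rewrite /= jK].
  by exists x => //; move: Cx; rewrite jK.
rewrite [X in _ `<=` X](closure_id _).1//; apply: closureS => y /= fy.
have [[x _ xy]|ny] := pselect (range j y); last first.
  by move: fy; rewrite extend0_out// eqxx.
exists x => //; apply: closure_support.
by move: fy; rewrite -xy extend0_in.
Qed.

Lemma extend0_C0 f : C0 f -> C0 (extend0 j f).
Proof.
move=> [cf f0]; split; first exact: extend0_continuous.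
move=> e e0; have [C kC hC] := f0 e e0; exists (j @` C).
  apply: continuous_compact => //; apply: continuous_subspaceT.
  exact: re_continuous.
move=> y ny; have [[x _ xy]|nr] := pselect (range j y); last first.
  by rewrite extend0_out// nc0.
by rewrite -xy extend0_in; apply: hC => Cx; apply: ny; exists x.
Qed.

Lemma comp_continuous F : continuous (F : K -> R[i]^o) ->
  continuous ((F \o j) : H -> R[i]^o).
Proof.
move=> cF x; apply: (@continuous_comp _ _ R[i]^o j F); last exact: cF.
exact: re_continuous rj _.
Qed.

Lemma comp_C0 F : C0 F -> C0 (F \o j).
Proof.
move=> [cF F0]; split; first exact: comp_continuous.
move=> e e0; have [C kC hC] := F0 e e0; exists (r @` C).
  apply: continuous_compact => //; apply: continuous_subspaceT.
  exact: re_retract_continuous.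
by move=> x nx; apply: hC => Cx; apply: nx; exists (j x).
Qed.

Lemma comp_Cc F : Cc F -> Cc (F \o j).
Proof.
move=> [cF kF]; split; first exact: comp_continuous.
set C := closure _ in kF.
have kr : compact (r @` C).
  apply: continuous_compact => //; apply: continuous_subspaceT.
  exact: re_retract_continuous.
apply: (subclosed_compact (@closed_closure _ _) kr).
have cl : closed (j @^-1` C).
  apply: preimage_closed => [x _|]; last exact: closed_closure.
  exact: re_continuous rj _.
have sub : closure [set x | (F \o j) x != 0] `<=` j @^-1` C.
  rewrite [X in _ `<=` X](closure_id _).1//; apply: closureS => x /= fx.
  exact: closure_support.
by move=> x /sub Cx; exists (j x) => //; exact: jK.
Qed.

Lemma Cstar_image_Cstar T : Cstar_image j T -> Cstar (T : oper R K).
Proof.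
move=> [bT [S _ [f_ [cf _ cvT]]]]; split=> // e e0.
have [n _ hn] := cvT e e0; exists (extend0 j (f_ n)); first exact: extend0_Cc.
exact: hn n (leqnn n).
Qed.

(** Coefficients are continuous for the operator norm and vanish off the range of [j] for every
    approximant. *)
Lemma Cstar_image_coef T y : Cstar_image j T -> ~ range j y ->
  coef (T : oper R K) y = 0.
Proof.
move=> [bT [S _ [f_ [cf _ cvT]]]] ny; apply: eq_nc_small => e e0.
have [n _ hn] := cvT e e0.
have := opnorm_le_coord (src y) y (ltW e0) (hn n (leqnn n)).
rewrite -/(coef _ _) -/(coef T y) coef_lambda extend0_out// sub0r ncN.
by rewrite subr0.
Qed.

Lemma Cstar_image_lambda F : C0bis F -> Cc F ->
  (forall y, F y != 0 -> range j y) -> Cstar_image j (lambda F).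
Proof.
move=> bF cF hF; have jM := re_morphism rj.
have [F0 sF rF] := bF.
split; first exact/bounded_lambda/C0bis_bisection.
exists (lambda (F \o j)).
  apply: C0bis_Cstar; split; first exact: comp_C0.
    move=> x x' Fx Fx' e; apply: (can_inj jK); apply: sF => //.
    by rewrite !(morph_src jM) e.
  move=> x x' Fx Fx' e; apply: (can_inj jK); apply: rF => //.
  by rewrite !(morph_rng jM) e.
have op0 (T : choiceType) (A : oper R T) (e : R) : opnorm_le (A - A) e.
  move=> xi _; rewrite subrr -[(0 : oper R T) xi]/(0 : T -> R[i]).
  rewrite [leLHS](_ : _ = 0%E) ?mule_ge0 ?l2normsq_ge0 ?lee_fin ?sqr_ge0//.
  by rewrite /l2normsq esum1// => x _; rewrite nc0 expr0n.
exists (fun=> F \o j); split.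
- by move=> _; exact: comp_Cc.
- by move=> e _; apply: nearW => n; exact: op0.
- by move=> e _; apply: nearW => n; rewrite extend0_comp_j//; exact: op0.
Qed.

End RetractEmbedding.

Section Embeddings.
Variables (R : realType) (Gamma : groupType) (G : topGroupoid)
  (alpha : gpd_action Gamma G).
Hypothesis eG : etale_groupoid G.
Local Notation K := (semidirect alpha).

Let eK : etale_groupoid K := semidirect_etale alpha eG.

Let closed_units : closed (units G).
Proof.
apply: (@closed_equalizer G G src idfun); first exact: eg_hausdorff eG.
  exact: src_continuous.
by move=> x; exact: cvg_id.
Qed.

Let open_snd (U : set G) : open U -> open [set p : K | U p.2].
Proof. by move=> oU; apply: sd_openP. Qed.

Let open_fst (B : Gamma -> Prop) : open [set p : K | B p.1].
Proof.
apply: sd_openP => d; have [Bd|nB] := pselect (B d).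
  rewrite (_ : mkset _ = setT); first exact: openT.
  by apply/seteqP; split.
rewrite (_ : mkset _ = set0); first exact: open0.
by apply/seteqP; split.
Qed.

Let sd_snd_continuous : continuous (snd : K -> G).
Proof. by move=> p; exact: cvg_snd. Qed.

Lemma range_emb_crossed : range (@emb_crossed Gamma G alpha) =
  [set p | units G p.2].
Proof.
apply/seteqP; split=> [_ [[c u] _ <-]|[c g] /= ug].
  by rewrite /=; exact: (set_mem (valP u)).
by exists (c, exist _ g (mem_set ug)).
Qed.

Lemma range_emb_groupoid : range (@emb_groupoid Gamma G alpha) =
  [set p | p.1 = 1%g].
Proof.
apply/seteqP; split=> [_ [g _ <-]//|[c g] /= ->].
by exists g.
Qed.

Lemma range_emb_units : range (@emb_units Gamma G alpha) = units K.
Proof.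
apply/seteqP; split=> [_ [u _ <-]|[c g] /sd_units[/= -> ug]].
  by apply/sd_units; split=> //; exact: (set_mem (valP u)).
by exists (exist _ g (mem_set ug)).
Qed.

Lemma usrc_val (u : set_type (units G)) : usrc (val u) = u.
Proof. by apply: val_inj; exact: (set_mem (valP u)). Qed.

Lemma retract_emb_groupoid :
  retract_embedding (@emb_groupoid Gamma G alpha) (snd : K -> G).
Proof.
split.
- move=> g h gh; split.
    by rewrite /composable /= /sd_src /sd_rng /= act1 (gh : src g = rng h).
  by rewrite /emb_groupoid /= /sd_mul /= mulg1 invg1 act1.
- by apply: sd_pair_cont => x; exact: cvg_id.
- exact: sd_snd_continuous.
- by [].
- by rewrite range_emb_groupoid; exact: (@open_fst (fun c : Gamma => c = 1%g)).
- rewrite range_emb_groupoid -openC (_ : ~` _ = [set p : K | p.1 <> 1%g])//.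
  exact: (@open_fst (fun c : Gamma => c <> 1%g)).
Qed.

Lemma retract_emb_crossed :
  retract_embedding (@emb_crossed Gamma G alpha)
    (fun p : K => (p.1, usrc p.2) : semidirect (unit_action alpha)).
Proof.
split.
- move=> x y xy; split; first exact/emb_crossed_comp.
  exact: emb_crossed_mul.
- move=> x; apply: (@cvg_pair _ _ _ (nbhs x) (nbhs (x.1 : discrete_topology Gamma))
    (nbhs (val x.2 : G))); first exact: cvg_fst.
  apply: (@continuous_comp (discrete_topology Gamma * set_type (units G))%type
    (set_type (units G)) G snd val); first exact: cvg_snd.
  exact: initial_continuous.
- move=> x; apply: (@cvg_pair _ _ _ (nbhs x) (nbhs (x.1 : discrete_topology Gamma))
    (nbhs (usrc x.2))); first exact: cvg_fst.
  apply: (@continuous_comp (discrete_topology Gamma * G)%type G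
    (set_type (units G)) snd (@usrc G)); first exact: cvg_snd.
  exact: usrc_continuous.
- by move=> [c u]; rewrite /emb_crossed /= usrc_val.
- by rewrite range_emb_crossed; apply: open_snd; exact: eg_open_units eG.
- rewrite range_emb_crossed -openC.
  exact: (open_snd (closed_openC closed_units)).
Qed.

Lemma retract_emb_units :
  @retract_embedding (space_groupoid (set_type (units G))) K
    (@emb_units Gamma G alpha) (fun p => usrc p.2).
Proof.
split.
- move=> u v uv; have uu : units G (val u) := set_mem (valP u).
  rewrite -(uv : u = v) /composable /= /sd_src /sd_rng /= /emb_units /= act1.
  rewrite (unit_rng uu) (uu : src _ = _); split=> //.
  by rewrite /sd_mul /= mulg1 invg1 act1 gmul_srcE.
- apply: sd_pair_cont => u; exact: initial_continuous.
- move=> x; apply: (@continuous_comp (discrete_topology Gamma * G)%type G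
    (set_type (units G)) snd (@usrc G)); first exact: cvg_snd.
  exact: usrc_continuous.
- by move=> u; rewrite /emb_units /= usrc_val.
- by rewrite range_emb_units; exact: eg_open_units eK.
- rewrite range_emb_units.
  apply: (@closed_equalizer K K src idfun); first exact: eg_hausdorff eK.
    exact: src_continuous.
  by move=> x; exact: cvg_id.
Qed.

(** Passes from functions on the subtype of units, extended by zero, to functions on the groupoid
    supported on units, the form used by [cartan_morphism]. *)
Lemma alg_unitsE : alg_units R alpha = [set lambda F | F in @C0units R K].
Proof.
have re := retract_emb_units.
apply/seteqP; split=> [_ [f f0 <-]|_ [F [F0 Fu] <-]].
  exists (extend0 (emb_units alpha) f) => //; split.
    exact: (extend0_C0 re).
  move=> y; have [[u _ <-] _|ny] := pselect (range (emb_units alpha) y).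
    by rewrite -range_emb_units; exists u.
  by rewrite (@extend0_out R (space_groupoid _) K _ f y ny) eqxx.
exists (F \o emb_units alpha); first exact: (comp_C0 re F0).
rewrite (extend0_comp_j re)// => y /Fu uy.
by rewrite range_emb_units.
Qed.

End Embeddings.

(** * From a star isomorphism to an isomorphism of groupoids *)

Section StarIso.
Variables (R : realType) (K1 K2 : topGroupoid).
Hypotheses (e1 : etale_groupoid K1) (e2 : etale_groupoid K2).
Variable theta : oper R K1 -> oper R K2.
Hypothesis iso : star_iso (@Cstar R K1) (@Cstar R K2) theta.
Hypothesis theta_units : theta @` [set lambda F | F in @C0units R K1] =
  [set lambda F | F in @C0units R K2].

Lemma star_iso_cartan : cartan_morphism theta.
Proof.
have [[fun_ inj_ surj_] D_ Z_ M_ _] := iso; split=> //.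
move=> f fu; have : (theta @` [set lambda F | F in @C0units R K1]) (theta (lambda f)).
  by exists (lambda f) => //; exists f.
by rewrite theta_units => -[f' fu' E]; exists f'.
Qed.

(** Each identity for [theta'] comes from applying it to the one for [theta]. This requires sums,
    multiples and products to stay in [Cstar], where [theta'] is known to undo [theta]. *)
Lemma star_iso_inverse : exists theta' : oper R K2 -> oper R K1,
  [/\ cartan_morphism theta', forall T, Cstar T -> theta' (theta T) = T &
     forall S, Cstar S -> theta (theta' S) = S].
Proof.
have [[fun_ inj_ surj_] D_ Z_ M_ _] := iso.
have ex S : exists T, Cstar S -> Cstar T /\ theta T = S.
  have [cS|nS] := pselect (Cstar S); last by exists 0.
  by have [T cT E] := surj_ S cS; exists T.
have [theta' hth] := choice ex.
have cth S : Cstar S -> Cstar (theta' S) by move=> /hth[].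
have thV S : Cstar S -> theta (theta' S) = S by move=> /hth[].
have thK T : Cstar T -> theta' (theta T) = T.
  move=> cT; have cT' := fun_ _ cT.
  by apply: inj_; rewrite ?inE ?thV//; exact: cth.
exists theta'; split=> //; split=> //.
- move=> S T cS cT; have [cS' cT'] := (cth _ cS, cth _ cT).
  by rewrite -{1}(thV S)// -{1}(thV T)// -D_// thK//; exact: CstarD.
- move=> c S cS; have cS' := cth _ cS.
  by rewrite -{1}(thV S)// -Z_// thK//; exact: CstarZ.
- move=> S T cS cT; have [cS' cT'] := (cth _ cS, cth _ cT).
  by rewrite -{1}(thV S)// -{1}(thV T)// -M_// thK//; exact: CstarM.
- move=> f' fu'; have : [set lambda F | F in @C0units R K2] (lambda f') by exists f'.
  rewrite -theta_units => -[_ [f fu <-] E]; exists f => //.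
  by rewrite -E thK//; exact: Cstar_units.
Qed.

End StarIso.

Lemma Cstar_iso_semidirect (R : realType) (Gamma1 Gamma2 : groupType)
    (G1 G2 : topGroupoid)
    (alpha1 : gpd_action Gamma1 G1) (alpha2 : gpd_action Gamma2 G2) :
  etale_groupoid G1 -> etale_groupoid G2 ->
  topologically_principally_free alpha1 ->
  topologically_principally_free alpha2 ->
  Cstar_iso_preserving R alpha1 alpha2 -> semidirect_iso_preserving alpha1 alpha2.
Proof.
move=> e1 e2 f1 f2 [theta [iso thU thX thG]].
have eK1 := semidirect_etale alpha1 e1; have eK2 := semidirect_etale alpha2 e2.
have p1 := principal_dense_semidirect f1; have p2 := principal_dense_semidirect f2.
move: thU; rewrite !alg_unitsE// => thU.
have cm := star_iso_cartan iso thU.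
have [theta' [cm' thK thV]] := star_iso_inverse eK1 iso thU.
have [sg [su sE si ss sc]] := unit_map eK1 eK2 cm cm' thK thV.
have [psi [psi_iso psiE psiE']] :=
  reconstruction eK1 eK2 p1 p2 cm cm' thK thV (star_isoJ iso) su sE si ss sc.
have [phi [psiK phiK _ _ _]] := psi_iso.
(* One argument serves both subgroupoids: a bump function at [p] supported in the range of [j1] has
   an image whose coefficient at [psi p] is nonzero, while all its coefficients off the range of
   [j2] vanish. The other inclusion runs in the same way through [theta']. *)
have image_sub (H1 H2 : topGroupoid) (j1 : H1 -> semidirect alpha1)
    (j2 : H2 -> semidirect alpha2) r1 r2 :
    retract_embedding j1 r1 -> retract_embedding j2 r2 ->
    theta @` Cstar_image j1 = Cstar_image j2 -> psi @` range j1 = range j2.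
  move=> re1 re2 thJ; apply/seteqP; split=> [_ [p jp <-]|k jk].
    have [F [bF Fp cF FJ]] := bump_bis R eK1 (re_open re1) jp.
    have Fp0 : F p != 0 by rewrite Fp oner_neq0.
    have FJ' y : F y != 0 -> range j1 y by move=> Fy; apply/FJ/closure_support.
    have : Cstar_image j2 (theta (lambda F)).
      by rewrite -thJ; exists (lambda F) => //; exact: (Cstar_image_lambda re1).
    move=> im; apply: contrapT => nj.
    have := Cstar_image_coef im nj; move/eqP; apply/negP.
    by rewrite psiE.
  have [F [bF Fk cF FJ]] := bump_bis R eK2 (re_open re2) jk.
  have Fk0 : F k != 0 by rewrite Fk oner_neq0.
  have FJ' y : F y != 0 -> range j2 y by move=> Fy; apply/FJ/closure_support.
  have := Cstar_image_lambda re2 bF cF FJ'.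
  rewrite -thJ => -[T imT E].
  have cT := Cstar_image_Cstar re1 imT.
  exists (phi k); last exact: phiK.
  apply: contrapT => nj; have := Cstar_image_coef imT nj.
  move/eqP; apply/negP; rewrite -(thK _ cT) E psiE'//.
  by rewrite phiK.
exists psi; split=> //.
- rewrite -(range_emb_crossed alpha1) -(range_emb_crossed alpha2).
  exact: (image_sub _ _ _ _ _ _ (retract_emb_crossed alpha1 e1)
    (retract_emb_crossed alpha2 e2) thX).
- rewrite -(range_emb_groupoid alpha1) -(range_emb_groupoid alpha2).
  exact: (image_sub _ _ _ _ _ _ (retract_emb_groupoid alpha1)
    (retract_emb_groupoid alpha2) thG).
Qed.

Theorem corollary2 (R : realType) (Gamma1 Gamma2 : groupType)
  (G1 G2 : topGroupoid)
  (countable_Gamma1 : countable [set: Gamma1])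
  (countable_Gamma2 : countable [set: Gamma2])
  (etale_G1 : lcsc_hausdorff_etale G1)
  (etale_G2 : lcsc_hausdorff_etale G2)
  (alpha1 : gpd_action Gamma1 G1) (alpha2 : gpd_action Gamma2 G2)
  (free_alpha1 : topologically_free alpha1)
  (free_alpha2 : topologically_free alpha2) :
  [/\ coe alpha1 alpha2 <-> semidirect_iso_preserving alpha1 alpha2,
      semidirect_iso_preserving alpha1 alpha2 ->
        Cstar_iso_preserving R alpha1 alpha2 &
      topologically_principally_free alpha1 ->
      topologically_principally_free alpha2 ->
        (coe alpha1 alpha2 <-> semidirect_iso_preserving alpha1 alpha2) /\
        (semidirect_iso_preserving alpha1 alpha2 <->
          Cstar_iso_preserving R alpha1 alpha2)].
Proof.
have e1 := lcsc_etale_groupoid etale_G1.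
have e2 := lcsc_etale_groupoid etale_G2.
have coeE : coe alpha1 alpha2 <-> semidirect_iso_preserving alpha1 alpha2.
  by split; [exact: coe_semidirect_iso|exact: semidirect_iso_coe].
have isoC := @semidirect_iso_Cstar R _ _ _ _ alpha1 alpha2.
split=> // f1 f2; split=> //; split=> //.
exact: Cstar_iso_semidirect.
Qed.
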